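(* Consider the Kerr metric with $m=1$, $0\le a\le1$, and put $r_+=1+(1-a^2)^{1/2}$ and $\epsilon=a/r$. There is $\epsilon_0>0$ (independent of $r,a$) such that if $r\ge 2$, or if $r\ge r_+$ and $\epsilon\le\epsilon_0$, then the Brown-York quasilocal energy of the spacelike surface $\mathcal S(r)$ ($r=\text{constant}$, $t=\text{constant}$) is given by $$\mathfrak m_{\mathrm{BY}}(\mathcal S(r))=E(\mathbf N,\Omega(r);0,0).$$
   Context: In Boyer-Lindquist coordinates the slice $t=\text{constant}$ of Kerr spacetime has induced metric $H\,d\varphi^2+R^2dr^2+\Sigma^2d\theta^2$ ($0\le\theta\le\pi$, $0\le\varphi<2\pi$), where, with $m=1$, $\Sigma^2=r^2+a^2\cos^2\theta$, $\Delta=r^2-2r+a^2$, $R^2=\Sigma^2/\Delta$, $H=\dfrac{\sin^2\theta\left((r^2+a^2)^2-\Delta a^2\sin^2\theta\right)}{\Sigma^2}$, and $r_+$ is the largest root of $\Delta=0$. $\mathcal S(r)$ has induced metric $d\sigma^2=\Sigma^2d\theta^2+H\,d\varphi^2$, and $\Omega(r)$ is the domain in the slice with boundary $\mathcal S(r)$; $\mathbf N=\partial_T$. Subscripts $r,\theta$ denote partial derivatives. The quasilocal energy, for functions $x(\theta),y(\theta)$, is $$E(\mathbf N,\Omega(r);x,y)=-\int_0^{2\pi}\left(\int_0^\pi\left(\frac{AH_\theta}{D}\frac{xy}{\beta\ell}+\frac AD\frac{\alpha}{\ell}+\frac CD\frac1\beta\right)d\theta\right)d\varphi,$$ where $A=\Sigma(H\Sigma^2)_r$,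 $C=2HR^2(H_{\theta\theta}\Sigma-H_\theta\Sigma_\theta-2\Sigma^3)$, $D=16\pi H^{1/2}R^2\Sigma$, $\alpha=(x^2\Sigma^2+R^2(y^2+\Sigma^2))^{1/2}$, $\beta=(-H_\theta^2+4H(y^2+\Sigma^2))^{1/2}$, $\ell=y^2+\Sigma^2$. The Brown-York quasilocal energy of $\mathcal S(r)$ with respect to the slice is $\mathfrak m_{\mathrm{BY}}(\mathcal S(r))=\frac1{8\pi}\int_{\mathcal S(r)}(\kappa_0-\kappa)\,d\sigma$, where $\kappa$ is the mean curvature of $\mathcal S(r)$ in the slice with respect to the unit normal $\nu=R^{-1}\partial_r$, and $\kappa_0$ is the mean curvature, with respect to the outward unit normal, of $\mathcal S(r)$ isometrically embedded in $\mathbb R^3$ as a closed surface of positive Gaussian curvature (the embedding is unique up to rigid motions). Mean curvature is the sum of the principal curvatures, positive for round spheres in $\mathbb R^3$ with respect to the outward normal. In the borderline case $r=r_+$ (where $\Delta=0$), the factor $1/R=\Delta^{1/2}/\Sigma$ is understood to be $0$, i.e. $\kappa$ and the integrand of $E$ at $x=y=0$ are understood as limits $r\downarrow r_+$. *)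

(* Defs.v *)
From Stdlib Require Import Reals.
From Coquelicot Require Import Coquelicot.
Open Scope R_scope.

(* Kerr metric with m = 1 in Boyer-Lindquist coordinates: the slice t = constant
   has the metric H dphi^2 + RR^2 dr^2 + Sigma^2 dtheta^2. *)
Definition Delta (a r : R) : R := r ^ 2 - 2 * r + a ^ 2.

Definition Sigma (a r theta : R) : R := sqrt (r ^ 2 + a ^ 2 * cos theta ^ 2).

Definition RR (a r theta : R) : R := sqrt (Sigma a r theta ^ 2 / Delta a r).

Definition H (a r theta : R) : R :=
  sin theta ^ 2 * ((r ^ 2 + a ^ 2) ^ 2 - Delta a r * a ^ 2 * sin theta ^ 2)
  / Sigma a r theta ^ 2.

Definition r_plus (a : R) : R := 1 + sqrt (1 - a ^ 2).

Definition right_limit (f : R -> R) (r : R) : R :=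
  iota (fun l : R => filterlim f (at_right r) (locally l)).

(* [RR] is infinite where [Delta = 0]; there, and only there, a quantity
   depending on [r] is read as its limit from the right. *)
Definition horizon_ext (a : R) (f : R -> R) (r : R) : R :=
  if Req_EM_T (Delta a r) 0 then right_limit f r else f r.

Definition H_th (a r theta : R) : R := Derive (fun t => H a r t) theta.
Definition H_thth (a r theta : R) : R := Derive (fun t => H_th a r t) theta.
Definition Sigma_th (a r theta : R) : R := Derive (fun t => Sigma a r t) theta.

Definition coefA (a r theta : R) : R :=
  Sigma a r theta * Derive (fun s => H a s theta * Sigma a s theta ^ 2) r.

Definition coefC (a r theta : R) : R :=
  2 * H a r theta * RR a r theta ^ 2 *
  (H_thth a r theta * Sigma a r theta - H_th a r theta * Sigma_th a r theta
   - 2 * Sigma a r theta ^ 3).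

Definition coefD (a r theta : R) : R :=
  16 * PI * sqrt (H a r theta) * RR a r theta ^ 2 * Sigma a r theta.

Definition ell (a r theta y : R) : R := y ^ 2 + Sigma a r theta ^ 2.

Definition alpha (a r theta x y : R) : R :=
  sqrt (x ^ 2 * Sigma a r theta ^ 2
        + RR a r theta ^ 2 * (y ^ 2 + Sigma a r theta ^ 2)).

Definition beta (a r theta y : R) : R :=
  sqrt (- H_th a r theta ^ 2
        + 4 * H a r theta * (y ^ 2 + Sigma a r theta ^ 2)).

Definition energy_integrand (a theta x y r : R) : R :=
  coefA a r theta * H_th a r theta / coefD a r theta
    * (x * y / (beta a r theta y * ell a r theta y))
  + coefA a r theta / coefD a r theta
    * (alpha a r theta x y / ell a r theta y)
  + coefC a r theta / coefD a r theta * (1 / beta a r theta y).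

Definition energy (a r : R) (x y : R -> R) : R :=
  - RInt (fun _ : R =>
      RInt (fun theta =>
        horizon_ext a (energy_integrand a theta (x theta) (y theta)) r) 0 PI)
    0 (2 * PI).

(* Trace of the shape operator, i.e. sum of the principal curvatures, for first
   and second fundamental forms [g] and [h]. *)
Definition mean_curvature (g11 g12 g22 h11 h12 h22 : R) : R :=
  (g22 * h11 - 2 * g12 * h12 + g11 * h22) / (g11 * g22 - g12 ^ 2).

Definition gauss_curvature (g11 g12 g22 h11 h12 h22 : R) : R :=
  (h11 * h22 - h12 ^ 2) / (g11 * g22 - g12 ^ 2).

Inductive coord : Set := cphi | crad | ctheta.

Definition coord_eq_dec (i j : coord) : {i = j} + {i <> j}.
Proof. decide equality. Defined.

Definition point : Type := coord -> R.

Definition upd (p : point) (i : coord) (t : R) : point :=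
  fun j => if coord_eq_dec i j then t else p j.

Definition partial (i : coord) (f : point -> R) (p : point) : R :=
  Derive (fun t => f (upd p i t)) (p i).

Definition sum_coord (f : coord -> R) : R := f cphi + f crad + f ctheta.

Definition slice_metric (a : R) (i j : coord) (p : point) : R :=
  match i, j with
  | cphi, cphi => H a (p crad) (p ctheta)
  | crad, crad => RR a (p crad) (p ctheta) ^ 2
  | ctheta, ctheta => Sigma a (p crad) (p ctheta) ^ 2
  | _, _ => 0
  end.

Definition slice_normal (a : R) (i : coord) (p : point) : R :=
  match i with
  | crad => / RR a (p crad) (p ctheta)
  | _ => 0
  end.

(* Christoffel symbol of the first kind, g(nabla_i d_k, d_j). *)
Definition christoffel (g : coord -> coord -> point -> R) (i k j : coord)
    (p : point) : R :=
  (partial i (g k j) p + partial k (g i j) p - partial j (g i k) p) / 2.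

(* g(nabla_i nu, d_j) *)
Definition second_form (g : coord -> coord -> point -> R)
    (nu : coord -> point -> R) (i j : coord) (p : point) : R :=
  sum_coord (fun k =>
    partial i (nu k) p * g k j p + nu k p * christoffel g i k j p).

Definition slice_point (r theta phi : R) : point :=
  fun i => match i with cphi => phi | crad => r | ctheta => theta end.

Definition kappa (a theta phi r : R) : R :=
  let p := slice_point r theta phi in
  let g i j := slice_metric a i j p in
  let h i j := second_form (slice_metric a) (slice_normal a) i j p in
  mean_curvature (g ctheta ctheta) (g ctheta cphi) (g cphi cphi)
                 (h ctheta ctheta) (h ctheta cphi) (h cphi cphi).

Definition vec3 : Type := (R * R * R)%type.

Definition vx (v : vec3) : R := fst (fst v).
Definition vy (v : vec3) : R := snd (fst v).
Definition vz (v : vec3) : R := snd v.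

Definition dot (v w : vec3) : R := vx v * vx w + vy v * vy w + vz v * vz w.

Definition vsub (v w : vec3) : vec3 := (vx v - vx w, vy v - vy w, vz v - vz w).

Definition patch : Type := R -> R -> vec3.

Definition d1 (Y : patch) : patch := fun u v =>
  (Derive (fun t => vx (Y t v)) u,
   Derive (fun t => vy (Y t v)) u,
   Derive (fun t => vz (Y t v)) u).

Definition d2 (Y : patch) : patch := fun u v =>
  (Derive (fun t => vx (Y u t)) v,
   Derive (fun t => vy (Y u t)) v,
   Derive (fun t => vz (Y u t)) v).

Definition g11 (Y : patch) (u v : R) : R := dot (d1 Y u v) (d1 Y u v).
Definition g12 (Y : patch) (u v : R) : R := dot (d1 Y u v) (d2 Y u v).
Definition g22 (Y : patch) (u v : R) : R := dot (d2 Y u v) (d2 Y u v).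

(* [n] is the unit normal along the patch.  Since [<n, d_j Y> = 0], one has
   [<d_i n, d_j Y> = - <d_i d_j Y, n>]; this is positive definite for a round
   sphere with its outward normal. *)
Definition h11 (Y n : patch) (u v : R) : R := - dot (d1 (d1 Y) u v) (n u v).
Definition h12 (Y n : patch) (u v : R) : R := - dot (d1 (d2 Y) u v) (n u v).
Definition h22 (Y n : patch) (u v : R) : R := - dot (d2 (d2 Y) u v) (n u v).

Definition patch_mean_curvature (Y n : patch) (u v : R) : R :=
  mean_curvature (g11 Y u v) (g12 Y u v) (g22 Y u v)
                 (h11 Y n u v) (h12 Y n u v) (h22 Y n u v).

Definition patch_gauss_curvature (Y n : patch) (u v : R) : R :=
  gauss_curvature (g11 Y u v) (g12 Y u v) (g22 Y u v)
                  (h11 Y n u v) (h12 Y n u v) (h22 Y n u v).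

Definition on_sphere (p : vec3) : Prop := dot p p = 1.

(* Spherical coordinates about the z-axis and about the x-axis: together, for
   [0 < theta < PI], they cover the whole unit sphere.  [S(r)] is the unit
   sphere with [(theta, phi)] the coordinates of [sph_z]. *)
Definition sph_z : patch := fun theta phi =>
  (sin theta * cos phi, sin theta * sin phi, cos theta).
Definition sph_x : patch := fun theta phi =>
  (cos theta, sin theta * cos phi, sin theta * sin phi).

Definition in_chart (c : patch) (F : vec3 -> vec3) : patch :=
  fun theta phi => F (c theta phi).

Definition smooth_patch (Y : patch) : Prop :=
  forall (n : nat) (theta phi : R), 0 < theta < PI ->
    ex_diff_n (fun u v => vx (Y u v)) n theta phi /\
    ex_diff_n (fun u v => vy (Y u v)) n theta phi /\
    ex_diff_n (fun u v => vz (Y u v)) n theta phi.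

Definition smooth_on_sphere (F : vec3 -> vec3) : Prop :=
  smooth_patch (in_chart sph_z F) /\ smooth_patch (in_chart sph_x F).

Definition normal_along (Y n : patch) : Prop :=
  forall theta phi, 0 < theta < PI ->
    dot (n theta phi) (d1 Y theta phi) = 0 /\
    dot (n theta phi) (d2 Y theta phi) = 0.

Definition positively_curved (Y n : patch) : Prop :=
  forall theta phi, 0 < theta < PI -> 0 < patch_gauss_curvature Y n theta phi.

(* [X] is an isometric embedding of [S(r)] onto a closed surface of positive
   Gaussian curvature, with outward unit normal [N].  Only the values of [X]
   and [N] on the unit sphere matter.  Such a surface bounds a convex body, so
   the outward normal is the one for which the surface lies behind each of its
   tangent planes.  At the two poles of [sph_z] the isometry condition follows
   by continuity. *)
Record isometric_embedding (a r : R) (X N : vec3 -> vec3) : Prop := {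
  emb_smooth : smooth_on_sphere X;
  emb_injective :
    forall p q, on_sphere p -> on_sphere q -> X p = X q -> p = q;
  emb_isometric :
    forall theta phi, 0 < theta < PI ->
      g11 (in_chart sph_z X) theta phi = Sigma a r theta ^ 2 /\
      g12 (in_chart sph_z X) theta phi = 0 /\
      g22 (in_chart sph_z X) theta phi = H a r theta;
  emb_normal_smooth : smooth_on_sphere N;
  emb_normal_unit : forall p, on_sphere p -> dot (N p) (N p) = 1;
  emb_normal :
    normal_along (in_chart sph_z X) (in_chart sph_z N) /\
    normal_along (in_chart sph_x X) (in_chart sph_x N);
  emb_normal_outward :
    forall p q, on_sphere p -> on_sphere q -> dot (vsub (X q) (X p)) (N p) <= 0;
  emb_curvature :
    positively_curved (in_chart sph_z X) (in_chart sph_z N) /\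
    positively_curved (in_chart sph_x X) (in_chart sph_x N)
}.

Definition kappa0 (X N : vec3 -> vec3) (theta phi : R) : R :=
  patch_mean_curvature (in_chart sph_z X) (in_chart sph_z N) theta phi.

(* The Brown-York energy of [S(r)] computed from the isometric embedding [X]
   with outward normal [N]; [sqrt (Sigma ^ 2 * H)] is the area density. *)
Definition brown_york_of (a r : R) (X N : vec3 -> vec3) : R :=
  / (8 * PI) *
  RInt (fun phi =>
    RInt (fun theta =>
      (kappa0 X N theta phi - horizon_ext a (kappa a theta phi) r)
      * sqrt (Sigma a r theta ^ 2 * H a r theta)) 0 PI)
  0 (2 * PI).

(* [m] is the Brown-York energy of [S(r)]: an isometric embedding exists, and
   every one of them gives the value [m]. *)
Definition is_brown_york (a r m : R) : Prop :=
  (exists X N, isometric_embedding a r X N) /\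
  (forall X N, isometric_embedding a r X N -> brown_york_of a r X N = m).

(* Main.v *)
(** Uniqueness does not need the rigidity of the embedding, only that of its total
mean curvature, which is Herglotz' integral formula. If [h] and [h'] are the second
fundamental forms of two isometric closed surfaces, the cofactor tensor of [h] is
divergence free by Codazzi; contracted with the tangential part of the position
vector of the second surface, it gives
  [int tr h = int p' (h11 h'22 + h22 h'11 - 2 h12 h'12) / det g],
where [p'] is the support function of the second surface. As [det h = det h'] by
the Gauss equation, the mixed determinant is at least [2 det h'] and [p' >= 0], so
[int tr h >= int tr h'], and equality follows by symmetry.

Existence: [S(r)] is embedded as a surface of revolution. With [z = cos theta], the
cosine [f] of the angle between the meridian and the radial direction satisfies
[f(1) = 1], [f(-1) = -1], and [f' > 0] is equivalent to positive Gauss curvature.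
It holds as soon as [4 a^2 <= r^2], and it makes [Sigma^2 - (d sqrt H / dtheta)^2],
the square of the height derivative, positive between the poles. *)

Require Import Defs.
From Stdlib Require Import Reals Lra Lia.
From Coquelicot Require Import Coquelicot.
(* [Reals] has its own [d1]; this makes the one of [Defs] visible again. *)
Import Defs.
Open Scope R_scope.

(** * Functions of class C^n on an open set of the plane *)

(** Most of the analytic work comes from the poles. The coordinates (theta, phi) degenerate there,
    while an arbitrary embedding is known only through its smoothness in two charts and its metric
    between the poles. The second chart shows that whatever is read in [sph_z] is smooth across
    theta = 0 and theta = PI. Hence h12 and h22 are sin and sin^2 times continuous functions, the
    densities are continuous on the closed interval, and the flux through a small circle about a
    pole tends to 0. Herglotz' formula deals with an unknown embedding, so the value may be computed
    on one surface of revolution. There the identity with E holds pointwise: at x = y = 0 the A-term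
    is the density of kappa / (8 PI) and the C-term that of - kappa0 / (8 PI), since beta becomes 2
    sqrt H times the height derivative. For the horizon, each quantity is rewritten with sqrt Delta
    in place of 1 / R; the new formula is continuous in r, so its value is the right limit. *)

Definition open2 (U : R -> R -> Prop) : Prop :=
  forall u v, U u v -> locally_2d U u v.

(** [ex_diff_n] speaks of iterated partial derivatives at a single point; required on an open set it
    is the usual class C^n. *)
Definition Ck (n : nat) (U : R -> R -> Prop) (f : R -> R -> R) : Prop :=
  forall u v, U u v -> ex_diff_n f n u v.

Definition D1 (f : R -> R -> R) : R -> R -> R :=
  fun u v => Derive (fun t => f t v) u.
Definition D2 (f : R -> R -> R) : R -> R -> R :=
  fun u v => Derive (fun t => f u t) v.

Lemma Ck_ext n U f g : open2 U -> (forall u v, U u v -> f u v = g u v) ->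
  Ck n U f -> Ck n U g.
Proof.
  intros HU Hfg Hf u v Huv.
  apply ex_diff_n_ext_loc with f; [|now apply Hf].
  destruct (HU u v Huv) as [d Hd].
  exists d; intros; apply Hfg; now apply Hd.
Qed.

Lemma Ck_sub n (U V : R -> R -> Prop) f : (forall u v, U u v -> V u v) ->
  Ck n V f -> Ck n U f.
Proof. intros HUV Hf u v Huv; now apply Hf, HUV. Qed.

Lemma Ck_le m n U f : (m <= n)%nat -> Ck n U f -> Ck m U f.
Proof. intros Hmn Hf u v Huv; eapply ex_diff_n_m; eauto. Qed.

Lemma Ck_cont n U f u v : Ck n U f -> U u v -> continuity_2d_pt f u v.
Proof.
  intros Hf Huv; specialize (Hf u v Huv).
  destruct n; apply Hf.
Qed.

Lemma Ck_D1 n U f : Ck (S n) U f -> Ck n U (D1 f).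
Proof. intros Hf u v Huv; exact (ex_diff_n_deriv_aux1 f n u v (Hf u v Huv)). Qed.

Lemma Ck_D2 n U f : Ck (S n) U f -> Ck n U (D2 f).
Proof. intros Hf u v Huv; exact (ex_diff_n_deriv_aux2 f n u v (Hf u v Huv)). Qed.

Lemma Ck_is_D1 n U f u v : Ck (S n) U f -> U u v ->
  is_derive (fun t => f t v) u (D1 f u v).
Proof. intros Hf Huv; apply Derive_correct; now destruct (Hf u v Huv) as [_ [? _]]. Qed.

Lemma Ck_is_D2 n U f u v : Ck (S n) U f -> U u v ->
  is_derive (fun t => f u t) v (D2 f u v).
Proof. intros Hf Huv; apply Derive_correct; now destruct (Hf u v Huv) as [_ [_ [? _]]]. Qed.

(** The induction step behind all closure properties. Explicit candidates [f1], [f2] stand for the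
    partial derivatives; they agree with [Derive] only on [U], and openness makes that enough for
    higher derivatives. *)
Lemma Ck_S_intro n U f f1 f2 : open2 U ->
  (forall u v, U u v -> continuity_2d_pt f u v) ->
  (forall u v, U u v -> is_derive (fun t => f t v) u (f1 u v)) ->
  (forall u v, U u v -> is_derive (fun t => f u t) v (f2 u v)) ->
  Ck n U f1 -> Ck n U f2 -> Ck (S n) U f.
Proof.
  intros HU Hc H1 H2 Hf1 Hf2 u v Huv.
  assert (A1 : Ck n U (D1 f)).
  { apply (Ck_ext n U f1); auto.
    intros x y Hxy; symmetry; now apply is_derive_unique, H1. }
  assert (A2 : Ck n U (D2 f)).
  { apply (Ck_ext n U f2); auto.
    intros x y Hxy; symmetry; now apply is_derive_unique, H2. }
  split; [now apply Hc|].
  split; [eexists; now apply H1|].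
  split; [eexists; now apply H2|].
  split; [now apply A1|now apply A2].
Qed.

Lemma is_derive_Rconst (c x : R) : is_derive (fun _ : R => c) x 0.
Proof. exact (is_derive_const (K := R_AbsRing) (V := R_NormedModule) c x). Qed.

Lemma open2_True : open2 (fun _ _ => True).
Proof. intros x y _; exists (mkposreal 1 Rlt_0_1); easy. Qed.

Lemma Ck_const n U c : Ck n U (fun _ _ => c).
Proof.
  revert U c; induction n as [|n IH]; intros U c u v Huv.
  - split; [apply continuity_2d_pt_const|easy].
  - refine (Ck_S_intro n (fun _ _ => True) _ (fun _ _ => 0) (fun _ _ => 0) _ _ _ _
             (IH _ _) (IH _ _) u v I).
    + intros x y _; exists (mkposreal 1 Rlt_0_1); easy.
    + intros; apply continuity_2d_pt_const.
    + intros; apply is_derive_Rconst.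
    + intros; apply is_derive_Rconst.
Qed.

Lemma Ck_fst n U : Ck n U (fun u _ => u).
Proof.
  apply (Ck_sub n U (fun _ _ => True)); [easy|].
  destruct n as [|n].
  - intros u v _; split; [apply continuity_2d_pt_id1|easy].
  - apply Ck_S_intro with (fun _ _ => 1) (fun _ _ => 0); try apply Ck_const.
    + apply open2_True.
    + intros; apply continuity_2d_pt_id1.
    + intros; exact (is_derive_id u).
    + intros; apply is_derive_Rconst.
Qed.

Lemma Ck_snd n U : Ck n U (fun _ v => v).
Proof.
  apply (Ck_sub n U (fun _ _ => True)); [easy|].
  destruct n as [|n].
  - intros u v _; split; [apply continuity_2d_pt_id2|easy].
  - apply Ck_S_intro with (fun _ _ => 0) (fun _ _ => 1); try apply Ck_const.
    + apply open2_True.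
    + intros; apply continuity_2d_pt_id2.
    + intros; apply is_derive_Rconst.
    + intros; exact (is_derive_id v).
Qed.

Lemma Ck_plus n U f g : open2 U -> Ck n U f -> Ck n U g ->
  Ck n U (fun u v => f u v + g u v).
Proof.
  intros HU; revert f g; induction n as [|n IH]; intros f g Hf Hg.
  - intros u v Huv; split; [|easy].
    apply continuity_2d_pt_plus; [now apply (Hf u v)|now apply (Hg u v)].
  - apply Ck_S_intro with (fun u v => D1 f u v + D1 g u v)
                          (fun u v => D2 f u v + D2 g u v); auto.
    + intros u v Huv; apply continuity_2d_pt_plus; eapply Ck_cont; eauto.
    + intros u v Huv; apply (is_derive_plus (fun t => f t v) (fun t => g t v));
        eapply Ck_is_D1; eauto.
    + intros u v Huv; apply (is_derive_plus (fun t => f u t) (fun t => g u t));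
        eapply Ck_is_D2; eauto.
    + apply IH; now apply Ck_D1.
    + apply IH; now apply Ck_D2.
Qed.

Lemma is_derive_Rmult (f g : R -> R) x df dg :
  is_derive f x df -> is_derive g x dg ->
  is_derive (fun t => f t * g t) x (df * g x + f x * dg).
Proof. intros Hf Hg; apply (is_derive_mult f g x df dg Hf Hg Rmult_comm). Qed.

Lemma Ck_mult n U f g : open2 U -> Ck n U f -> Ck n U g ->
  Ck n U (fun u v => f u v * g u v).
Proof.
  intros HU; revert f g; induction n as [|n IH]; intros f g Hf Hg.
  - intros u v Huv; split; [|easy].
    apply continuity_2d_pt_mult; [now apply (Hf u v)|now apply (Hg u v)].
  - assert (Hf' := Ck_le n (S n) U f ltac:(lia) Hf).
    assert (Hg' := Ck_le n (S n) U g ltac:(lia) Hg).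
    apply Ck_S_intro with (fun u v => D1 f u v * g u v + f u v * D1 g u v)
                          (fun u v => D2 f u v * g u v + f u v * D2 g u v); auto.
    + intros u v Huv; apply continuity_2d_pt_mult; eapply Ck_cont; eauto.
    + intros u v Huv; apply (is_derive_Rmult (fun t => f t v) (fun t => g t v));
        eapply Ck_is_D1; eauto.
    + intros u v Huv; apply (is_derive_Rmult (fun t => f u t) (fun t => g u t));
        eapply Ck_is_D2; eauto.
    + apply Ck_plus; auto; apply IH; auto; now apply Ck_D1.
    + apply Ck_plus; auto; apply IH; auto; now apply Ck_D2.
Qed.

Lemma Ck_opp n U f : open2 U -> Ck n U f -> Ck n U (fun u v => - f u v).
Proof.
  intros HU Hf; apply Ck_ext with (fun u v => (-1) * f u v); auto.
  - intros; ring.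
  - apply Ck_mult; auto; apply Ck_const.
Qed.

Lemma Ck_minus n U f g : open2 U -> Ck n U f -> Ck n U g ->
  Ck n U (fun u v => f u v - g u v).
Proof. intros HU Hf Hg; apply Ck_plus; auto; now apply Ck_opp. Qed.

Lemma Ck_pow n U f k : open2 U -> Ck n U f -> Ck n U (fun u v => f u v ^ k).
Proof.
  intros HU Hf; induction k as [|k IH]; simpl; [apply Ck_const|now apply Ck_mult].
Qed.

(** One partial derivative existing nearby and continuous at the point, together with the other one
    at the point, already gives the total differential that the chain rule needs. *)
Lemma Ck_differentiable n U f u v : open2 U -> Ck (S n) U f -> U u v ->
  differentiable_pt_lim f u v (D1 f u v) (D2 f u v).
Proof.
  intros HU Hf Huv.
  apply filterdiff_differentiable_pt_lim.
  assert (K := is_derive_filterdiff f u v (D1 f) (D2 f u v)).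
  eapply filterdiff_ext_lin; [apply K|].
  - destruct (HU u v Huv) as [d Hd].
    exists d; intros [x y] [B1 B2]; simpl in *.
    apply (Ck_is_D1 n U); auto; now apply Hd.
  - eapply Ck_is_D2; eauto.
  - apply continuity_2d_pt_filterlim with (f := D1 f).
    apply (Ck_cont n U); auto; now apply Ck_D1.
  - intros [x y]; reflexivity.
Qed.

Lemma continuity_2d_comp (F p q : R -> R -> R) u v :
  continuity_2d_pt F (p u v) (q u v) ->
  continuity_2d_pt p u v -> continuity_2d_pt q u v ->
  continuity_2d_pt (fun u v => F (p u v) (q u v)) u v.
Proof.
  intros HF Hp Hq eps.
  destruct (HF eps) as [d Hd].
  destruct (Hp d) as [d1 Hd1]; destruct (Hq d) as [d2 Hd2].
  assert (M : 0 < Rmin d1 d2) by (apply Rmin_glb_lt; apply cond_pos).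
  exists (mkposreal _ M); simpl; intros x y Hx Hy.
  apply Hd; [apply Hd1|apply Hd2]; eapply Rlt_le_trans; eauto;
    try apply Rmin_l; apply Rmin_r.
Qed.

Lemma Ck_comp n U V F p q : open2 U -> open2 V ->
  Ck n V F -> Ck n U p -> Ck n U q ->
  (forall u v, U u v -> V (p u v) (q u v)) ->
  Ck n U (fun u v => F (p u v) (q u v)).
Proof.
  intros HU HV; revert F p q; induction n as [|n IH]; intros F p q HF Hp Hq HUV.
  - intros u v Huv; split; [|easy].
    apply continuity_2d_comp; [apply HF; auto|apply Hp; auto|apply Hq; auto].
  - assert (HF' := Ck_le n (S n) V F ltac:(lia) HF).
    assert (Hp' := Ck_le n (S n) U p ltac:(lia) Hp).
    assert (Hq' := Ck_le n (S n) U q ltac:(lia) Hq).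
    apply Ck_S_intro with
      (fun u v => D1 F (p u v) (q u v) * D1 p u v + D2 F (p u v) (q u v) * D1 q u v)
      (fun u v => D1 F (p u v) (q u v) * D2 p u v + D2 F (p u v) (q u v) * D2 q u v);
      auto.
    + intros u v Huv; apply continuity_2d_comp; eapply Ck_cont; eauto.
    + intros u v Huv.
      apply is_derive_Reals.
      apply (derivable_pt_lim_comp_2d F (fun t => p t v) (fun t => q t v)).
      * apply (Ck_differentiable n V); auto.
      * apply is_derive_Reals; eapply Ck_is_D1; eauto.
      * apply is_derive_Reals; eapply Ck_is_D1; eauto.
    + intros u v Huv.
      apply is_derive_Reals.
      apply (derivable_pt_lim_comp_2d F (fun t => p u t) (fun t => q u t)).
      * apply (Ck_differentiable n V); auto.
      * apply is_derive_Reals; eapply Ck_is_D2; eauto.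
      * apply is_derive_Reals; eapply Ck_is_D2; eauto.
    + apply Ck_plus; auto; apply Ck_mult; auto; try (now apply Ck_D1);
        apply IH; auto; [now apply Ck_D1|now apply Ck_D2].
    + apply Ck_plus; auto; apply Ck_mult; auto; try (now apply Ck_D2);
        apply IH; auto; [now apply Ck_D1|now apply Ck_D2].
Qed.

(** A function of one variable is seen as a function of two that ignores the second, so that one set
    of closure lemmas serves both. *)
Definition Ck1 (n : nat) (D : R -> Prop) (g : R -> R) : Prop :=
  Ck n (fun u _ => D u) (fun u _ => g u).

Lemma open2_open (D : R -> Prop) : open D -> open2 (fun u _ => D u).
Proof.
  intros HD u v Hu; destruct (HD u Hu) as [d Hd].
  exists d; intros x y Hx _; now apply Hd.
Qed.

Lemma Ck1_comp n U D g p : open2 U -> open D -> Ck1 n D g -> Ck n U p ->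
  (forall u v, U u v -> D (p u v)) -> Ck n U (fun u v => g (p u v)).
Proof.
  intros HU HD Hg Hp HUD.
  apply (Ck_comp n U (fun u _ => D u) (fun u _ => g u) p (fun _ _ => 0)); auto.
  - now apply open2_open.
  - apply Ck_const.
Qed.

Lemma continuity_pt_2d_fst g u v : continuity_pt g u ->
  continuity_2d_pt (fun x _ => g x) u v.
Proof.
  intros Hg; apply (continuity_1d_2d_pt_comp g (fun x _ => x)); auto.
  apply continuity_2d_pt_id1.
Qed.

Lemma is_derive_continuity_pt (g : R -> R) u l : is_derive g u l -> continuity_pt g u.
Proof.
  intros Hg; apply continuity_pt_filterlim, (ex_derive_continuous g u); now exists l.
Qed.

Lemma Ck1_S n D g g' : open D -> (forall x, D x -> is_derive g x (g' x)) ->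
  Ck1 n D g' -> Ck1 (S n) D g.
Proof.
  intros HD Hg Hg'; apply Ck_S_intro with (fun u _ => g' u) (fun _ _ => 0).
  - now apply open2_open.
  - intros u v Hu; apply continuity_pt_2d_fst; eapply is_derive_continuity_pt, Hg; auto.
  - intros u v Hu; now apply Hg.
  - intros; apply is_derive_Rconst.
  - exact Hg'.
  - apply Ck_const.
Qed.

Lemma Ck1_0 D g : (forall x, D x -> continuity_pt g x) -> Ck1 0 D g.
Proof. intros Hg u v Hu; split; [apply continuity_pt_2d_fst; auto|easy]. Qed.

Lemma open_pos : open (fun x => 0 < x).
Proof. apply open_gt. Qed.

Lemma open_nonzero : open (fun x : R => x <> 0).
Proof. apply open_neq. Qed.

Lemma Ck1_inv n : Ck1 n (fun x => x <> 0) Rinv.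
Proof.
  assert (K : forall x : R, x <> 0 -> is_derive Rinv x (- (/ x * / x))).
  { intros x Hx; evar_last; [apply (is_derive_inv (fun x => x) x 1)|]; auto.
    - exact (is_derive_id x).
    - simpl; field; auto. }
  induction n as [|n IH].
  - apply Ck1_0; intros; eapply is_derive_continuity_pt, K; auto.
  - apply Ck1_S with (fun x => - (/ x * / x)); auto.
    + apply open_nonzero.
    + apply (Ck_opp n _ (fun u _ => / u * / u)); [apply open2_open, open_nonzero|].
      apply (Ck_mult n _ (fun u _ => / u) (fun u _ => / u)); auto;
        apply open2_open, open_nonzero.
Qed.

Lemma Ck_inv n U f : open2 U -> Ck n U f -> (forall u v, U u v -> f u v <> 0) ->
  Ck n U (fun u v => / f u v).
Proof.
  intros; apply (Ck1_comp n U (fun x => x <> 0) Rinv); auto.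
  - apply open_nonzero.
  - apply Ck1_inv.
Qed.

Lemma Ck_div n U f g : open2 U -> Ck n U f -> Ck n U g ->
  (forall u v, U u v -> g u v <> 0) -> Ck n U (fun u v => f u v / g u v).
Proof. intros; apply Ck_mult; auto; now apply Ck_inv. Qed.

Lemma Ck1_sqrt n : Ck1 n (fun x => 0 < x) sqrt.
Proof.
  assert (K : forall x : R, 0 < x -> is_derive sqrt x (/ 2 * / sqrt x)).
  { intros x Hx; evar_last; [apply (is_derive_sqrt (fun x => x) x 1)|]; auto.
    - exact (is_derive_id x).
    - assert (0 < sqrt x) by now apply sqrt_lt_R0. simpl; field; lra. }
  induction n as [|n IH].
  - apply Ck1_0; intros; eapply is_derive_continuity_pt, K; auto.
  - apply Ck1_S with (fun x => / 2 * / sqrt x); auto.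
    + apply open_pos.
    + apply (Ck_mult n _ (fun _ _ => / 2) (fun u _ => / sqrt u));
        [apply open2_open, open_pos|apply Ck_const|].
      apply Ck_inv; auto; [apply open2_open, open_pos|].
      intros u _ Hu; assert (0 < sqrt u) by now apply sqrt_lt_R0. lra.
Qed.

Lemma Ck_sqrt n U f : open2 U -> Ck n U f -> (forall u v, U u v -> 0 < f u v) ->
  Ck n U (fun u v => sqrt (f u v)).
Proof.
  intros; apply (Ck1_comp n U (fun x => 0 < x) sqrt); auto.
  - apply open_pos.
  - apply Ck1_sqrt.
Qed.

Lemma Ck_atan n U f : open2 U -> Ck n U f -> Ck n U (fun u v => atan (f u v)).
Proof.
  intros HU Hf; apply (Ck1_comp n U (fun _ => True) atan); auto; [apply open_true|].
  destruct n as [|n].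
  - apply Ck1_0; intros; eapply is_derive_continuity_pt, is_derive_atan.
  - apply Ck1_S with (fun x => / (1 + Rsqr x)); [apply open_true| |].
    + intros; apply is_derive_atan.
    + apply Ck_inv; [apply open2_True| |].
      * apply (Ck_plus n _ (fun _ _ => 1) (fun u _ => Rsqr u));
          [apply open2_True|apply Ck_const|].
        apply Ck_mult; [apply open2_True|apply Ck_fst|apply Ck_fst].
      * intros u _ _; generalize (Rle_0_sqr u); lra.
Qed.

Lemma Ck1_sin_cos n : Ck1 n (fun _ => True) sin /\ Ck1 n (fun _ => True) cos.
Proof.
  induction n as [|n [IHs IHc]]; split.
  - apply Ck1_0; intros; apply continuity_sin.
  - apply Ck1_0; intros; apply continuity_cos.
  - apply Ck1_S with cos; auto; [apply open_true|intros; apply is_derive_sin].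
  - apply Ck1_S with (fun x => - sin x); [apply open_true|intros; apply is_derive_cos|].
    apply (Ck_opp n _ (fun u _ => sin u)); auto; apply open2_True.
Qed.

Lemma Ck_sin n U f : open2 U -> Ck n U f -> Ck n U (fun u v => sin (f u v)).
Proof.
  intros; apply (Ck1_comp n U (fun _ => True) sin); auto; [apply open_true|].
  apply Ck1_sin_cos.
Qed.

Lemma Ck_cos n U f : open2 U -> Ck n U f -> Ck n U (fun u v => cos (f u v)).
Proof.
  intros; apply (Ck1_comp n U (fun _ => True) cos); auto; [apply open_true|].
  apply Ck1_sin_cos.
Qed.

Lemma Ck_locally n U f :
  (forall u v, U u v -> exists V, V u v /\ Ck n V f) -> Ck n U f.
Proof. intros K u v Huv; destruct (K u v Huv) as [V [HV Hf]]; now apply Hf. Qed.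

(** * Removing the polar singularity of spherical coordinates *)

Definition interior_strip : R -> R -> Prop := fun u _ => 0 < u < PI.
(** It contains both poles with a margin. For theta outside [0, PI] the point [sph_z theta phi]
    still lies on the sphere, so pulled back functions make sense there. *)
Definition wide_strip : R -> R -> Prop := fun u _ => - (PI / 2) < u < 3 * (PI / 2).

Lemma open_interval a b : open (fun u : R => a < u < b).
Proof. apply open_and; [apply open_gt|apply open_lt]. Qed.

Lemma open2_interior_strip : open2 interior_strip.
Proof. apply (open2_open (fun u => 0 < u < PI)), open_interval. Qed.

Lemma open2_wide_strip : open2 wide_strip.
Proof.
  apply (open2_open (fun u => - (PI / 2) < u < 3 * (PI / 2))), open_interval.
Qed.

Lemma open2_preimage U (p : R -> R -> R) D : open2 U -> open D ->
  (forall u v, U u v -> continuity_2d_pt p u v) ->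
  open2 (fun u v => U u v /\ D (p u v)).
Proof.
  intros HU HD Hp u v [Huv Hd].
  apply locally_2d_and; [now apply HU|].
  destruct (HD _ Hd) as [d Hd'].
  destruct (Hp u v Huv d) as [d2 Hd2].
  exists d2; intros x y Hx Hy; apply Hd'; now apply Hd2.
Qed.

(** With [s] the sign of [z], this is the polar angle of the point (y, z) of the plane, written
    through [atan] so that it is smooth on the whole half-plane [0 < s * z]. *)
Lemma sin_half_PI_plus_minus_atan s y z : s = 1 \/ s = -1 -> 0 < s * z ->
  cos (s * (PI / 2) - atan (y / z)) = y / sqrt (y ^ 2 + z ^ 2) /\
  sin (s * (PI / 2) - atan (y / z)) = z / sqrt (y ^ 2 + z ^ 2).
Proof.
  intros Hs Hz.
  assert (Hz0 : z <> 0) by (intros ->; lra).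
  set (w := sqrt (y ^ 2 + z ^ 2)).
  assert (Hsum : 0 < y ^ 2 + z ^ 2).
  { generalize (pow2_ge_0 y) (pow2_gt_0 z Hz0); lra. }
  assert (Hw : 0 < w) by now apply sqrt_lt_R0.
  assert (Hr : sqrt (1 + Rsqr (y / z)) = w * (s / z)).
  { apply sqrt_lem_1.
    - generalize (Rle_0_sqr (y / z)); lra.
    - assert (0 < s / z); [|nra].
      replace (s / z) with (s * z * (/ z) ^ 2) by (field; auto).
      apply Rmult_lt_0_compat; auto.
      apply pow2_gt_0, Rinv_neq_0_compat; auto.
    - replace (w * (s / z) * (w * (s / z))) with (w ^ 2 * s ^ 2 / z ^ 2) by (field; auto).
      unfold w; rewrite pow2_sqrt by lra.
      replace (s ^ 2) with 1 by (destruct Hs as [-> | ->]; ring).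
      unfold Rsqr; field; auto. }
  assert (Hs0 : s <> 0) by (destruct Hs as [-> | ->]; lra).
  assert (Hs2 : s * s = 1) by (destruct Hs as [-> | ->]; lra).
  rewrite cos_minus, sin_minus, cos_atan, sin_atan, Hr.
  assert (Hc : cos (s * (PI / 2)) = 0).
  { destruct Hs as [-> | ->].
    - rewrite Rmult_1_l; apply cos_PI2.
    - replace (-1 * (PI / 2)) with (- (PI / 2)) by ring; rewrite cos_neg; apply cos_PI2. }
  assert (Hsn : sin (s * (PI / 2)) = s).
  { destruct Hs as [-> | ->].
    - rewrite Rmult_1_l; apply sin_PI2.
    - replace (-1 * (PI / 2)) with (- (PI / 2)) by ring; rewrite sin_neg, sin_PI2; ring. }
  rewrite Hc, Hsn; split; field; repeat split; auto; lra.
Qed.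

Definition smooth_sphere_fun (f : vec3 -> R) : Prop :=
  forall n, Ck n interior_strip (fun u v => f (sph_z u v)) /\
            Ck n interior_strip (fun u v => f (sph_x u v)).

(* Near the poles of [sph_z] the angles of [sph_x] are smooth functions of
   [(theta, phi)], also across [theta = 0] and [theta = PI]. *)
Lemma Ck_polar_chart n f : smooth_sphere_fun f ->
  Ck n wide_strip (fun u v => f (sph_z u v)).
Proof.
  intros Hf; apply Ck_locally; intros u v Huv.
  (* Where cos u = 0 only the equator is left, which is inside the domain of [sph_z]. Elsewhere
     [sph_x] is used: its axis lies in the plane z = 0. *)
  destruct (Req_dec (cos u) 0) as [Hcos|Hcos].
  { exists interior_strip; split; [|apply (Hf n)].
    unfold interior_strip; unfold wide_strip in Huv.
    destruct (Rle_or_lt u 0) as [H0|H0].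
    - assert (0 < cos u) by (apply cos_gt_0; lra); lra.
    - split; auto; destruct (Rle_or_lt PI u) as [H1|H1]; auto.
      assert (cos u < 0) by (apply cos_lt_0; lra); lra. }
  assert (Hs : exists s, (s = 1 \/ s = -1) /\ 0 < s * cos u).
  { destruct (Rdichotomy _ _ Hcos); [exists (-1)|exists 1]; split; auto; lra. }
  destruct Hs as [s [Hs Hsu]].
  set (V := fun u0 v0 : R => True /\ 0 < s * cos u0).
  assert (HV : open2 V).
  { apply (open2_preimage (fun _ _ => True) (fun u _ => s * cos u) (fun x => 0 < x)).
    - apply open2_True.
    - apply open_pos.
    - intros; apply (Ck_cont 0 (fun _ _ => True)); auto.
      apply Ck_mult; [apply open2_True|apply Ck_const|].
      apply (Ck_cos 0 _ (fun u _ => u)); [apply open2_True|apply Ck_fst]. }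
  exists V; split; [split; auto|].
  set (x := fun u v => sin u * cos v).
  set (y := fun u v => sin u * sin v).
  set (z := fun u v : R => cos u).
  assert (Hsin : Ck n V (fun u _ => sin u)) by (apply Ck_sin; auto; apply Ck_fst).
  assert (Hz : Ck n V z) by (apply (Ck_cos n V (fun u _ => u)); auto; apply Ck_fst).
  assert (Hx : Ck n V x).
  { apply Ck_mult; auto; apply (Ck_cos n V (fun _ v => v)); auto; apply Ck_snd. }
  assert (Hy : Ck n V y).
  { apply Ck_mult; auto; apply (Ck_sin n V (fun _ v => v)); auto; apply Ck_snd. }
  assert (Hz0 : forall u v, V u v -> z u v <> 0).
  { intros u0 v0 [_ Hp]; unfold z; intros E; rewrite E in Hp; lra. }
  assert (Hpos : forall u v, V u v -> 0 < y u v ^ 2 + z u v ^ 2).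
  { intros u0 v0 Hv; generalize (pow2_ge_0 (y u0 v0)) (pow2_gt_0 _ (Hz0 u0 v0 Hv)); lra. }
  set (w := fun u v => sqrt (y u v ^ 2 + z u v ^ 2)).
  assert (Hw : Ck n V w).
  { apply Ck_sqrt; auto; apply Ck_plus; auto; apply Ck_pow; auto. }
  assert (Hw0 : forall u v, V u v -> 0 < w u v) by (intros; apply sqrt_lt_R0; auto).
  (* [th] and [ph] are the angles of [sph_x] at the point [sph_z u v]; [w] is positive on [V]
     because z = cos u does not vanish there. *)
  set (th := fun u v => PI / 2 - atan (x u v / w u v)).
  set (ph := fun u v => s * (PI / 2) - atan (y u v / z u v)).
  apply Ck_ext with (fun u v => f (sph_x (th u v) (ph u v))); auto.
  - intros u0 v0 Hv; f_equal.
    assert (W := Hw0 u0 v0 Hv).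
    destruct (sin_half_PI_plus_minus_atan s (y u0 v0) (z u0 v0) Hs) as [E1 E2].
    { apply Hv. }
    fold (w u0 v0) in E1, E2.
    destruct (sin_half_PI_plus_minus_atan 1 (x u0 v0) (w u0 v0)) as [E3 E4]; auto; [lra|].
    rewrite Rmult_1_l in E3, E4.
    replace (sqrt (x u0 v0 ^ 2 + w u0 v0 ^ 2)) with 1 in E3, E4.
    + unfold sph_x, th, ph; rewrite E1, E2, E3, E4; unfold sph_z.
      assert (w u0 v0 <> 0) by lra.
      f_equal; [f_equal|].
      * unfold x; field.
      * fold (y u0 v0); field; auto.
      * fold (z u0 v0); field; auto.
    + symmetry; unfold w; rewrite pow2_sqrt by (left; apply Hpos; auto).
      replace (x u0 v0 ^ 2 + (y u0 v0 ^ 2 + z u0 v0 ^ 2)) with 1; [apply sqrt_1|].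
      unfold x, y, z; generalize (sin2_cos2 u0) (sin2_cos2 v0); unfold Rsqr; intros A B.
      replace ((sin u0 * cos v0) ^ 2 + ((sin u0 * sin v0) ^ 2 + cos u0 ^ 2))
        with (sin u0 * sin u0 * (sin v0 * sin v0 + cos v0 * cos v0) + cos u0 * cos u0)
        by ring.
      rewrite B; lra.
  - apply (Ck_comp n V interior_strip (fun u v => f (sph_x u v)) th ph); auto.
    + apply open2_interior_strip.
    + apply (Hf n).
    + apply Ck_minus; auto; [apply Ck_const|].
      apply Ck_atan; auto; apply Ck_div; auto.
      intros; apply Rgt_not_eq, Hw0; auto.
    + apply Ck_minus; auto; [apply Ck_const|].
      apply Ck_atan; auto; apply Ck_div; auto.
    + intros u0 v0 _; unfold interior_strip, th.
      generalize (atan_bound (x u0 v0 / w u0 v0)); lra.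
Qed.

(** * Surfaces with an orthogonal metric depending on theta alone *)

Definition Ck3 (n : nat) (U : R -> R -> Prop) (Y : patch) : Prop :=
  Ck n U (fun u v => vx (Y u v)) /\ Ck n U (fun u v => vy (Y u v)) /\
  Ck n U (fun u v => vz (Y u v)).

Lemma Ck3_le m n U Y : (m <= n)%nat -> Ck3 n U Y -> Ck3 m U Y.
Proof. intros Hmn [A [B C]]; repeat split; eapply Ck_le; eauto. Qed.

Lemma Ck3_sub n (U V : R -> R -> Prop) Y : (forall u v, U u v -> V u v) ->
  Ck3 n V Y -> Ck3 n U Y.
Proof. intros HUV [A [B C]]; repeat split; eapply Ck_sub; eauto. Qed.

Lemma Ck3_d1 n U Y : Ck3 (S n) U Y -> Ck3 n U (d1 Y).
Proof. intros [A [B C]]; split; [|split]; now apply Ck_D1. Qed.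

Lemma Ck3_d2 n U Y : Ck3 (S n) U Y -> Ck3 n U (d2 Y).
Proof. intros [A [B C]]; split; [|split]; now apply Ck_D2. Qed.

Lemma Ck_dot n U Y Z : open2 U -> Ck3 n U Y -> Ck3 n U Z ->
  Ck n U (fun u v => dot (Y u v) (Z u v)).
Proof.
  intros HU [A [B C]] [A' [B' C']]; unfold dot.
  apply Ck_plus; auto; [apply Ck_plus; auto|]; apply Ck_mult; auto.
Qed.

Lemma Ck3_vsub n U Y c : open2 U -> Ck3 n U Y -> Ck3 n U (fun u v => vsub (Y u v) c).
Proof.
  intros HU [A [B C]]; split; [|split]; apply Ck_minus; auto; apply Ck_const.
Qed.

Lemma is_derive_dot (Y Z : R -> vec3) x Y' Z' :
  is_derive (fun t => vx (Y t)) x (vx Y') -> is_derive (fun t => vy (Y t)) x (vy Y') ->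
  is_derive (fun t => vz (Y t)) x (vz Y') ->
  is_derive (fun t => vx (Z t)) x (vx Z') -> is_derive (fun t => vy (Z t)) x (vy Z') ->
  is_derive (fun t => vz (Z t)) x (vz Z') ->
  is_derive (fun t => dot (Y t) (Z t)) x (dot Y' (Z x) + dot (Y x) Z').
Proof.
  intros A B C A' B' C'; unfold dot.
  replace (vx Y' * vx (Z x) + vy Y' * vy (Z x) + vz Y' * vz (Z x) +
           (vx (Y x) * vx Z' + vy (Y x) * vy Z' + vz (Y x) * vz Z'))
    with ((vx Y' * vx (Z x) + vx (Y x) * vx Z')
          + (vy Y' * vy (Z x) + vy (Y x) * vy Z')
          + (vz Y' * vz (Z x) + vz (Y x) * vz Z')) by ring.
  apply (is_derive_plus (V := R_NormedModule)
           (fun t => vx (Y t) * vx (Z t) + vy (Y t) * vy (Z t))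
           (fun t => vz (Y t) * vz (Z t))).
  - apply (is_derive_plus (V := R_NormedModule)
             (fun t => vx (Y t) * vx (Z t)) (fun t => vy (Y t) * vy (Z t)));
      now apply is_derive_Rmult.
  - now apply is_derive_Rmult.
Qed.

Lemma D1_dot n U Y Z u v : Ck3 (S n) U Y -> Ck3 (S n) U Z -> U u v ->
  D1 (fun u v => dot (Y u v) (Z u v)) u v =
  dot (d1 Y u v) (Z u v) + dot (Y u v) (d1 Z u v).
Proof.
  intros [A [B C]] [A' [B' C']] Huv; apply is_derive_unique.
  apply (is_derive_dot (fun t => Y t v) (fun t => Z t v)).
  - apply (Ck_is_D1 n U _ u v A Huv).
  - apply (Ck_is_D1 n U _ u v B Huv).
  - apply (Ck_is_D1 n U _ u v C Huv).
  - apply (Ck_is_D1 n U _ u v A' Huv).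
  - apply (Ck_is_D1 n U _ u v B' Huv).
  - apply (Ck_is_D1 n U _ u v C' Huv).
Qed.

Lemma D2_dot n U Y Z u v : Ck3 (S n) U Y -> Ck3 (S n) U Z -> U u v ->
  D2 (fun u v => dot (Y u v) (Z u v)) u v =
  dot (d2 Y u v) (Z u v) + dot (Y u v) (d2 Z u v).
Proof.
  intros [A [B C]] [A' [B' C']] Huv; apply is_derive_unique.
  apply (is_derive_dot (fun t => Y u t) (fun t => Z u t)).
  - apply (Ck_is_D2 n U _ u v A Huv).
  - apply (Ck_is_D2 n U _ u v B Huv).
  - apply (Ck_is_D2 n U _ u v C Huv).
  - apply (Ck_is_D2 n U _ u v A' Huv).
  - apply (Ck_is_D2 n U _ u v B' Huv).
  - apply (Ck_is_D2 n U _ u v C' Huv).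
Qed.

Lemma D1_ext U f g u v : open2 U -> (forall u v, U u v -> f u v = g u v) -> U u v ->
  D1 f u v = D1 g u v.
Proof.
  intros HU Hfg Huv; apply Derive_ext_loc.
  apply (locally_2d_1d_const_y (fun x y => f x y = g x y)).
  destruct (HU u v Huv) as [d Hd]; exists d; auto.
Qed.

Lemma D2_ext U f g u v : open2 U -> (forall u v, U u v -> f u v = g u v) -> U u v ->
  D2 f u v = D2 g u v.
Proof.
  intros HU Hfg Huv; apply Derive_ext_loc.
  apply (locally_2d_1d_const_x (fun x y => f x y = g x y)).
  destruct (HU u v Huv) as [d Hd]; exists d; auto.
Qed.

Lemma D1_D2_comm U f u v : open2 U -> Ck 2 U f -> U u v -> D1 (D2 f) u v = D2 (D1 f) u v.
Proof.
  intros HU Hf Huv.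
  assert (A1 := Ck_D1 1 U f Hf); assert (A2 := Ck_D2 1 U f Hf).
  apply Schwarz.
  - destruct (HU u v Huv) as [d Hd]; exists d; intros x y Hx Hy.
    assert (Hxy := Hd x y Hx Hy); repeat split; eexists.
    + eapply Ck_is_D1 with (f := f); eauto.
    + eapply Ck_is_D2 with (f := f); eauto.
    + eapply Ck_is_D1 with (f := D2 f); eauto.
    + eapply Ck_is_D2 with (f := D1 f); eauto.
  - apply (Ck_cont 0 U (D1 (D2 f))); auto; now apply Ck_D1.
  - apply (Ck_cont 0 U (D2 (D1 f))); auto; now apply Ck_D2.
Qed.

Lemma d1_d2_comm U Y u v : open2 U -> Ck3 2 U Y -> U u v ->
  d1 (d2 Y) u v = d2 (d1 Y) u v.
Proof.
  intros HU [A [B C]] Huv.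
  assert (KA := D1_D2_comm U _ u v HU A Huv).
  assert (KB := D1_D2_comm U _ u v HU B Huv).
  assert (KC := D1_D2_comm U _ u v HU C Huv).
  unfold d1 at 1, d2 at 4.
  apply f_equal2; [apply f_equal2; [exact KA|exact KB]|exact KC].
Qed.

(** * Expansion in an orthogonal frame of space *)

Lemma dot_comm v w : dot v w = dot w v.
Proof. unfold dot; ring. Qed.

Lemma dot_vsub_l u v w : dot (vsub u v) w = dot u w - dot v w.
Proof. unfold dot, vsub, vx, vy, vz; simpl; ring. Qed.

(** Parseval's identity. That the three orthogonal vectors span space is shown through their
    determinant, whose square is the product of the squared lengths. *)
Lemma dot_frame (a b n v w : vec3) :
  dot a a <> 0 -> dot b b <> 0 -> dot n n = 1 ->
  dot a b = 0 -> dot n a = 0 -> dot n b = 0 ->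
  dot v w = dot v a * dot w a / dot a a + dot v b * dot w b / dot b b
            + dot v n * dot w n.
Proof.
  intros Ha Hb Hn Hab Hna Hnb.
  destruct a as [[a1 a2] a3], b as [[b1 b2] b3], n as [[n1 n2] n3],
           v as [[v1 v2] v3], w as [[w1 w2] w3].
  unfold dot, vx, vy, vz in *; simpl in *.
  set (A := a1 * a1 + a2 * a2 + a3 * a3) in *.
  set (B := b1 * b1 + b2 * b2 + b3 * b3) in *.
  set (va := v1 * a1 + v2 * a2 + v3 * a3).
  set (vb := v1 * b1 + v2 * b2 + v3 * b3).
  set (vn := v1 * n1 + v2 * n2 + v3 * n3).
  (* the residue of v in the frame (a, b, n) is orthogonal to the frame *)
  set (x1 := v1 - va / A * a1 - vb / B * b1 - vn * n1).
  set (x2 := v2 - va / A * a2 - vb / B * b2 - vn * n2).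
  set (x3 := v3 - va / A * a3 - vb / B * b3 - vn * n3).
  assert (Ea : x1 * a1 + x2 * a2 + x3 * a3 = 0).
  { replace (x1 * a1 + x2 * a2 + x3 * a3)
      with ((v1 * a1 + v2 * a2 + v3 * a3) - va / A * (a1 * a1 + a2 * a2 + a3 * a3)
            - vb / B * (a1 * b1 + a2 * b2 + a3 * b3)
            - vn * (n1 * a1 + n2 * a2 + n3 * a3)) by (unfold x1, x2, x3; ring).
    fold va A; rewrite Hab, Hna; field; auto. }
  assert (Eb : x1 * b1 + x2 * b2 + x3 * b3 = 0).
  { replace (x1 * b1 + x2 * b2 + x3 * b3)
      with ((v1 * b1 + v2 * b2 + v3 * b3) - va / A * (a1 * b1 + a2 * b2 + a3 * b3)
            - vb / B * (b1 * b1 + b2 * b2 + b3 * b3)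
            - vn * (n1 * b1 + n2 * b2 + n3 * b3)) by (unfold x1, x2, x3; ring).
    fold vb B; rewrite Hab, Hnb; field; auto. }
  assert (En : x1 * n1 + x2 * n2 + x3 * n3 = 0).
  { replace (x1 * n1 + x2 * n2 + x3 * n3)
      with ((v1 * n1 + v2 * n2 + v3 * n3) - va / A * (n1 * a1 + n2 * a2 + n3 * a3)
            - vb / B * (n1 * b1 + n2 * b2 + n3 * b3)
            - vn * (n1 * n1 + n2 * n2 + n3 * n3)) by (unfold x1, x2, x3; ring).
    fold vn; rewrite Hna, Hnb, Hn; ring. }
  (* The determinant of the frame; its square is the Gram determinant. *)
  set (d := a1 * (b2 * n3 - b3 * n2) - a2 * (b1 * n3 - b3 * n1)
            + a3 * (b1 * n2 - b2 * n1)).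
  assert (Hd : d * d = A * B).
  { replace (d * d) with
      (A * (B * (n1 * n1 + n2 * n2 + n3 * n3) - (n1 * b1 + n2 * b2 + n3 * b3) ^ 2)
       - (a1 * b1 + a2 * b2 + a3 * b3) *
         ((a1 * b1 + a2 * b2 + a3 * b3) * (n1 * n1 + n2 * n2 + n3 * n3)
          - (n1 * a1 + n2 * a2 + n3 * a3) * (n1 * b1 + n2 * b2 + n3 * b3))
       + (n1 * a1 + n2 * a2 + n3 * a3) *
         ((a1 * b1 + a2 * b2 + a3 * b3) * (n1 * b1 + n2 * b2 + n3 * b3)
          - (n1 * a1 + n2 * a2 + n3 * a3) * B))
      by (unfold d, A, B; ring).
    rewrite Hab, Hna, Hnb, Hn; ring. }
  assert (Hd0 : d <> 0).
  { intros E; rewrite E in Hd.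
    assert (A * B <> 0) by now apply Rmult_integral_contrapositive_currified.
    lra. }
  (* Cramer's rule for the linear system [Ea], [Eb], [En], here and for the two other components. *)
  assert (X1 : x1 = 0).
  { apply Rmult_eq_reg_l with d; auto.
    replace (d * x1) with
      ((x1 * a1 + x2 * a2 + x3 * a3) * (b2 * n3 - b3 * n2)
       - (x1 * b1 + x2 * b2 + x3 * b3) * (a2 * n3 - a3 * n2)
       + (x1 * n1 + x2 * n2 + x3 * n3) * (a2 * b3 - a3 * b2)) by (unfold d; ring).
    rewrite Ea, Eb, En; ring. }
  assert (X2 : x2 = 0).
  { apply Rmult_eq_reg_l with d; auto.
    replace (d * x2) with
      (- (x1 * a1 + x2 * a2 + x3 * a3) * (b1 * n3 - b3 * n1)
       + (x1 * b1 + x2 * b2 + x3 * b3) * (a1 * n3 - a3 * n1)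
       - (x1 * n1 + x2 * n2 + x3 * n3) * (a1 * b3 - a3 * b1)) by (unfold d; ring).
    rewrite Ea, Eb, En; ring. }
  assert (X3 : x3 = 0).
  { apply Rmult_eq_reg_l with d; auto.
    replace (d * x3) with
      ((x1 * a1 + x2 * a2 + x3 * a3) * (b1 * n2 - b2 * n1)
       - (x1 * b1 + x2 * b2 + x3 * b3) * (a1 * n2 - a2 * n1)
       + (x1 * n1 + x2 * n2 + x3 * n3) * (a1 * b2 - a2 * b1)) by (unfold d; ring).
    rewrite Ea, Eb, En; ring. }
  apply Rminus_diag_uniq.
  match goal with |- ?l = 0 => replace l with (x1 * w1 + x2 * w2 + x3 * w3) end.
  - rewrite X1, X2, X3; ring.
  - unfold x1, x2, x3; field; auto.
Qed.

(** * The equations of Gauss and Codazzi *)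

(** [e] and [s] are the lengths of the coordinate vectors: the metric is e^2 dtheta^2 + s^2
    dphi^2. *)
Record rotational_metric (e s : R -> R) : Prop := {
  rm_e_pos : forall u, 0 < u < PI -> 0 < e u;
  rm_s_pos : forall u, 0 < u < PI -> 0 < s u;
  rm_e_smooth : Ck1 1 (fun u => 0 < u < PI) e;
  rm_s_smooth : Ck1 1 (fun u => 0 < u < PI) s
}.

Record immersion (e s : R -> R) (Y n : patch) : Prop := {
  im_Y : Ck3 3 interior_strip Y;
  im_n : Ck3 3 interior_strip n;
  im_g11 : forall u v, interior_strip u v -> g11 Y u v = e u ^ 2;
  im_g12 : forall u v, interior_strip u v -> g12 Y u v = 0;
  im_g22 : forall u v, interior_strip u v -> g22 Y u v = s u ^ 2;
  im_nn : forall u v, interior_strip u v -> dot (n u v) (n u v) = 1;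
  im_n1 : forall u v, interior_strip u v -> dot (n u v) (d1 Y u v) = 0;
  im_n2 : forall u v, interior_strip u v -> dot (n u v) (d2 Y u v) = 0
}.

Lemma rm_ex_derive e s : rotational_metric e s -> forall u, 0 < u < PI ->
  is_derive e u (Derive e u) /\ is_derive s u (Derive s u).
Proof.
  intros M u Hu; split.
  - exact (Ck_is_D1 0 _ _ u 0 (rm_e_smooth e s M) Hu).
  - exact (Ck_is_D1 0 _ _ u 0 (rm_s_smooth e s M) Hu).
Qed.

Lemma Derive_square (f : R -> R) x l : is_derive f x l ->
  Derive (fun t => f t ^ 2) x = 2 * (f x * l).
Proof.
  intros Hf; apply is_derive_unique, (is_derive_ext (fun t => f t * f t));
    [intros; simpl; ring|].
  evar_last; [now apply is_derive_Rmult; eauto|simpl; ring].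
Qed.

(** Gauss' formulas. The tangential components of the second derivatives come from differentiating
    g11 = e^2, g12 = 0 and g22 = s^2 in both directions; the normal ones are -h by definition.
    Pairing with an arbitrary [w] avoids equations between vectors. *)
Lemma immersion_gauss e s Y n : rotational_metric e s -> immersion e s Y n ->
  forall u v, interior_strip u v -> forall w,
  dot (d1 (d1 Y) u v) w
    = Derive e u / e u * dot (d1 Y u v) w - h11 Y n u v * dot (n u v) w /\
  dot (d1 (d2 Y) u v) w
    = Derive s u / s u * dot (d2 Y u v) w - h12 Y n u v * dot (n u v) w /\
  dot (d2 (d2 Y) u v) w
    = - (s u * Derive s u / e u ^ 2) * dot (d1 Y u v) w - h22 Y n u v * dot (n u v) w.
Proof.
  intros M IM u v Huv w.
  assert (HO := open2_interior_strip).
  destruct (rm_ex_derive e s M u Huv) as [De Ds].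
  assert (Pe := rm_e_pos e s M u Huv); assert (Ps := rm_s_pos e s M u Huv).
  assert (HY := im_Y _ _ _ _ IM).
  assert (HY1 := Ck3_d1 2 _ _ HY); assert (HY2 := Ck3_d2 2 _ _ HY).
  assert (C12 := d1_d2_comm _ Y u v HO (Ck3_le 2 3 _ _ ltac:(lia) HY) Huv).
  assert (E111 : dot (d1 (d1 Y) u v) (d1 Y u v) = e u * Derive e u).
  { assert (K : D1 (g11 Y) u v = _) by exact (D1_dot 1 _ _ _ u v HY1 HY1 Huv).
    rewrite (D1_ext _ _ (fun u _ => e u ^ 2) u v HO (im_g11 _ _ _ _ IM) Huv) in K.
    unfold D1 in K; rewrite (Derive_square e u _ De) in K.
    rewrite (dot_comm (d1 Y u v)) in K; lra. }
  assert (E121 : dot (d1 (d2 Y) u v) (d1 Y u v) = 0).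
  { rewrite C12.
    assert (K : D2 (g11 Y) u v = _) by exact (D2_dot 1 _ _ _ u v HY1 HY1 Huv).
    rewrite (D2_ext _ _ (fun u _ => e u ^ 2) u v HO (im_g11 _ _ _ _ IM) Huv) in K.
    unfold D2 in K; rewrite Derive_const in K.
    rewrite (dot_comm (d1 Y u v)) in K; lra. }
  assert (E122 : dot (d1 (d2 Y) u v) (d2 Y u v) = s u * Derive s u).
  { assert (K : D1 (g22 Y) u v = _) by exact (D1_dot 1 _ _ _ u v HY2 HY2 Huv).
    rewrite (D1_ext _ _ (fun u _ => s u ^ 2) u v HO (im_g22 _ _ _ _ IM) Huv) in K.
    unfold D1 in K; rewrite (Derive_square s u _ Ds) in K.
    rewrite (dot_comm (d2 Y u v)) in K; lra. }
  assert (E222 : dot (d2 (d2 Y) u v) (d2 Y u v) = 0).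
  { assert (K : D2 (g22 Y) u v = _) by exact (D2_dot 1 _ _ _ u v HY2 HY2 Huv).
    rewrite (D2_ext _ _ (fun u _ => s u ^ 2) u v HO (im_g22 _ _ _ _ IM) Huv) in K.
    unfold D2 in K; rewrite Derive_const in K.
    rewrite (dot_comm (d2 Y u v)) in K; lra. }
  assert (E112 : dot (d1 (d1 Y) u v) (d2 Y u v) = 0).
  { assert (K : D1 (g12 Y) u v = _) by exact (D1_dot 1 _ _ _ u v HY1 HY2 Huv).
    rewrite (D1_ext _ _ (fun u _ => 0) u v HO (im_g12 _ _ _ _ IM) Huv) in K.
    unfold D1 in K; rewrite Derive_const in K.
    rewrite (dot_comm (d1 Y u v)) in K; lra. }
  assert (E221 : dot (d2 (d2 Y) u v) (d1 Y u v) = - (s u * Derive s u)).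
  { assert (K : D2 (g12 Y) u v = _) by exact (D2_dot 1 _ _ _ u v HY1 HY2 Huv).
    rewrite (D2_ext _ _ (fun u _ => 0) u v HO (im_g12 _ _ _ _ IM) Huv) in K.
    unfold D2 in K; rewrite Derive_const in K.
    rewrite <- C12, (dot_comm (d1 Y u v)) in K; lra. }
  assert (G1 := im_g11 _ _ _ _ IM u v Huv); unfold g11 in G1.
  assert (G2 := im_g22 _ _ _ _ IM u v Huv); unfold g22 in G2.
  assert (F : forall x, dot x w = dot x (d1 Y u v) * dot (d1 Y u v) w / e u ^ 2
     + dot x (d2 Y u v) * dot (d2 Y u v) w / s u ^ 2 + dot x (n u v) * dot (n u v) w).
  { intros x; rewrite <- G1, <- G2, (dot_comm (d1 Y u v) w), (dot_comm (d2 Y u v) w),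
      (dot_comm (n u v) w).
    apply dot_frame.
    - rewrite G1; apply Rgt_not_eq; nra.
    - rewrite G2; apply Rgt_not_eq; nra.
    - now apply (im_nn _ _ _ _ IM).
    - now apply (im_g12 _ _ _ _ IM).
    - now apply (im_n1 _ _ _ _ IM).
    - now apply (im_n2 _ _ _ _ IM). }
  unfold h11, h12, h22; split; [|split]; rewrite F.
  - rewrite E111, E112; field; lra.
  - rewrite E121, E122; field; lra.
  - rewrite E221, E222; field; lra.
Qed.

(** Weingarten's equations, by differentiating <n, d_j Y> = 0. The two expressions of h12 are the
    symmetry of the shape operator. *)
Lemma second_form_normal_derivatives U Y n : open2 U -> Ck3 2 U Y -> Ck3 1 U n ->
  (forall u v, U u v -> dot (n u v) (d1 Y u v) = 0) ->
  (forall u v, U u v -> dot (n u v) (d2 Y u v) = 0) ->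
  forall u v, U u v ->
  h11 Y n u v = dot (d1 n u v) (d1 Y u v) /\ h12 Y n u v = dot (d1 n u v) (d2 Y u v) /\
  h12 Y n u v = dot (d2 n u v) (d1 Y u v) /\ h22 Y n u v = dot (d2 n u v) (d2 Y u v).
Proof.
  intros HO HY Hn N1 N2 u v Huv.
  assert (HY1 := Ck3_d1 1 _ _ HY); assert (HY2 := Ck3_d2 1 _ _ HY).
  assert (C12 := d1_d2_comm _ Y u v HO HY Huv).
  assert (K11 := D1_dot 0 _ _ _ u v Hn HY1 Huv).
  rewrite (D1_ext _ _ (fun u _ => 0) u v HO N1 Huv) in K11.
  assert (K12 := D1_dot 0 _ _ _ u v Hn HY2 Huv).
  rewrite (D1_ext _ _ (fun u _ => 0) u v HO N2 Huv) in K12.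
  assert (K21 := D2_dot 0 _ _ _ u v Hn HY1 Huv).
  rewrite (D2_ext _ _ (fun u _ => 0) u v HO N1 Huv) in K21.
  assert (K22 := D2_dot 0 _ _ _ u v Hn HY2 Huv).
  rewrite (D2_ext _ _ (fun u _ => 0) u v HO N2 Huv) in K22.
  unfold D1, D2 in *; rewrite Derive_const in *.
  rewrite <- C12 in K21.
  rewrite (dot_comm (n u v)) in K11, K12, K21, K22.
  unfold h11, h12, h22; repeat split; lra.
Qed.

Lemma immersion_normal_derivatives e s Y n : immersion e s Y n ->
  forall u v, interior_strip u v ->
  dot (d1 n u v) (n u v) = 0 /\ dot (d2 n u v) (n u v) = 0 /\
  h11 Y n u v = dot (d1 n u v) (d1 Y u v) /\ h12 Y n u v = dot (d1 n u v) (d2 Y u v) /\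
  h12 Y n u v = dot (d2 n u v) (d1 Y u v) /\ h22 Y n u v = dot (d2 n u v) (d2 Y u v).
Proof.
  intros IM u v Huv.
  assert (HO := open2_interior_strip).
  assert (Hn := Ck3_le 1 3 _ _ ltac:(lia) (im_n _ _ _ _ IM)).
  assert (K1 := D1_dot 0 _ _ _ u v Hn Hn Huv).
  rewrite (D1_ext _ _ (fun u _ => 1) u v HO (im_nn _ _ _ _ IM) Huv) in K1.
  assert (K2 := D2_dot 0 _ _ _ u v Hn Hn Huv).
  rewrite (D2_ext _ _ (fun u _ => 1) u v HO (im_nn _ _ _ _ IM) Huv) in K2.
  unfold D1, D2 in *; rewrite Derive_const in *.
  rewrite (dot_comm (n u v)) in K1, K2.
  split; [lra|split; [lra|]].
  apply (second_form_normal_derivatives interior_strip); auto.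
  - apply (Ck3_le 2 3); [lia|apply (im_Y _ _ _ _ IM)].
  - apply (im_n1 _ _ _ _ IM).
  - apply (im_n2 _ _ _ _ IM).
Qed.

(** This is K e^2 s^2 with K = -(s'/e)' / (e s) the Gauss curvature of the metric. The term (s s')'
    is kept whole because it is the theta-derivative of <Y_12, Y_2>. *)
Definition intrinsic_det (e s : R -> R) (u : R) : R :=
  Derive e u * s u * Derive s u / e u + Derive s u ^ 2
  - Derive (fun t => s t * Derive s t) u.

(** Subtract the phi-derivative of <Y_11, Y_2> = 0 from the theta-derivative of <Y_12, Y_2> = s s'.
    The third derivatives cancel, and the remaining <Y_12, Y_12> - <Y_11, Y_22> is evaluated by
    Gauss' formulas. *)
Lemma theorema_egregium e s Y n : rotational_metric e s -> immersion e s Y n ->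
  forall u v, interior_strip u v ->
  h11 Y n u v * h22 Y n u v - h12 Y n u v ^ 2 = intrinsic_det e s u.
Proof.
  intros M IM u v Huv.
  assert (HO := open2_interior_strip).
  assert (HY := im_Y _ _ _ _ IM).
  assert (HY1 := Ck3_d1 2 _ _ HY); assert (HY2 := Ck3_d2 2 _ _ HY).
  assert (HY11 := Ck3_d1 1 _ _ HY1); assert (HY12 := Ck3_d1 1 _ _ HY2).
  assert (Pe := rm_e_pos e s M u Huv); assert (Ps := rm_s_pos e s M u Huv).
  destruct (immersion_gauss e s Y n M IM u v Huv (d2 (d2 Y) u v)) as [A1 _].
  destruct (immersion_gauss e s Y n M IM u v Huv (d1 (d2 Y) u v)) as [_ [A2 _]].
  destruct (immersion_gauss e s Y n M IM u v Huv (d1 Y u v)) as [_ [_ A3]].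
  destruct (immersion_gauss e s Y n M IM u v Huv (d2 Y u v)) as [_ [A4 _]].
  assert (B1 : D1 (fun u v => dot (d1 (d2 Y) u v) (d2 Y u v)) u v
               = Derive (fun t => s t * Derive s t) u).
  { apply (D1_ext interior_strip _ (fun t _ => s t * Derive s t) u v HO); auto.
    intros x y Hxy.
    destruct (immersion_gauss e s Y n M IM x y Hxy (d2 Y x y)) as [_ [-> _]].
    fold (g22 Y x y); rewrite (im_g22 _ _ _ _ IM x y Hxy), (im_n2 _ _ _ _ IM x y Hxy).
    generalize (rm_s_pos e s M x Hxy); intros; field; lra. }
  assert (B2 : D2 (fun u v => dot (d1 (d1 Y) u v) (d2 Y u v)) u v = 0).
  { rewrite (D2_ext interior_strip _ (fun t _ => 0) u v HO); auto.
    - exact (Derive_const 0 v).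
    - intros x y Hxy.
      destruct (immersion_gauss e s Y n M IM x y Hxy (d2 Y x y)) as [-> _].
      fold (g12 Y x y); rewrite (im_g12 _ _ _ _ IM x y Hxy), (im_n2 _ _ _ _ IM x y Hxy).
      ring. }
  rewrite (D1_dot 0 _ _ _ u v HY12 (Ck3_le 1 2 _ _ ltac:(lia) HY2) Huv) in B1.
  rewrite (D2_dot 0 _ _ _ u v HY11 (Ck3_le 1 2 _ _ ltac:(lia) HY2) Huv) in B2.
  assert (C12 : d2 (d1 (d1 Y)) u v = d1 (d1 (d2 Y)) u v).
  { rewrite <- (d1_d2_comm _ (d1 Y) u v HO HY1 Huv).
    assert (C : forall x y, interior_strip x y -> d2 (d1 Y) x y = d1 (d2 Y) x y).
    { intros x y Hxy; symmetry.
      apply (d1_d2_comm _ Y x y HO (Ck3_le 2 3 _ _ ltac:(lia) HY) Hxy). }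
    unfold d1 at 1 3.
    apply f_equal2; [apply f_equal2|].
    - apply (D1_ext interior_strip (fun x y => vx (d2 (d1 Y) x y))
               (fun x y => vx (d1 (d2 Y) x y))); auto; intros; now rewrite C.
    - apply (D1_ext interior_strip (fun x y => vy (d2 (d1 Y) x y))
               (fun x y => vy (d1 (d2 Y) x y))); auto; intros; now rewrite C.
    - apply (D1_ext interior_strip (fun x y => vz (d2 (d1 Y) x y))
               (fun x y => vz (d1 (d2 Y) x y))); auto; intros; now rewrite C. }
  rewrite C12 in B2.
  unfold intrinsic_det; rewrite <- B1.
  assert (N1 := im_n1 _ _ _ _ IM u v Huv); assert (N2 := im_n2 _ _ _ _ IM u v Huv).
  assert (G1 := im_g11 _ _ _ _ IM u v Huv); assert (G12 := im_g12 _ _ _ _ IM u v Huv).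
  assert (G2 := im_g22 _ _ _ _ IM u v Huv).
  unfold g11, g12, g22 in *.
  rewrite N1, G1 in A3; rewrite N2, G2 in A4.
  rewrite (dot_comm (d1 Y u v)), A3 in A1.
  rewrite (dot_comm (d2 Y u v)), A4 in A2.
  rewrite A1, (dot_comm (n u v)) in B2; rewrite A2, (dot_comm (n u v)) in B1 |- *.
  fold (h22 Y n u v) in *.
  replace (dot (d2 (d2 Y) u v) (n u v)) with (- h22 Y n u v) in B2 by (unfold h22; ring).
  replace (dot (d1 (d2 Y) u v) (n u v)) with (- h12 Y n u v) in * by (unfold h12; ring).
  match goal with
  | |- _ = _ - (?t + _) =>
    replace t with (- (Derive e u / e u * (- (s u * Derive s u / e u ^ 2) * e u ^ 2
       - h22 Y n u v * 0) - h11 Y n u v * - h22 Y n u v)) by lra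
  end.
  field; lra.
Qed.

Lemma immersion_h_smooth e s Y n : immersion e s Y n ->
  Ck 1 interior_strip (h11 Y n) /\ Ck 1 interior_strip (h12 Y n) /\
  Ck 1 interior_strip (h22 Y n).
Proof.
  intros IM.
  assert (HO := open2_interior_strip).
  assert (HY := im_Y _ _ _ _ IM); assert (Hn := Ck3_le 1 3 _ _ ltac:(lia) (im_n _ _ _ _ IM)).
  assert (HY1 := Ck3_d1 2 _ _ HY); assert (HY2 := Ck3_d2 2 _ _ HY).
  split; [|split]; apply Ck_opp; auto; apply Ck_dot; auto.
  - now apply Ck3_d1.
  - now apply Ck3_d1.
  - now apply Ck3_d2.
Qed.

(** With each h_ij written as <d_i n, d_j Y>, the mixed second derivatives of [n] cancel by Schwarz,
    and the terms <n_i, Y_jk> that remain are given by Gauss' formulas. *)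
Lemma codazzi e s Y n : rotational_metric e s -> immersion e s Y n ->
  forall u v, interior_strip u v ->
  D1 (h22 Y n) u v - D2 (h12 Y n) u v
    = s u * Derive s u / e u ^ 2 * h11 Y n u v + Derive s u / s u * h22 Y n u v /\
  D2 (h11 Y n) u v - D1 (h12 Y n) u v
    = (Derive s u / s u - Derive e u / e u) * h12 Y n u v.
Proof.
  intros M IM u v Huv.
  assert (HO := open2_interior_strip).
  assert (HY := im_Y _ _ _ _ IM); assert (Hn := im_n _ _ _ _ IM).
  assert (HY1 := Ck3_le 1 2 _ _ ltac:(lia) (Ck3_d1 2 _ _ HY)).
  assert (HY2 := Ck3_le 1 2 _ _ ltac:(lia) (Ck3_d2 2 _ _ HY)).
  assert (Hn1 := Ck3_le 1 2 _ _ ltac:(lia) (Ck3_d1 2 _ _ Hn)).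
  assert (Hn2 := Ck3_le 1 2 _ _ ltac:(lia) (Ck3_d2 2 _ _ Hn)).
  assert (CY := d1_d2_comm _ Y u v HO (Ck3_le 2 3 _ _ ltac:(lia) HY) Huv).
  assert (Cn := d1_d2_comm _ n u v HO (Ck3_le 2 3 _ _ ltac:(lia) Hn) Huv).
  assert (W := immersion_normal_derivatives e s Y n IM).
  assert (W11 : forall u v, interior_strip u v -> h11 Y n u v = dot (d1 n u v) (d1 Y u v))
    by (intros x y Hxy; apply (W x y Hxy)).
  assert (W12 : forall u v, interior_strip u v -> h12 Y n u v = dot (d1 n u v) (d2 Y u v))
    by (intros x y Hxy; apply (W x y Hxy)).
  assert (W21 : forall u v, interior_strip u v -> h12 Y n u v = dot (d2 n u v) (d1 Y u v))
    by (intros x y Hxy; apply (W x y Hxy)).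
  assert (W22 : forall u v, interior_strip u v -> h22 Y n u v = dot (d2 n u v) (d2 Y u v))
    by (intros x y Hxy; apply (W x y Hxy)).
  destruct (W u v Huv) as [Z1 [Z2 _]].
  destruct (immersion_gauss e s Y n M IM u v Huv (d1 n u v)) as [_ [A1 A2]].
  destruct (immersion_gauss e s Y n M IM u v Huv (d2 n u v)) as [B1 [B2 _]].
  rewrite (dot_comm (n u v)), Z1 in A1, A2; rewrite (dot_comm (n u v)), Z2 in B1, B2.
  rewrite (dot_comm (d2 Y u v)), <- (W12 u v Huv), dot_comm in A1.
  rewrite (dot_comm (d1 Y u v)), <- (W11 u v Huv), dot_comm in A2.
  rewrite (dot_comm (d1 Y u v)), <- (W21 u v Huv), dot_comm in B1.
  rewrite (dot_comm (d2 Y u v)), <- (W22 u v Huv), dot_comm in B2.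
  rewrite (D1_ext _ _ _ u v HO W22 Huv), (D2_ext _ _ _ u v HO W12 Huv),
          (D2_ext _ _ _ u v HO W11 Huv), (D1_ext _ _ _ u v HO W21 Huv).
  rewrite (D1_dot 0 _ _ _ u v Hn2 HY2 Huv), (D2_dot 0 _ _ _ u v Hn1 HY2 Huv),
          (D2_dot 0 _ _ _ u v Hn1 HY1 Huv), (D1_dot 0 _ _ _ u v Hn2 HY1 Huv).
  rewrite <- Cn, <- CY, A1, A2, B1, B2.
  split; ring.
Qed.

(** * The divergence identity behind Herglotz' formula *)

Definition mixed_det (Y n Y' n' : patch) (u v : R) : R :=
  h22 Y n u v * h11 Y' n' u v + h11 Y n u v * h22 Y' n' u v
  - 2 * h12 Y n u v * h12 Y' n' u v.

(** Contravariant components multiplied by the area density e s, so that the divergence becomes the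
    plain sum of the two partial derivatives; the cofactors carry a factor 1 / (e s)^2, of which 1 /
    (e s) is left. *)
Definition flux1 (e s : R -> R) (Y n Z : patch) (c : vec3) (u v : R) : R :=
  (h22 Y n u v * dot (vsub (Z u v) c) (d1 Z u v)
   - h12 Y n u v * dot (vsub (Z u v) c) (d2 Z u v)) / (e u * s u).
Definition flux2 (e s : R -> R) (Y n Z : patch) (c : vec3) (u v : R) : R :=
  (h11 Y n u v * dot (vsub (Z u v) c) (d2 Z u v)
   - h12 Y n u v * dot (vsub (Z u v) c) (d1 Z u v)) / (e u * s u).

Lemma d1_vsub U Y c u v : Ck3 1 U Y -> U u v ->
  d1 (fun u v => vsub (Y u v) c) u v = d1 Y u v.
Proof.
  intros [P1 [P2 P3]] Huv.
  unfold d1; apply f_equal2; [apply f_equal2|];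
    (apply is_derive_unique;
     match goal with |- is_derive _ _ ?l => replace l with (l - 0) by ring end;
     apply (is_derive_minus (V := R_NormedModule)); [|apply is_derive_Rconst]).
  - exact (Ck_is_D1 0 _ _ u v P1 Huv).
  - exact (Ck_is_D1 0 _ _ u v P2 Huv).
  - exact (Ck_is_D1 0 _ _ u v P3 Huv).
Qed.

Lemma d2_vsub U Y c u v : Ck3 1 U Y -> U u v ->
  d2 (fun u v => vsub (Y u v) c) u v = d2 Y u v.
Proof.
  intros [P1 [P2 P3]] Huv.
  unfold d2; apply f_equal2; [apply f_equal2|];
    (apply is_derive_unique;
     match goal with |- is_derive _ _ ?l => replace l with (l - 0) by ring end;
     apply (is_derive_minus (V := R_NormedModule)); [|apply is_derive_Rconst]).
  - exact (Ck_is_D2 0 _ _ u v P1 Huv).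
  - exact (Ck_is_D2 0 _ _ u v P2 Huv).
  - exact (Ck_is_D2 0 _ _ u v P3 Huv).
Qed.

Lemma flux_smooth e s Y n Z m c : rotational_metric e s -> immersion e s Y n ->
  immersion e s Z m ->
  Ck 1 interior_strip (flux1 e s Y n Z c) /\ Ck 1 interior_strip (flux2 e s Y n Z c).
Proof.
  intros M IM IZ.
  assert (HO := open2_interior_strip).
  destruct (immersion_h_smooth e s Y n IM) as [H1 [H2 H3]].
  assert (HZ := im_Y _ _ _ _ IZ).
  assert (HZ1 := Ck3_le 1 2 _ _ ltac:(lia) (Ck3_d1 2 _ _ HZ)).
  assert (HZ2 := Ck3_le 1 2 _ _ ltac:(lia) (Ck3_d2 2 _ _ HZ)).
  assert (HZ0 := Ck3_le 1 3 _ _ ltac:(lia) HZ).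
  assert (HZc := Ck3_vsub 1 _ Z c HO HZ0).
  assert (V1 := Ck_dot 1 _ _ _ HO HZc HZ1); assert (V2 := Ck_dot 1 _ _ _ HO HZc HZ2).
  split; (apply Ck_div; auto; [apply Ck_minus; auto; apply Ck_mult; auto| |]).
  1, 3: apply Ck_mult; auto; [apply (rm_e_smooth e s M)|apply (rm_s_smooth e s M)].
  1, 2: intros u v Huv; assert (Pe := rm_e_pos e s M u Huv);
     assert (Ps := rm_s_pos e s M u Huv); apply Rgt_not_eq; nra.
Qed.

(* The vector field is the tangential part of the position vector of the second
   surface, contracted with the cofactor tensor of the second fundamental form of
   the first one; that tensor is divergence free by Codazzi. *)
Lemma flux_divergence e s Y n Z m c : rotational_metric e s -> immersion e s Y n ->
  immersion e s Z m -> forall u v, interior_strip u v ->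
  D1 (flux1 e s Y n Z c) u v + D2 (flux2 e s Y n Z c) u v =
  s u / e u * h11 Y n u v + e u / s u * h22 Y n u v
  - dot (vsub (Z u v) c) (m u v) * mixed_det Y n Z m u v / (e u * s u).
Proof.
  intros M IM IZ u v Huv.
  assert (HO := open2_interior_strip).
  destruct (rm_ex_derive e s M u Huv) as [De Ds].
  assert (Pe := rm_e_pos e s M u Huv); assert (Ps := rm_s_pos e s M u Huv).
  destruct (immersion_h_smooth e s Y n IM) as [S1 [S2 S3]].
  destruct (codazzi e s Y n M IM u v Huv) as [Co1 Co2].
  assert (HZ := im_Y _ _ _ _ IZ).
  assert (HZ1 := Ck3_le 1 2 _ _ ltac:(lia) (Ck3_d1 2 _ _ HZ)).
  assert (HZ2 := Ck3_le 1 2 _ _ ltac:(lia) (Ck3_d2 2 _ _ HZ)).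
  assert (HZ0 := Ck3_le 1 3 _ _ ltac:(lia) HZ).
  assert (HZc := Ck3_vsub 1 _ Z c HO HZ0).
  assert (C12 := d1_d2_comm _ Z u v HO (Ck3_le 2 3 _ _ ltac:(lia) HZ) Huv).
  destruct (immersion_gauss e s Z m M IZ u v Huv (vsub (Z u v) c)) as [G1 [G2 G3]].
  set (V1 := fun u v => dot (vsub (Z u v) c) (d1 Z u v)).
  set (V2 := fun u v => dot (vsub (Z u v) c) (d2 Z u v)).
  assert (SV1 : Ck 1 interior_strip V1) by now apply Ck_dot.
  assert (SV2 : Ck 1 interior_strip V2) by now apply Ck_dot.
  assert (E11 : D1 V1 u v = e u ^ 2 + (Derive e u / e u * V1 u v
                            - h11 Z m u v * dot (vsub (Z u v) c) (m u v))).
  { unfold V1; rewrite (D1_dot 0 _ _ _ u v HZc HZ1 Huv), (d1_vsub _ Z c u v HZ0 Huv).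
    fold (g11 Z u v); rewrite (im_g11 _ _ _ _ IZ u v Huv).
    rewrite (dot_comm (vsub (Z u v) c) (d1 (d1 Z) u v)), G1, (dot_comm (m u v)),
      (dot_comm (vsub (Z u v) c) (d1 Z u v)); reflexivity. }
  assert (E12 : D1 V2 u v = Derive s u / s u * V2 u v
                            - h12 Z m u v * dot (vsub (Z u v) c) (m u v)).
  { unfold V2; rewrite (D1_dot 0 _ _ _ u v HZc HZ2 Huv), (d1_vsub _ Z c u v HZ0 Huv).
    fold (g12 Z u v); rewrite (im_g12 _ _ _ _ IZ u v Huv).
    rewrite (dot_comm (vsub (Z u v) c) (d1 (d2 Z) u v)), G2, (dot_comm (m u v)),
      (dot_comm (vsub (Z u v) c) (d2 Z u v)); ring. }
  assert (E21 : D2 V1 u v = Derive s u / s u * V2 u v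
                            - h12 Z m u v * dot (vsub (Z u v) c) (m u v)).
  { unfold V1; rewrite (D2_dot 0 _ _ _ u v HZc HZ1 Huv), (d2_vsub _ Z c u v HZ0 Huv).
    rewrite (dot_comm (d2 Z u v)); fold (g12 Z u v); rewrite (im_g12 _ _ _ _ IZ u v Huv).
    rewrite <- C12.
    rewrite (dot_comm (vsub (Z u v) c) (d1 (d2 Z) u v)), G2, (dot_comm (m u v)).
    unfold V2; rewrite (dot_comm (vsub (Z u v) c) (d2 Z u v)); ring. }
  assert (E22 : D2 V2 u v = s u ^ 2 + (- (s u * Derive s u / e u ^ 2) * V1 u v
                            - h22 Z m u v * dot (vsub (Z u v) c) (m u v))).
  { unfold V2; rewrite (D2_dot 0 _ _ _ u v HZc HZ2 Huv), (d2_vsub _ Z c u v HZ0 Huv).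
    fold (g22 Z u v); rewrite (im_g22 _ _ _ _ IZ u v Huv).
    rewrite (dot_comm (vsub (Z u v) c) (d2 (d2 Z) u v)), G3, (dot_comm (m u v)).
    unfold V1; rewrite (dot_comm (vsub (Z u v) c) (d1 Z u v)); reflexivity. }
  assert (F1 : D1 (flux1 e s Y n Z c) u v =
    ((D1 (h22 Y n) u v * V1 u v + h22 Y n u v * D1 V1 u v
      - (D1 (h12 Y n) u v * V2 u v + h12 Y n u v * D1 V2 u v)) * (e u * s u)
     - (h22 Y n u v * V1 u v - h12 Y n u v * V2 u v)
       * (Derive e u * s u + e u * Derive s u)) / (e u * s u) ^ 2).
  { apply is_derive_unique.
    apply (is_derive_div (fun t => h22 Y n t v * V1 t v - h12 Y n t v * V2 t v)
                         (fun t => e t * s t)).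
    - apply (is_derive_minus (V := R_NormedModule));
        [apply (is_derive_Rmult (fun t => h22 Y n t v) (fun t => V1 t v))
        |apply (is_derive_Rmult (fun t => h12 Y n t v) (fun t => V2 t v))].
      + now apply (Ck_is_D1 0 interior_strip (h22 Y n) u v).
      + now apply (Ck_is_D1 0 interior_strip V1 u v).
      + now apply (Ck_is_D1 0 interior_strip (h12 Y n) u v).
      + now apply (Ck_is_D1 0 interior_strip V2 u v).
    - now apply is_derive_Rmult.
    - apply Rgt_not_eq; nra. }
  assert (F2 : D2 (flux2 e s Y n Z c) u v =
    ((D2 (h11 Y n) u v * V2 u v + h11 Y n u v * D2 V2 u v
      - (D2 (h12 Y n) u v * V1 u v + h12 Y n u v * D2 V1 u v)) * (e u * s u)
     - (h11 Y n u v * V2 u v - h12 Y n u v * V1 u v) * 0) / (e u * s u) ^ 2).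
  { apply is_derive_unique.
    apply (is_derive_div (fun t => h11 Y n u t * V2 u t - h12 Y n u t * V1 u t)
                         (fun t => e u * s u)).
    - apply (is_derive_minus (V := R_NormedModule));
        [apply (is_derive_Rmult (fun t => h11 Y n u t) (fun t => V2 u t))
        |apply (is_derive_Rmult (fun t => h12 Y n u t) (fun t => V1 u t))].
      + now apply (Ck_is_D2 0 interior_strip (h11 Y n) u v).
      + now apply (Ck_is_D2 0 interior_strip V2 u v).
      + now apply (Ck_is_D2 0 interior_strip (h12 Y n) u v).
      + now apply (Ck_is_D2 0 interior_strip V1 u v).
    - apply is_derive_Rconst.
    - apply Rgt_not_eq; nra. }
  rewrite F1, F2, E11, E12, E21, E22.
  (* Codazzi's equations eliminate two derivatives of h; the two others then cancel. *)
  replace (D1 (h22 Y n) u v)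
    with (D2 (h12 Y n) u v + (s u * Derive s u / e u ^ 2 * h11 Y n u v
                              + Derive s u / s u * h22 Y n u v)) by lra.
  replace (D2 (h11 Y n) u v)
    with (D1 (h12 Y n) u v + (Derive s u / s u - Derive e u / e u) * h12 Y n u v) by lra.
  unfold mixed_det; field; lra.
Qed.

(** * Integration over the sphere in polar coordinates *)

(** The poles are included, and continuity there is two-sided in theta, so values beyond the closed
    interval count as well. *)
Definition cont_polar (W : R -> R -> R) : Prop :=
  forall u v, 0 <= u <= PI -> continuity_2d_pt W u v.

Definition polar_integral (W : R -> R -> R) : R :=
  RInt (fun v => RInt (fun u => W u v) 0 PI) 0 (2 * PI).

Lemma PI_gt_3 : 3 < PI.
Proof. generalize PI2_3_2; lra. Qed.

Lemma cont_polar_Ck n W : Ck n wide_strip W -> cont_polar W.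
Proof.
  intros HW u v Hu; apply (Ck_cont n wide_strip); auto.
  unfold wide_strip; generalize PI_gt_3; lra.
Qed.

Lemma cont_polar_const c : cont_polar (fun _ _ => c).
Proof. intros u v _; apply continuity_2d_pt_const. Qed.

Lemma cont_polar_plus f g : cont_polar f -> cont_polar g ->
  cont_polar (fun u v => f u v + g u v).
Proof. intros Hf Hg u v Hu; apply continuity_2d_pt_plus; auto. Qed.

Lemma cont_polar_minus f g : cont_polar f -> cont_polar g ->
  cont_polar (fun u v => f u v - g u v).
Proof. intros Hf Hg u v Hu; apply continuity_2d_pt_minus; auto. Qed.

Lemma cont_polar_mult f g : cont_polar f -> cont_polar g ->
  cont_polar (fun u v => f u v * g u v).
Proof. intros Hf Hg u v Hu; apply continuity_2d_pt_mult; auto. Qed.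

Lemma cont_polar_div f g : cont_polar f -> cont_polar g ->
  (forall u v, 0 <= u <= PI -> g u v <> 0) -> cont_polar (fun u v => f u v / g u v).
Proof.
  intros Hf Hg H0 u v Hu; apply continuity_2d_pt_mult; auto.
  apply continuity_2d_pt_inv; auto.
Qed.

Lemma cont_polar_fst (g : R -> R) : (forall u, 0 <= u <= PI -> continuity_pt g u) ->
  cont_polar (fun u _ => g u).
Proof. intros Hg u v Hu; apply continuity_pt_2d_fst; auto. Qed.

Lemma cont_polar_dot Y Z :
  cont_polar (fun u v => vx (Y u v)) -> cont_polar (fun u v => vy (Y u v)) ->
  cont_polar (fun u v => vz (Y u v)) ->
  cont_polar (fun u v => vx (Z u v)) -> cont_polar (fun u v => vy (Z u v)) ->
  cont_polar (fun u v => vz (Z u v)) ->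
  cont_polar (fun u v => dot (Y u v) (Z u v)).
Proof.
  intros; unfold dot.
  apply cont_polar_plus; [apply cont_polar_plus|]; apply cont_polar_mult; auto.
Qed.

Lemma continuity_2d_fst_section f u v : continuity_2d_pt f u v ->
  continuous (fun t => f t v) u.
Proof.
  intros Hf; apply continuity_pt_filterlim.
  intros eps Heps.
  destruct (Hf (mkposreal eps Heps)) as [d Hd].
  exists d; split; [apply cond_pos|].
  intros x [_ Hx]; apply Hd; auto.
  rewrite Rminus_eq_0, Rabs_R0; apply cond_pos.
Qed.

Lemma continuity_2d_snd_section f u v : continuity_2d_pt f u v ->
  continuous (fun t => f u t) v.
Proof.
  intros Hf; apply continuity_pt_filterlim.
  intros eps Heps.
  destruct (Hf (mkposreal eps Heps)) as [d Hd].
  exists d; split; [apply cond_pos|].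
  intros x [_ Hx]; apply Hd; auto.
  rewrite Rminus_eq_0, Rabs_R0; apply cond_pos.
Qed.

Lemma cont_polar_ex_RInt W a b v : cont_polar W -> 0 <= a <= PI -> 0 <= b <= PI ->
  ex_RInt (fun u => W u v) a b.
Proof.
  intros HW Ha Hb; apply (ex_RInt_continuous (V := R_CompleteNormedModule)); intros u Hu.
  apply (continuity_2d_fst_section W u v), HW.
  revert Hu; unfold Rmin, Rmax; destruct (Rle_dec a b); lra.
Qed.

(** Compactness is used in the form of a positive lower bound for a gauge. Keeping the gauge below 1
    / (1 + |W|) turns that lower bound into an upper bound for |W|. *)
Lemma cont_polar_bounded W : cont_polar W ->
  exists B, 0 <= B /\
    forall u v, 0 <= u <= PI -> 0 <= v <= 2 * PI -> Rabs (W u v) <= B.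
Proof.
  intros HW.
  assert (D : forall u v, {d : posreal | 0 <= u <= PI ->
     (forall x y, Rabs (x - u) < d -> Rabs (y - v) < d -> Rabs (W x y - W u v) < 1) /\
     d <= / (1 + Rabs (W u v))}).
  { intros u v.
    destruct (Rle_dec 0 u) as [H0|H0]; [destruct (Rle_dec u PI) as [H1|H1]|].
    2, 3: exists (mkposreal 1 Rlt_0_1); lra.
    (* Decidability of the predicate lets the radius be extracted as data, which the gauge has to
       be. *)
    destruct (locally_2d_ex_dec (fun x y => Rabs (W x y - W u v) < 1) u v) as [d Hd].
    - intros x y; destruct (Rlt_dec (Rabs (W x y - W u v)) 1); auto.
    - exact (HW u v (conj H0 H1) (mkposreal 1 Rlt_0_1)).
    - assert (P : 0 < / (1 + Rabs (W u v))).
      { apply Rinv_0_lt_compat; generalize (Rabs_pos (W u v)); lra. }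
      exists (mkposreal _ (Rmin_glb_lt _ _ _ (cond_pos d) P)); simpl; intros _; split.
      + intros x y Hx Hy; apply Hd; eapply Rlt_le_trans; eauto; apply Rmin_l.
      + apply Rmin_r. }
  destruct (compactness_value_2d 0 PI 0 (2 * PI) (fun u v => proj1_sig (D u v))) as [d Hd].
  exists (1 + / d); split.
  { generalize (Rinv_0_lt_compat _ (cond_pos d)); lra. }
  intros x y Hx Hy.
  (* Compactness yields a doubly negated existence, which suffices for a decidable inequality. *)
  destruct (Rle_dec (Rabs (W x y)) (1 + / d)) as [|Hn]; auto; exfalso.
  apply (Hd x y Hx Hy); intros [u [v [Hu [Hv [Hxu [Hyv Hdu]]]]]].
  destruct (D u v) as [d' Hd']; simpl in *.
  destruct (Hd' Hu) as [K1 K2]; specialize (K1 x y Hxu Hyv).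
  apply Hn.
  assert (A : Rabs (W u v) <= / d).
  { assert (P : 0 < 1 + Rabs (W u v)) by (generalize (Rabs_pos (W u v)); lra).
    assert (1 + Rabs (W u v) <= / d); [|lra].
    rewrite <- (Rinv_inv (1 + Rabs (W u v))).
    apply Rinv_le_contravar; [apply cond_pos|lra]. }
  replace (W x y) with ((W x y - W u v) + W u v) by ring.
  generalize (Rabs_triang (W x y - W u v) (W u v)); lra.
Qed.

Lemma cont_polar_RInt_continuous W a b v : cont_polar W -> 0 <= a -> a <= b -> b <= PI ->
  continuous (fun v => RInt (fun u => W u v) a b) v.
Proof.
  intros HW Ha Hab Hb.
  apply continuity_pt_filterlim; intros eps Heps.
  (* The interval has length at most PI <= 4, so eps / 8 leaves a factor 2 to spare. *)
  assert (Pb : 0 < eps / 8) by lra.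
  destruct (uniform_continuity_2d W 0 PI (v - 1) (v + 1)) with (eps := mkposreal _ Pb)
    as [d Hd]; [intros; now apply HW|].
  simpl in Hd.
  exists (Rmin d 1); split; [apply Rmin_glb_lt; [apply cond_pos|lra]|].
  intros x [_ Hx]; simpl in *; unfold R_dist in *.
  assert (Hx1 : Rabs (x - v) < 1) by (eapply Rlt_le_trans; [exact Hx|apply Rmin_r]).
  assert (Hxd : Rabs (x - v) < d) by (eapply Rlt_le_trans; [exact Hx|apply Rmin_l]).
  apply Rabs_def2 in Hx1.
  assert (E1 := cont_polar_ex_RInt W a b x HW ltac:(lra) ltac:(lra)).
  assert (E2 := cont_polar_ex_RInt W a b v HW ltac:(lra) ltac:(lra)).
  assert (M : RInt (fun u => W u x) a b - RInt (fun u => W u v) a b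
              = RInt (fun u => W u x - W u v) a b)
    by (symmetry; exact (RInt_minus _ _ a b E1 E2)).
  rewrite M.
  apply Rle_lt_trans with ((b - a) * (eps / 8)).
  - apply abs_RInt_le_const; auto.
    + exact (ex_RInt_minus (V := R_NormedModule) _ _ a b E1 E2).
    + intros t Ht; left; apply Hd; try lra.
      rewrite Rminus_eq_0, Rabs_R0; apply cond_pos.
  - generalize PI_4; nra.
Qed.

Lemma cont_polar_ex_RInt_outer W a b : cont_polar W -> 0 <= a -> a <= b -> b <= PI ->
  ex_RInt (fun v => RInt (fun u => W u v) a b) 0 (2 * PI).
Proof.
  intros HW Ha Hab Hb; apply (ex_RInt_continuous (V := R_CompleteNormedModule)); intros v _.
  now apply cont_polar_RInt_continuous.
Qed.

Lemma polar_integral_ext f g :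
  (forall u v, interior_strip u v -> f u v = g u v) -> polar_integral f = polar_integral g.
Proof.
  intros Hfg; unfold polar_integral; apply RInt_ext; intros v _.
  apply RInt_ext; intros u; generalize PI_RGT_0; intros HP.
  rewrite Rmin_left, Rmax_right by lra; intros Hu; now apply Hfg.
Qed.

Lemma polar_integral_minus f g : cont_polar f -> cont_polar g ->
  polar_integral (fun u v => f u v - g u v) = polar_integral f - polar_integral g.
Proof.
  intros Hf Hg; unfold polar_integral.
  assert (HP := PI_RGT_0).
  rewrite <- (RInt_minus (V := R_CompleteNormedModule) _ _ 0 (2 * PI));
    try (apply cont_polar_ex_RInt_outer; auto; lra).
  apply RInt_ext; intros v _.
  exact (RInt_minus (V := R_CompleteNormedModule) _ _ 0 PI
    (cont_polar_ex_RInt f 0 PI v Hf ltac:(lra) ltac:(lra))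
    (cont_polar_ex_RInt g 0 PI v Hg ltac:(lra) ltac:(lra))).
Qed.

Lemma polar_integral_scal k f : cont_polar f ->
  polar_integral (fun u v => k * f u v) = k * polar_integral f.
Proof.
  intros Hf; unfold polar_integral.
  assert (HP := PI_RGT_0).
  etransitivity.
  2: exact (RInt_scal (V := R_CompleteNormedModule) (fun v => RInt (fun u => f u v) 0 PI) 0
             (2 * PI) k (cont_polar_ex_RInt_outer f 0 PI Hf ltac:(lra) ltac:(lra) ltac:(lra))).
  apply RInt_ext; intros v _.
  exact (RInt_scal (V := R_CompleteNormedModule) _ 0 PI k
    (cont_polar_ex_RInt f 0 PI v Hf ltac:(lra) ltac:(lra))).
Qed.

Lemma polar_integral_le f g : cont_polar f -> cont_polar g ->
  (forall u v, interior_strip u v -> f u v <= g u v) ->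
  polar_integral f <= polar_integral g.
Proof.
  intros Hf Hg Hfg; unfold polar_integral.
  assert (HP := PI_RGT_0).
  apply RInt_le; try (apply cont_polar_ex_RInt_outer; auto; lra); [lra|].
  intros v _; apply RInt_le; try (apply cont_polar_ex_RInt; auto; lra); [lra|].
  intros u Hu; now apply Hfg.
Qed.

(** Integrate over d <= theta <= PI - d. The [Q] term vanishes by periodicity, the two boundary
    circles contribute at most d C each because P = sin k, and each omitted cap costs at most d B.
    Integration over phi gives the bound 4 PI (B + C) d, for every small d. *)
Lemma polar_divergence P Q k W :
  Ck 1 interior_strip P -> Ck 1 interior_strip Q -> cont_polar k -> cont_polar W ->
  (forall u v, interior_strip u v -> P u v = sin u * k u v) ->
  (forall u, 0 < u < PI -> Q u (2 * PI) = Q u 0) ->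
  (forall u v, interior_strip u v -> D1 P u v + D2 Q u v = W u v) ->
  polar_integral W = 0.
Proof.
  intros HP HQ Hk HW EP EQ EW.
  assert (Pi3 := PI_gt_3).
  destruct (cont_polar_bounded W HW) as [B [HB BW]].
  destruct (cont_polar_bounded k Hk) as [C [HC BC]].
  assert (Key : forall d, 0 < d < 1 -> Rabs (polar_integral W) <= d * (4 * PI * (B + C))).
  { intros d Hd.
    assert (CP1 : forall u v, d <= u <= PI - d -> continuous (fun t => D1 P t v) u).
    { intros u v Hu; apply (continuity_2d_fst_section (D1 P)).
      apply (Ck_cont 0 interior_strip); [now apply Ck_D1|unfold interior_strip; lra]. }
    assert (CQ2 : forall u v, d <= u <= PI - d -> continuous (fun t => D2 Q t v) u).
    { intros u v Hu; apply (continuity_2d_fst_section (D2 Q)).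
      apply (Ck_cont 0 interior_strip); [now apply Ck_D2|unfold interior_strip; lra]. }
    assert (Md : Rmin d (PI - d) = d /\ Rmax d (PI - d) = PI - d).
    { split; [apply Rmin_left|apply Rmax_right]; lra. }
    destruct Md as [Md1 Md2].
    assert (IQ : forall v, ex_RInt (fun u => D2 Q u v) d (PI - d)).
    { intros v; apply (ex_RInt_continuous (V := R_CompleteNormedModule)).
      intros u; rewrite Md1, Md2; auto. }
    assert (HA : forall v, RInt (fun u => W u v) d (PI - d)
        = (P (PI - d) v - P d v) + RInt (fun u => D2 Q u v) d (PI - d)).
    { intros v.
      assert (IP : is_RInt (fun u => D1 P u v) d (PI - d) (P (PI - d) v - P d v)).
      { apply (is_RInt_derive (V := R_CompleteNormedModule) (fun u => P u v)).
        - intros u; rewrite Md1, Md2; intros Hu.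
          apply (Ck_is_D1 0 interior_strip P u v HP); unfold interior_strip; lra.
        - intros u; rewrite Md1, Md2; auto. }
      apply is_RInt_unique.
      apply (is_RInt_ext (fun u => plus (D1 P u v) (D2 Q u v))).
      - intros u; rewrite Md1, Md2; intros Hu; apply EW; unfold interior_strip; lra.
      - apply (is_RInt_plus (V := R_NormedModule)); auto.
        apply (RInt_correct (V := R_CompleteNormedModule)); auto. }
    (* Differentiating [J] under the integral sign replaces an exchange of the order of
       integration. *)
    set (J := fun v => RInt (fun u => Q u v) d (PI - d)).
    assert (DJ : forall v, is_derive J v (RInt (fun u => D2 Q u v) d (PI - d))).
    { intros v; apply (is_derive_RInt_param (fun v u => Q u v) d (PI - d) v);
        rewrite ?Md1, ?Md2.
      - exists (mkposreal 1 Rlt_0_1); intros w _ u Hu; eexists.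
        apply (Ck_is_D2 0 interior_strip Q u w HQ); unfold interior_strip; lra.
      - intros u Hu.
        apply (continuity_2d_comp (D2 Q) (fun _ y => y) (fun x _ => x)).
        + apply (Ck_cont 0 interior_strip); [now apply Ck_D2|unfold interior_strip; lra].
        + apply continuity_2d_pt_id2.
        + apply continuity_2d_pt_id1.
      - exists (mkposreal 1 Rlt_0_1); intros w _.
        apply (ex_RInt_continuous (V := R_CompleteNormedModule)).
        intros u; rewrite Md1, Md2; intros Hu.
        apply (continuity_2d_fst_section Q).
        apply (Ck_cont 1 interior_strip); auto; unfold interior_strip; lra. }
    set (A := fun v => RInt (fun u => W u v) d (PI - d)).
    assert (CA : forall v, continuous A v).
    { intros v; apply cont_polar_RInt_continuous; auto; lra. }
    assert (CP : forall u v, 0 < u < PI -> continuous (fun t => P u t) v).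
    { intros u v Hu; apply (continuity_2d_snd_section P).
      apply (Ck_cont 1 interior_strip); auto. }
    set (E := fun v => P (PI - d) v - P d v).
    assert (CE : forall v, continuous E v).
    { intros v; apply (continuous_minus (V := R_NormedModule)); apply CP; lra. }
    assert (CDJ : forall v, continuous (fun v => RInt (fun u => D2 Q u v) d (PI - d)) v).
    { intros v; apply (continuous_ext (fun v => A v - E v)).
      - intros w; unfold A, E; rewrite HA; apply Rplus_minus_l.
      - apply (continuous_minus (V := R_NormedModule)); auto. }
    assert (IJ : is_RInt (fun v => RInt (fun u => D2 Q u v) d (PI - d)) 0 (2 * PI) 0).
    { replace 0 with (J (2 * PI) - J 0) at 2.
      - apply (is_RInt_derive (V := R_CompleteNormedModule) J); auto.
      - apply Rminus_diag_eq, RInt_ext; intros u; rewrite Md1, Md2; intros Hu.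
        apply EQ; lra. }
    assert (IE : ex_RInt E 0 (2 * PI))
        by (apply (ex_RInt_continuous (V := R_CompleteNormedModule)); auto).
    assert (SA : RInt A 0 (2 * PI) = RInt E 0 (2 * PI)).
    { apply is_RInt_unique.
      apply (is_RInt_ext (fun v => plus (E v) (RInt (fun u => D2 Q u v) d (PI - d)))).
      - intros v _; unfold A; now rewrite HA.
      - rewrite <- (Rplus_0_r (RInt E 0 (2 * PI))).
        apply (is_RInt_plus (V := R_NormedModule)); auto.
        apply (RInt_correct (V := R_CompleteNormedModule)); auto. }
    assert (BE : Rabs (RInt E 0 (2 * PI)) <= (2 * PI - 0) * (2 * (d * C))).
    { apply abs_RInt_le_const; auto; [lra|].
      intros v Hv; unfold E.
      assert (Sd : sin d <= d) by (left; apply sin_lt_x; lra).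
      assert (S0 : 0 < sin d) by (apply sin_gt_0; lra).
      rewrite !EP by (unfold interior_strip; lra); rewrite sin_PI_x.
      replace (sin d * k (PI - d) v - sin d * k d v)
        with (sin d * k (PI - d) v + sin d * - k d v) by ring.
      eapply Rle_trans; [apply Rabs_triang|].
      rewrite !Rabs_mult, Rabs_Ropp, (Rabs_pos_eq (sin d)) by lra.
      assert (K1 := BC (PI - d) v ltac:(lra) Hv); assert (K2 := BC d v ltac:(lra) Hv).
      assert (K3 := Rabs_pos (k (PI - d) v)); assert (K4 := Rabs_pos (k d v)).
      nra. }
    assert (BD : Rabs (polar_integral W - RInt A 0 (2 * PI)) <= (2 * PI - 0) * (2 * (d * B))).
    { unfold polar_integral.
      assert (IO := cont_polar_ex_RInt_outer W 0 PI HW ltac:(lra) ltac:(lra) ltac:(lra)).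
      assert (IA : ex_RInt A 0 (2 * PI))
        by (apply (ex_RInt_continuous (V := R_CompleteNormedModule)); auto).
      assert (EM : RInt (fun v => RInt (fun u => W u v) 0 PI) 0 (2 * PI) - RInt A 0 (2 * PI)
        = RInt (fun v => RInt (fun u => W u v) 0 PI - A v) 0 (2 * PI))
        by (symmetry; exact (RInt_minus (V := R_CompleteNormedModule) _ _ _ _ IO IA)).
      rewrite EM.
      apply abs_RInt_le_const; [lra| |].
      - exact (ex_RInt_minus (V := R_NormedModule) _ _ _ _ IO IA).
      - intros v Hv; unfold A.
        assert (I1 := cont_polar_ex_RInt W 0 d v HW ltac:(lra) ltac:(lra)).
        assert (I2 := cont_polar_ex_RInt W d (PI - d) v HW ltac:(lra) ltac:(lra)).
        assert (I3 := cont_polar_ex_RInt W (PI - d) PI v HW ltac:(lra) ltac:(lra)).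
        assert (C1 := RInt_Chasles (V := R_CompleteNormedModule) (fun u => W u v) 0 d (PI - d)
                        I1 I2).
        assert (C2 := RInt_Chasles (V := R_CompleteNormedModule) (fun u => W u v) 0 (PI - d) PI
                        (ex_RInt_Chasles _ _ _ _ I1 I2) I3).
        unfold plus in C1, C2; simpl in C1, C2.
        rewrite <- C2, <- C1.
        match goal with |- Rabs (?x + ?y + ?z - ?y) <= _ =>
          replace (x + y + z - y) with (x + z) by ring end.
        eapply Rle_trans; [apply Rabs_triang|].
        assert (L1 := abs_RInt_le_const (fun u => W u v) 0 d B ltac:(lra) I1
                        ltac:(intros; apply BW; lra)).
        assert (L2 := abs_RInt_le_const (fun u => W u v) (PI - d) PI B ltac:(lra) I3
                        ltac:(intros; apply BW; lra)).
        lra. }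
    rewrite SA in BD.
    replace (polar_integral W)
      with ((polar_integral W - RInt E 0 (2 * PI)) + RInt E 0 (2 * PI)) by ring.
    eapply Rle_trans; [apply Rabs_triang|]; lra. }
  apply Rabs_eq_0.
  apply Rle_antisym; [|apply Rabs_pos].
  set (m := 4 * PI * (B + C)) in Key.
  assert (Hm : 0 <= m) by (unfold m; apply Rmult_le_pos; lra).
  apply Rnot_lt_le; intros Hpos.
  set (x := Rabs (polar_integral W)) in *.
  (* For this d the bound x <= d m reads x <= x m / (2 (m + x)), whose right side is less than x. *)
  assert (Hd : 0 < x / (2 * (m + x)) < 1).
  { split; [apply Rdiv_lt_0_compat; lra|].
    apply Rmult_lt_reg_r with (2 * (m + x)); [lra|].
    unfold Rdiv; rewrite Rmult_assoc, Rinv_l; lra. }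
  specialize (Key _ Hd).
  assert (x / (2 * (m + x)) * m < x); [|lra].
  apply Rmult_lt_reg_r with (2 * (m + x)); [lra|].
  replace (x / (2 * (m + x)) * m * (2 * (m + x))) with (x * m) by (field; lra).
  nra.
Qed.

(** * Division by sin at the poles *)

(** f / sin, extended to the poles by the value of l'Hopital's rule. *)
Definition sin_quotient (f : R -> R -> R) (u v : R) : R :=
  if Req_EM_T (sin u) 0 then D1 f u v / cos u else f u v / sin u.

Lemma sin_quotient_interior f u v : 0 < u < PI -> f u v = sin u * sin_quotient f u v.
Proof.
  intros Hu; unfold sin_quotient; assert (0 < sin u) by (apply sin_gt_0; lra).
  destruct (Req_EM_T (sin u) 0); [lra|field; lra].
Qed.

(* At a pole the quotient is a value of f_theta / cos at an intermediate point,
   by Cauchy's mean value theorem. *)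
Lemma cont_polar_sin_quotient f : Ck 1 wide_strip f ->
  (forall v, f 0 v = 0) -> (forall v, f PI v = 0) -> cont_polar (sin_quotient f).
Proof.
  intros Hf F0 FP u0 v0 Hu0.
  assert (Pi3 := PI_gt_3).
  assert (HO := open2_wide_strip).
  assert (Hw : wide_strip u0 v0) by (unfold wide_strip; lra).
  assert (Csin : continuity_2d_pt (fun u _ => sin u) u0 v0).
  { apply continuity_pt_2d_fst, continuity_sin. }
  destruct (Req_dec (sin u0) 0) as [Hs|Hs].
  2:{ apply continuity_2d_pt_ext_loc with (fun u v => f u v / sin u).
      - destruct (continuity_2d_pt_neq_0 (fun u _ => sin u) u0 v0 Csin Hs) as [d Hd].
        exists d; intros u v Hu Hv; unfold sin_quotient.
        destruct (Req_EM_T (sin u) 0) as [E|]; auto.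
        exfalso; now apply (Hd u v Hu Hv).
      - apply continuity_2d_pt_mult; [now apply (Ck_cont 1 wide_strip)|].
        now apply continuity_2d_pt_inv. }
  assert (Pole : u0 = 0 \/ u0 = PI).
  { destruct (Req_dec u0 0); auto; destruct (Req_dec u0 PI); auto.
    assert (0 < sin u0) by (apply sin_gt_0; lra); lra. }
  assert (FU : forall v, f u0 v = 0) by (destruct Pole as [-> | ->]; auto).
  assert (NZ : forall u, Rabs (u - u0) < 1 -> u <> u0 -> sin u <> 0).
  { intros u Hu Hne; apply Rabs_def2 in Hu.
    destruct Pole as [E|E]; rewrite E in *.
    - destruct (Rlt_or_le u 0).
      + assert (0 < sin (- u)) by (apply sin_gt_0; lra).
        rewrite sin_neg in *; lra.
      + assert (0 < sin u) by (apply sin_gt_0; lra); lra.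
    - destruct (Rlt_or_le u PI).
      + assert (0 < sin u) by (apply sin_gt_0; lra); lra.
      + assert (sin u < 0) by (apply sin_lt_0; lra); lra. }
  assert (CZ : forall u, Rabs (u - u0) < 1 -> cos u <> 0).
  { intros u Hu; apply Rabs_def2 in Hu.
    destruct Pole as [E|E]; rewrite E in *.
    - assert (0 < cos u) by (apply cos_gt_0; lra); lra.
    - assert (cos u < 0) by (apply cos_lt_0; lra); lra. }
  assert (Loc : forall u v, Rabs (u - u0) < 1 ->
            exists x, Rabs (x - u0) <= Rabs (u - u0) /\
                      sin_quotient f u v = D1 f x v / cos x).
  { intros u v Hu; destruct (Req_dec u u0) as [-> |Hne].
    { exists u0; split; [lra|]; unfold sin_quotient.
      destruct (Req_EM_T (sin u0) 0); [auto|lra]. }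
    assert (Hin : forall t, Rmin u0 u <= t <= Rmax u0 u ->
              Rabs (t - u0) <= Rabs (u - u0) /\ wide_strip t v).
    { intros t Ht.
      assert (A : Rabs (t - u0) <= Rabs (u - u0)).
      { revert Ht; unfold Rmin, Rmax, Rabs; destruct (Rle_dec u0 u);
          destruct (Rcase_abs (t - u0)); destruct (Rcase_abs (u - u0)); lra. }
      split; auto; unfold wide_strip.
      assert (B : Rabs (t - u0) < 1) by lra; apply Rabs_def2 in B; lra. }
    (* This auxiliary function vanishes at both ends, since f and sin vanish at the pole [u0]; a
       zero of its derivative gives f(u) / sin u = f_theta(x) / cos x. *)
    destruct (MVT_gen (fun t => f t v * sin u - f u v * sin t) u0 u
                      (fun t => D1 f t v * sin u - f u v * cos t)) as [x [Hx Ex]].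
    - intros t Ht.
      destruct (Hin t) as [_ Ht']; [lra|].
      apply (is_derive_minus (V := R_NormedModule)).
      + evar_last; [apply is_derive_Rmult;
          [exact (Ck_is_D1 0 _ f t v Hf Ht')|apply is_derive_Rconst]|simpl; ring].
      + evar_last; [apply is_derive_Rmult;
          [apply is_derive_Rconst|apply is_derive_sin]|simpl; ring].
    - intros t Ht.
      destruct (Hin t Ht) as [_ Ht'].
      apply (is_derive_continuity_pt _ t (D1 f t v * sin u - f u v * cos t)).
      apply (is_derive_minus (V := R_NormedModule)).
      + evar_last; [apply is_derive_Rmult;
          [exact (Ck_is_D1 0 _ f t v Hf Ht')|apply is_derive_Rconst]|simpl; ring].
      + evar_last; [apply is_derive_Rmult;
          [apply is_derive_Rconst|apply is_derive_sin]|simpl; ring].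
    - exists x; split; [apply Hin, Hx|].
      destruct (Hin x Hx) as [Hxu _].
      rewrite Hs, FU in Ex.
      assert (E0 : D1 f x v * sin u - f u v * cos x = 0).
      { apply Rmult_eq_reg_r with (u - u0); [|lra]. lra. }
      assert (S := NZ u Hu Hne); assert (C := CZ x ltac:(lra)).
      unfold sin_quotient; destruct (Req_EM_T (sin u) 0); [easy|].
      apply Rmult_eq_reg_r with (sin u * cos x).
      + replace (f u v / sin u * (sin u * cos x)) with (f u v * cos x) by (field; auto).
        replace (D1 f x v / cos x * (sin u * cos x)) with (D1 f x v * sin u) by (field; auto).
        lra.
      + now apply Rmult_integral_contrapositive_currified. }
  assert (CD : continuity_2d_pt (fun u v => D1 f u v / cos u) u0 v0).
  { apply continuity_2d_pt_mult.
    - apply (Ck_cont 0 wide_strip); auto; now apply Ck_D1.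
    - apply continuity_2d_pt_inv.
      + apply continuity_pt_2d_fst, continuity_cos.
      + apply CZ; rewrite Rminus_eq_0, Rabs_R0; lra. }
  intros eps; destruct (CD eps) as [d Hd].
  exists (mkposreal _ (Rmin_glb_lt _ _ _ (cond_pos d) Rlt_0_1)); simpl.
  intros u v Hu Hv.
  assert (Hu1 : Rabs (u - u0) < 1) by (eapply Rlt_le_trans; [exact Hu|apply Rmin_r]).
  assert (Hud : Rabs (u - u0) < d) by (eapply Rlt_le_trans; [exact Hu|apply Rmin_l]).
  assert (Hvd : Rabs (v - v0) < d) by (eapply Rlt_le_trans; [exact Hv|apply Rmin_l]).
  destruct (Loc u v Hu1) as [x [Hx ->]].
  replace (sin_quotient f u0 v0) with (D1 f u0 v0 / cos u0).
  - apply Hd; auto; lra.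
  - unfold sin_quotient; destruct (Req_EM_T (sin u0) 0); [auto|lra].
Qed.

(** * Herglotz' integral formula *)

(** Here s = sin gam: the zero of s at the poles is split off, and the remaining data stay
    continuous and positive up to the poles. *)
Record polar_metric (e gam : R -> R) : Prop := {
  pm_e_pos : forall u, 0 <= u <= PI -> 0 < e u;
  pm_g_pos : forall u, 0 <= u <= PI -> 0 < gam u;
  pm_e_cont : forall u, 0 <= u <= PI -> continuity_pt e u;
  pm_g_cont : forall u, 0 <= u <= PI -> continuity_pt gam u;
  pm_e_smooth : Ck1 1 (fun u => 0 < u < PI) e;
  pm_g_smooth : Ck1 1 (fun u => 0 < u < PI) gam
}.

Lemma polar_rotational_metric e gam : polar_metric e gam ->
  rotational_metric e (fun u => sin u * gam u).
Proof.
  intros M; split.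
  - intros u Hu; apply (pm_e_pos e gam M); lra.
  - intros u Hu; apply Rmult_lt_0_compat; [apply sin_gt_0; lra|].
    apply (pm_g_pos e gam M); lra.
  - apply (pm_e_smooth e gam M).
  - apply Ck_mult; [apply open2_interior_strip| |apply (pm_g_smooth e gam M)].
    apply (Ck_sin 1 _ (fun u _ => u)); [apply open2_interior_strip|apply Ck_fst].
Qed.

(** * Closed surfaces in polar coordinates *)

Definition periodic (Y : patch) : Prop := forall u v, Y u (v + 2 * PI) = Y u v.

Definition constant_at_poles (Y : patch) : Prop :=
  forall v, Y 0 v = Y 0 0 /\ Y PI v = Y PI 0.

Lemma Derive_shift (f : R -> R) p x : (forall t, f (t + p) = f t) ->
  Derive f (x + p) = Derive f x.
Proof.
  intros Hf; unfold Derive; f_equal; apply Lim_ext; intros h.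
  replace (x + p + h) with (x + h + p) by ring; now rewrite !Hf.
Qed.

Lemma periodic_d1 Y : periodic Y -> periodic (d1 Y).
Proof.
  intros HY u v; unfold d1.
  apply f_equal2; [apply f_equal2|]; apply Derive_ext; intros t; now rewrite HY.
Qed.

Lemma periodic_d2 Y : periodic Y -> periodic (d2 Y).
Proof.
  intros HY u v; unfold d2.
  apply f_equal2; [apply f_equal2|].
  - apply (Derive_shift (fun t => vx (Y u t))); intros t; now rewrite HY.
  - apply (Derive_shift (fun t => vy (Y u t))); intros t; now rewrite HY.
  - apply (Derive_shift (fun t => vz (Y u t))); intros t; now rewrite HY.
Qed.

Lemma d2_at_poles Y : constant_at_poles Y ->
  forall v, d2 Y 0 v = (0, 0, 0) /\ d2 Y PI v = (0, 0, 0).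
Proof.
  intros HY v; split; unfold d2; apply f_equal2; try apply f_equal2.
  - rewrite (Derive_ext _ (fun _ => vx (Y 0 0))); [apply Derive_const|].
    intros t; now rewrite (proj1 (HY t)).
  - rewrite (Derive_ext _ (fun _ => vy (Y 0 0))); [apply Derive_const|].
    intros t; now rewrite (proj1 (HY t)).
  - rewrite (Derive_ext _ (fun _ => vz (Y 0 0))); [apply Derive_const|].
    intros t; now rewrite (proj1 (HY t)).
  - rewrite (Derive_ext _ (fun _ => vx (Y PI 0))); [apply Derive_const|].
    intros t; now rewrite (proj2 (HY t)).
  - rewrite (Derive_ext _ (fun _ => vy (Y PI 0))); [apply Derive_const|].
    intros t; now rewrite (proj2 (HY t)).
  - rewrite (Derive_ext _ (fun _ => vz (Y PI 0))); [apply Derive_const|].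
    intros t; now rewrite (proj2 (HY t)).
Qed.

Record closed_surface (e gam : R -> R) (Y n : patch) : Prop := {
  cs_immersion : immersion e (fun u => sin u * gam u) Y n;
  cs_Y : Ck3 3 wide_strip Y;
  cs_n : Ck3 3 wide_strip n;
  cs_Y_periodic : periodic Y;
  cs_n_periodic : periodic n;
  cs_Y_poles : constant_at_poles Y;
  cs_n_poles : constant_at_poles n
}.

Record convex_surface (Y n : patch) : Prop := {
  cv_det : forall u v, interior_strip u v -> 0 < h11 Y n u v * h22 Y n u v - h12 Y n u v ^ 2;
  cv_h11 : forall u v, interior_strip u v -> 0 <= h11 Y n u v;
  cv_support : forall u v, interior_strip u v ->
    0 <= dot (vsub (Y u v) (Y 0 0)) (n u v)
}.

Definition sin_quotient3 (Y : patch) : patch := fun u v =>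
  (sin_quotient (fun u v => vx (Y u v)) u v, sin_quotient (fun u v => vy (Y u v)) u v,
   sin_quotient (fun u v => vz (Y u v)) u v).

Lemma dot_sin_quotient3 Y u v w : 0 < u < PI ->
  dot (Y u v) w = sin u * dot (sin_quotient3 Y u v) w.
Proof.
  intros Hu; unfold dot at 1.
  rewrite (sin_quotient_interior (fun u v => vx (Y u v)) u v Hu),
    (sin_quotient_interior (fun u v => vy (Y u v)) u v Hu),
    (sin_quotient_interior (fun u v => vz (Y u v)) u v Hu).
  unfold dot, sin_quotient3, vx, vy, vz; simpl; ring.
Qed.

(** h12 / sin and h22 / sin^2. The phi-derivatives of the position and of the normal vanish at the
    poles, so each contributes one factor sin to <n_2, Y_j>, with a quotient continuous up to the
    poles. *)
Definition k12 (Y n : patch) (u v : R) : R := dot (sin_quotient3 (d2 n) u v) (d1 Y u v).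
Definition k22 (Y n : patch) (u v : R) : R :=
  dot (sin_quotient3 (d2 n) u v) (sin_quotient3 (d2 Y) u v).

Lemma cont_polar_sin_quotient3 Y : Ck3 2 wide_strip Y -> constant_at_poles Y ->
  cont_polar (fun u v => vx (sin_quotient3 (d2 Y) u v)) /\
  cont_polar (fun u v => vy (sin_quotient3 (d2 Y) u v)) /\
  cont_polar (fun u v => vz (sin_quotient3 (d2 Y) u v)).
Proof.
  intros HY HP; destruct (Ck3_d2 1 _ _ HY) as [A [B C]].
  split; [|split].
  - apply (cont_polar_sin_quotient (fun u v => vx (d2 Y u v)) A);
      intros v; destruct (d2_at_poles Y HP v) as [E1 E2]; [now rewrite E1|now rewrite E2].
  - apply (cont_polar_sin_quotient (fun u v => vy (d2 Y u v)) B);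
      intros v; destruct (d2_at_poles Y HP v) as [E1 E2]; [now rewrite E1|now rewrite E2].
  - apply (cont_polar_sin_quotient (fun u v => vz (d2 Y u v)) C);
      intros v; destruct (d2_at_poles Y HP v) as [E1 E2]; [now rewrite E1|now rewrite E2].
Qed.

Lemma cont_polar_Ck3 n Y : Ck3 n wide_strip Y ->
  cont_polar (fun u v => vx (Y u v)) /\ cont_polar (fun u v => vy (Y u v)) /\
  cont_polar (fun u v => vz (Y u v)).
Proof.
  intros [A [B C]]; split; [|split].
  - exact (cont_polar_Ck n _ A).
  - exact (cont_polar_Ck n _ B).
  - exact (cont_polar_Ck n _ C).
Qed.

Lemma polar_second_form_cont e gam Y n : closed_surface e gam Y n ->
  cont_polar (h11 Y n) /\ cont_polar (k12 Y n) /\ cont_polar (k22 Y n).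
Proof.
  intros S.
  assert (HY := cs_Y _ _ _ _ S); assert (Hn := cs_n _ _ _ _ S).
  destruct (cont_polar_Ck3 2 _ (Ck3_d1 2 _ _ HY)) as [X1 [X2 X3]].
  destruct (cont_polar_sin_quotient3 Y (Ck3_le 2 3 _ _ ltac:(lia) HY) (cs_Y_poles _ _ _ _ S))
    as [A1 [A2 A3]].
  destruct (cont_polar_sin_quotient3 n (Ck3_le 2 3 _ _ ltac:(lia) Hn) (cs_n_poles _ _ _ _ S))
    as [B1 [B2 B3]].
  split; [|split].
  - apply (cont_polar_Ck 1), Ck_opp; [apply open2_wide_strip|].
    apply Ck_dot; [apply open2_wide_strip|now apply Ck3_d1, Ck3_d1|].
    apply (Ck3_le 1 3); [lia|auto].
  - apply (cont_polar_dot (sin_quotient3 (d2 n)) (d1 Y)); auto.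
  - apply (cont_polar_dot (sin_quotient3 (d2 n)) (sin_quotient3 (d2 Y))); auto.
Qed.

Lemma polar_second_form_interior e gam Y n : closed_surface e gam Y n ->
  forall u v, interior_strip u v ->
  h12 Y n u v = sin u * k12 Y n u v /\ h22 Y n u v = sin u ^ 2 * k22 Y n u v.
Proof.
  intros S u v Huv.
  destruct (immersion_normal_derivatives _ _ _ _ (cs_immersion _ _ _ _ S) u v Huv)
    as [_ [_ [_ [_ [-> ->]]]]].
  split; rewrite (dot_sin_quotient3 (d2 n)) by auto; auto.
  rewrite dot_comm, (dot_sin_quotient3 (d2 Y)), dot_comm by auto; unfold k22; ring.
Qed.

(* The integrand [(h11 / e^2 + h22 / s^2) e s] with [s = sin * gam], written so
   that it makes sense at the poles. *)
Definition mean_density (e gam : R -> R) (Y n : patch) (u v : R) : R :=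
  sin u * (gam u / e u * h11 Y n u v + e u / gam u * k22 Y n u v).

Definition polar_mixed_det (Y n Y' n' : patch) (u v : R) : R :=
  k22 Y n u v * h11 Y' n' u v + h11 Y n u v * k22 Y' n' u v
  - 2 * k12 Y n u v * k12 Y' n' u v.

Definition mixed_density (e gam : R -> R) (Y n Y' n' : patch) (u v : R) : R :=
  sin u * (dot (vsub (Y' u v) (Y' 0 0)) (n' u v) * polar_mixed_det Y n Y' n' u v
           / (e u * gam u)).

Lemma cont_polar_sin : cont_polar (fun u _ => sin u).
Proof. apply cont_polar_fst; intros; apply continuity_sin. Qed.

Lemma cont_polar_metric e gam : polar_metric e gam ->
  cont_polar (fun u _ => e u) /\ cont_polar (fun u _ => gam u) /\
  (forall u v : R, 0 <= u <= PI -> e u <> 0) /\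
  (forall u v : R, 0 <= u <= PI -> gam u <> 0) /\
  cont_polar (fun u _ => e u * gam u) /\
  (forall u v : R, 0 <= u <= PI -> e u * gam u <> 0).
Proof.
  intros M.
  assert (A : cont_polar (fun u _ => e u)) by apply cont_polar_fst, (pm_e_cont _ _ M).
  assert (B : cont_polar (fun u _ => gam u)) by apply cont_polar_fst, (pm_g_cont _ _ M).
  assert (C : forall u v : R, 0 <= u <= PI -> e u <> 0).
  { intros u _ Hu; apply Rgt_not_eq, (pm_e_pos _ _ M u Hu). }
  assert (D : forall u v : R, 0 <= u <= PI -> gam u <> 0).
  { intros u _ Hu; apply Rgt_not_eq, (pm_g_pos _ _ M u Hu). }
  refine (conj A (conj B (conj C (conj D (conj _ _))))).
  - now apply (cont_polar_mult (fun u _ => e u) (fun u _ => gam u)).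
  - intros u v Hu; apply Rmult_integral_contrapositive_currified; eauto.
Qed.

Lemma mean_density_cont e gam Y n : polar_metric e gam -> closed_surface e gam Y n ->
  cont_polar (mean_density e gam Y n).
Proof.
  intros M S.
  destruct (cont_polar_metric e gam M) as [A [B [C [D _]]]].
  destruct (polar_second_form_cont e gam Y n S) as [E [F G]].
  apply (cont_polar_mult (fun u _ => sin u)); [apply cont_polar_sin|].
  apply cont_polar_plus; apply cont_polar_mult; auto.
  - apply (cont_polar_div (fun u _ => gam u) (fun u _ => e u)); auto.
  - apply (cont_polar_div (fun u _ => e u) (fun u _ => gam u)); auto.
Qed.

Lemma mixed_density_cont e gam Y n Y' n' : polar_metric e gam ->
  closed_surface e gam Y n -> closed_surface e gam Y' n' ->
  cont_polar (mixed_density e gam Y n Y' n').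
Proof.
  intros M S S'.
  destruct (cont_polar_metric e gam M) as [_ [_ [_ [_ [A B]]]]].
  destruct (polar_second_form_cont e gam Y n S) as [E [F G]].
  destruct (polar_second_form_cont e gam Y' n' S') as [E' [F' G']].
  apply (cont_polar_mult (fun u _ => sin u)); [apply cont_polar_sin|].
  apply (cont_polar_div _ (fun u _ => e u * gam u)); auto.
  apply cont_polar_mult.
  - apply (cont_polar_Ck 3), Ck_dot; [apply open2_wide_strip| |apply (cs_n _ _ _ _ S')].
    apply Ck3_vsub; [apply open2_wide_strip|apply (cs_Y _ _ _ _ S')].
  - unfold polar_mixed_det; apply cont_polar_minus; [apply cont_polar_plus|];
      repeat apply cont_polar_mult; auto; apply cont_polar_const.
Qed.

(** The two densities differ by the divergence of the flux field. Its theta-component carries a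
    factor sin and its phi-component is periodic, so its integral is 0. *)
Lemma herglotz e gam Y n Y' n' : polar_metric e gam ->
  closed_surface e gam Y n -> closed_surface e gam Y' n' ->
  polar_integral (mean_density e gam Y n) =
  polar_integral (mixed_density e gam Y n Y' n').
Proof.
  intros M S S'.
  (* A pole of the second surface serves as origin; by [cv_support] its support function is then
     nonnegative. *)
  set (c := Y' 0 0).
  assert (RM := polar_rotational_metric e gam M).
  assert (I1 := cs_immersion _ _ _ _ S); assert (I2 := cs_immersion _ _ _ _ S').
  assert (CM := mean_density_cont e gam Y n M S).
  assert (CX := mixed_density_cont e gam Y n Y' n' M S S').
  set (s := fun u => sin u * gam u) in *.
  apply Rminus_diag_uniq; rewrite <- polar_integral_minus; auto.
  destruct (flux_smooth e s Y n Y' n' c RM I1 I2) as [F1 F2].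
  (* The flux divided by sin: its numerator contains sin^2 in both terms, its denominator e s only
     one sin. *)
  set (k := fun u v =>
    (k22 Y n u v * dot (vsub (Y' u v) c) (d1 Y' u v)
     - k12 Y n u v * dot (vsub (Y' u v) c) (sin_quotient3 (d2 Y') u v)) / (e u * gam u)).
  apply (polar_divergence (flux1 e s Y n Y' c) (flux2 e s Y n Y' c) k _ F1 F2).
  - destruct (cont_polar_metric e gam M) as [_ [_ [_ [_ [A B]]]]].
    destruct (polar_second_form_cont e gam Y n S) as [E [F G]].
    destruct (cont_polar_Ck3 3 _ (Ck3_vsub 3 _ _ c open2_wide_strip (cs_Y _ _ _ _ S')))
      as [T1 [T2 T3]].
    destruct (cont_polar_Ck3 2 _ (Ck3_d1 2 _ _ (cs_Y _ _ _ _ S'))) as [X1 [X2 X3]].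
    destruct (cont_polar_sin_quotient3 Y' (Ck3_le 2 3 _ _ ltac:(lia) (cs_Y _ _ _ _ S'))
                (cs_Y_poles _ _ _ _ S')) as [A1 [A2 A3]].
    apply (cont_polar_div _ (fun u _ => e u * gam u)); auto.
    apply cont_polar_minus; apply cont_polar_mult; auto.
    + apply (cont_polar_dot (fun u v => vsub (Y' u v) c) (d1 Y')); auto.
    + apply (cont_polar_dot (fun u v => vsub (Y' u v) c) (sin_quotient3 (d2 Y'))); auto.
  - now apply cont_polar_minus.
  - intros u v Huv; unfold flux1, k.
    destruct (polar_second_form_interior e gam Y n S u v Huv) as [-> ->].
    rewrite (dot_comm _ (d2 Y' u v)), (dot_sin_quotient3 (d2 Y')) by auto.
    rewrite (dot_comm (sin_quotient3 (d2 Y') u v)).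
    assert (Hs : 0 < sin u) by (apply sin_gt_0; apply Huv).
    assert (Pe := pm_e_pos e gam M u ltac:(unfold interior_strip in Huv; lra)).
    assert (Pg := pm_g_pos e gam M u ltac:(unfold interior_strip in Huv; lra)).
    unfold s; field; lra.
  - intros u Hu; unfold flux2.
    assert (PY := cs_Y_periodic _ _ _ _ S); assert (Pn := cs_n_periodic _ _ _ _ S).
    assert (PZ := cs_Y_periodic _ _ _ _ S').
    assert (K : forall Q, periodic Q -> Q u (2 * PI) = Q u 0).
    { intros Q HQ; rewrite <- (HQ u 0); f_equal; ring. }
    unfold h11, h12.
    rewrite (K Y' PZ), (K n Pn), (K (d1 Y')), (K (d2 Y')), (K (d1 (d1 Y))), (K (d1 (d2 Y)));
      auto using periodic_d1, periodic_d2.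
  - intros u v Huv; rewrite (flux_divergence e s Y n Y' n' c RM I1 I2 u v Huv).
    unfold mixed_det, mean_density, mixed_density, polar_mixed_det; fold c.
    destruct (polar_second_form_interior e gam Y n S u v Huv) as [-> ->].
    destruct (polar_second_form_interior e gam Y' n' S' u v Huv) as [-> ->].
    assert (Hs : 0 < sin u) by (apply sin_gt_0; apply Huv).
    assert (Pe := pm_e_pos e gam M u ltac:(unfold interior_strip in Huv; lra)).
    assert (Pg := pm_g_pos e gam M u ltac:(unfold interior_strip in Huv; lra)).
    unfold s; field; lra.
Qed.

(** * Comparison of total mean curvatures *)

(** The mixed discriminant inequality for positive definite forms of equal determinant: after
    multiplication by [a * a'], the difference of the two sides is
    [d * (a - a') ^ 2 + (a' * b - a * b') ^ 2]. *)
Lemma mixed_det_ge a b c a' b' c' d : 0 < a -> 0 < a' ->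
  a * c - b ^ 2 = d -> a' * c' - b' ^ 2 = d -> 0 < d ->
  2 * d <= c * a' + a * c' - 2 * b * b'.
Proof.
  intros Ha Ha' Hd Hd' Hd0.
  apply Rmult_le_reg_l with (a * a'); [now apply Rmult_lt_0_compat|].
  assert (E : a * a' * (c * a' + a * c' - 2 * b * b') - a * a' * (2 * d)
              = d * (a - a') ^ 2 + (a' * b - a * b') ^ 2).
  { replace (a * a' * (c * a' + a * c' - 2 * b * b'))
      with (a' ^ 2 * (a * c - b ^ 2) + a ^ 2 * (a' * c' - b' ^ 2)
            + (a' * b - a * b') ^ 2) by ring.
    rewrite Hd, Hd'; ring. }
  assert (0 <= d * (a - a') ^ 2) by (apply Rmult_le_pos; [lra|apply pow2_ge_0]).
  generalize (pow2_ge_0 (a' * b - a * b')); lra.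
Qed.

Lemma total_mean_curvature_le e gam Y n Y' n' : polar_metric e gam ->
  closed_surface e gam Y n -> convex_surface Y n ->
  closed_surface e gam Y' n' -> convex_surface Y' n' ->
  polar_integral (mean_density e gam Y' n') <= polar_integral (mean_density e gam Y n).
Proof.
  intros M S V S' V'.
  (* Applying the formula to the second surface paired with itself, and to the first paired with the
     second, brings the same support function into both integrals; they can then be compared
     pointwise. *)
  rewrite (herglotz e gam Y' n' Y' n' M S' S'), (herglotz e gam Y n Y' n' M S S').
  apply polar_integral_le; try now apply mixed_density_cont.
  intros u v Huv; unfold mixed_density.
  assert (RM := polar_rotational_metric e gam M).
  assert (Hs : 0 < sin u) by (apply sin_gt_0; apply Huv).
  assert (Pe := pm_e_pos e gam M u ltac:(unfold interior_strip in Huv; lra)).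
  assert (Pg := pm_g_pos e gam M u ltac:(unfold interior_strip in Huv; lra)).
  assert (Heg : 0 < / (e u * gam u))
    by (apply Rinv_0_lt_compat; now apply Rmult_lt_0_compat).
  assert (Hp := cv_support _ _ V' u v Huv).
  assert (D := theorema_egregium _ _ _ _ RM (cs_immersion _ _ _ _ S) u v Huv).
  assert (D' := theorema_egregium _ _ _ _ RM (cs_immersion _ _ _ _ S') u v Huv).
  assert (P := cv_det _ _ V u v Huv); assert (P' := cv_det _ _ V' u v Huv).
  assert (Q := cv_h11 _ _ V u v Huv); assert (Q' := cv_h11 _ _ V' u v Huv).
  rewrite D in P; rewrite D' in P'.
  destruct (polar_second_form_interior e gam Y n S u v Huv) as [E1 E2].
  destruct (polar_second_form_interior e gam Y' n' S' u v Huv) as [E1' E2'].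
  assert (Q1 : 0 < h11 Y n u v).
  { destruct Q as [Q|Q]; auto; rewrite <- Q in D.
    generalize (pow2_ge_0 (h12 Y n u v)); lra. }
  assert (Q1' : 0 < h11 Y' n' u v).
  { destruct Q' as [Q'|Q']; auto; rewrite <- Q' in D'.
    generalize (pow2_ge_0 (h12 Y' n' u v)); lra. }
  assert (G := mixed_det_ge _ _ _ _ _ _ _ Q1 Q1' D D' P).
  assert (L : polar_mixed_det Y' n' Y' n' u v <= polar_mixed_det Y n Y' n' u v).
  { apply Rmult_le_reg_l with (sin u ^ 2); [now apply pow_lt|].
    unfold polar_mixed_det.
    replace (sin u ^ 2 * (k22 Y' n' u v * h11 Y' n' u v + h11 Y' n' u v * k22 Y' n' u v
                          - 2 * k12 Y' n' u v * k12 Y' n' u v))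
      with (2 * (h11 Y' n' u v * h22 Y' n' u v - h12 Y' n' u v ^ 2))
      by (rewrite E1', E2'; ring).
    replace (sin u ^ 2 * (k22 Y n u v * h11 Y' n' u v + h11 Y n u v * k22 Y' n' u v
                          - 2 * k12 Y n u v * k12 Y' n' u v))
      with (h22 Y n u v * h11 Y' n' u v + h11 Y n u v * h22 Y' n' u v
            - 2 * h12 Y n u v * h12 Y' n' u v) by (rewrite E1, E2, E1', E2'; ring).
    rewrite D'; exact G. }
  unfold Rdiv; apply Rmult_le_compat_l; [lra|].
  apply Rmult_le_compat_r; [lra|].
  now apply Rmult_le_compat_l.
Qed.

Lemma total_mean_curvature_rigid e gam Y n Y' n' : polar_metric e gam ->
  closed_surface e gam Y n -> convex_surface Y n ->
  closed_surface e gam Y' n' -> convex_surface Y' n' ->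
  polar_integral (mean_density e gam Y n) = polar_integral (mean_density e gam Y' n').
Proof. intros; apply Rle_antisym; now apply total_mean_curvature_le. Qed.

(** * Rigidity of the total mean curvature of isometric embeddings *)

Lemma on_sphere_sph_z u v : on_sphere (sph_z u v).
Proof.
  unfold on_sphere, dot, sph_z, vx, vy, vz; simpl.
  generalize (sin2_cos2 u) (sin2_cos2 v); unfold Rsqr; intros A B.
  replace (sin u * cos v * (sin u * cos v) + sin u * sin v * (sin u * sin v)
           + cos u * cos u)
    with (sin u * sin u * (sin v * sin v + cos v * cos v) + cos u * cos u) by ring.
  rewrite B; lra.
Qed.

Lemma on_sphere_sph_x u v : on_sphere (sph_x u v).
Proof.
  generalize (on_sphere_sph_z u v); unfold on_sphere, dot, sph_z, sph_x, vx, vy, vz; simpl.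
  intros <-; ring.
Qed.

Lemma smooth_on_sphere_polar n X : smooth_on_sphere X -> Ck3 n wide_strip (in_chart sph_z X).
Proof.
  intros [Hz Hx]; split; [|split].
  - apply (Ck_polar_chart n (fun p => vx (X p))); intros m; split; intros u v Huv.
    + apply (Hz m u v Huv).
    + apply (Hx m u v Huv).
  - apply (Ck_polar_chart n (fun p => vy (X p))); intros m; split; intros u v Huv.
    + apply (Hz m u v Huv).
    + apply (Hx m u v Huv).
  - apply (Ck_polar_chart n (fun p => vz (X p))); intros m; split; intros u v Huv.
    + apply (Hz m u v Huv).
    + apply (Hx m u v Huv).
Qed.

(** Were [l] positive, f' would be positive just to the right of [x], and f would exceed its
    maximum. *)
Lemma second_derivative_at_max (f f' : R -> R) x l d : 0 < d ->
  (forall t, Rabs (t - x) < d -> is_derive f t (f' t)) ->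
  f' x = 0 -> is_derive f' x l ->
  (forall t, Rabs (t - x) < d -> f t <= f x) -> l <= 0.
Proof.
  intros Hd Df F0 Df' Hmax.
  apply Rnot_lt_le; intros Hl.
  apply is_derive_Reals in Df'.
  destruct (Df' (l / 2) ltac:(lra)) as [eta Heta].
  set (t := x + Rmin eta d / 2).
  assert (Hm : 0 < Rmin eta d) by (apply Rmin_glb_lt; [apply cond_pos|auto]).
  assert (Hm1 := Rmin_l eta d); assert (Hm2 := Rmin_r eta d).
  destruct (MVT_cor2 f f' x t) as [c [Ec Hc]]; [unfold t; lra| |].
  - intros c Hc; apply is_derive_Reals, Df; unfold t in Hc.
    rewrite Rabs_pos_eq; lra.
  - assert (A := Heta (c - x) ltac:(lra) ltac:(unfold t in Hc; rewrite Rabs_pos_eq; lra)).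
    replace (x + (c - x)) with c in A by ring; rewrite F0 in A.
    apply Rabs_def2 in A; destruct A as [_ A].
    assert (B : 0 < f' c).
    { replace (f' c) with ((f' c - 0) / (c - x) * (c - x)) by (field; lra).
      apply Rmult_lt_0_compat; lra. }
    assert (C := Hmax t ltac:(unfold t; rewrite Rabs_pos_eq; lra)).
    assert (0 < f' c * (t - x)) by (apply Rmult_lt_0_compat; lra); lra.
Qed.

Lemma polar_chart_periodic X : periodic (in_chart sph_z X).
Proof.
  intros u v; unfold in_chart, sph_z; f_equal.
  replace (cos (v + 2 * PI)) with (cos v); [replace (sin (v + 2 * PI)) with (sin v); auto|].
  - rewrite sin_plus, sin_2PI, cos_2PI; ring.
  - rewrite cos_plus, sin_2PI, cos_2PI; ring.
Qed.

Lemma polar_chart_poles X : constant_at_poles (in_chart sph_z X).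
Proof.
  intros v; unfold in_chart, sph_z; rewrite sin_0, sin_PI, !Rmult_0_l; auto.
Qed.

Lemma embedding_closed_surface a r gam X N : polar_metric (Sigma a r) gam ->
  (forall u, 0 < u < PI -> H a r u = (sin u * gam u) ^ 2) ->
  isometric_embedding a r X N ->
  closed_surface (Sigma a r) gam (in_chart sph_z X) (in_chart sph_z N).
Proof.
  intros M HG E.
  assert (SX := smooth_on_sphere_polar 3 X (emb_smooth _ _ _ _ E)).
  assert (SN := smooth_on_sphere_polar 3 N (emb_normal_smooth _ _ _ _ E)).
  assert (Sub : forall u v, interior_strip u v -> wide_strip u v)
    by (unfold interior_strip, wide_strip; intros; generalize PI_gt_3; lra).
  split; auto using polar_chart_periodic, polar_chart_poles.
  split.
  - eapply Ck3_sub; eauto.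
  - eapply Ck3_sub; eauto.
  - intros u v Huv; apply (emb_isometric _ _ _ _ E u v Huv).
  - intros u v Huv; apply (emb_isometric _ _ _ _ E u v Huv).
  - intros u v Huv; rewrite <- HG by auto; apply (emb_isometric _ _ _ _ E u v Huv).
  - intros u v Huv; apply (emb_normal_unit _ _ _ _ E), on_sphere_sph_z.
  - intros u v Huv; apply (proj1 (emb_normal _ _ _ _ E) u v Huv).
  - intros u v Huv; apply (proj1 (emb_normal _ _ _ _ E) u v Huv).
Qed.

(** As the surface lies behind its tangent plane at (u, v), the height <Y(t, v), n(u, v)> is maximal
    at t = u, and its second derivative -h11 is at most 0. The same property tested at the pole
    gives the sign of the support function. *)
Lemma embedding_convex_surface a r gam X N : polar_metric (Sigma a r) gam ->
  (forall u, 0 < u < PI -> H a r u = (sin u * gam u) ^ 2) ->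
  isometric_embedding a r X N ->
  convex_surface (in_chart sph_z X) (in_chart sph_z N).
Proof.
  intros M HG E.
  assert (S := embedding_closed_surface a r gam X N M HG E).
  assert (RM := polar_rotational_metric _ _ M).
  split; intros u v Huv.
  - assert (K := proj1 (emb_curvature _ _ _ _ E) u v Huv).
    unfold patch_gauss_curvature, gauss_curvature in K.
    destruct (emb_isometric _ _ _ _ E u v Huv) as [G1 [G2 G3]].
    rewrite G1, G2, G3, HG in K by auto.
    assert (P : 0 < Sigma a r u ^ 2 * (sin u * gam u) ^ 2 - 0 ^ 2).
    { assert (P1 := rm_e_pos _ _ RM u Huv); assert (P2 := rm_s_pos _ _ RM u Huv).
      simpl in P2; assert (A := pow_lt _ 2 P1); assert (B := pow_lt _ 2 P2).
      generalize (Rmult_lt_0_compat _ _ A B); lra. }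
    match type of K with 0 < ?x / ?y =>
      set (z := y) in *; replace x with (x / z * z) by (field; lra) end.
    now apply Rmult_lt_0_compat.
  - set (Y := in_chart sph_z X) in *; set (n := in_chart sph_z N) in *.
    assert (I1 := cs_immersion _ _ _ _ S).
    assert (SY := im_Y _ _ _ _ I1).
    destruct (open2_interior_strip u v Huv) as [d Hd].
    assert (Hd' : forall t, Rabs (t - u) < d -> interior_strip t v).
    { intros t Ht; apply Hd; auto; rewrite Rminus_eq_0, Rabs_R0; apply cond_pos. }
    assert (L : dot (d1 (d1 Y) u v) (n u v) <= 0); [|unfold h11; lra].
    assert (D : forall Z t, Ck3 1 interior_strip Z -> interior_strip t v ->
       is_derive (fun t => dot (Z t v) (n u v)) t (dot (d1 Z t v) (n u v))).
    { intros Z t [A [B C]] Ht.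
      replace (dot (d1 Z t v) (n u v))
        with (dot (d1 Z t v) (n u v) + dot (Z t v) (0, 0, 0))
        by (unfold dot at 2; simpl; unfold vx, vy, vz; simpl; ring).
      apply (is_derive_dot (fun t => Z t v) (fun _ => n u v)); try apply is_derive_Rconst.
      - apply (Ck_is_D1 0 _ _ t v A Ht).
      - apply (Ck_is_D1 0 _ _ t v B Ht).
      - apply (Ck_is_D1 0 _ _ t v C Ht). }
    apply (second_derivative_at_max (fun t => dot (Y t v) (n u v))
             (fun t => dot (d1 Y t v) (n u v)) u _ d (cond_pos d)).
    + intros t Ht; apply D; auto; apply (Ck3_le 1 3); auto.
    + rewrite dot_comm; apply (im_n1 _ _ _ _ I1 u v Huv).
    + apply D; auto; apply (Ck3_le 1 2); auto; now apply Ck3_d1.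
    + intros t Ht.
      assert (O := emb_normal_outward _ _ _ _ E (sph_z u v) (sph_z t v)
                     (on_sphere_sph_z _ _) (on_sphere_sph_z _ _)).
      rewrite dot_vsub_l in O; unfold Y, n, in_chart; lra.
  - assert (O := emb_normal_outward _ _ _ _ E (sph_z u v) (sph_z 0 0)
                   (on_sphere_sph_z _ _) (on_sphere_sph_z _ _)).
    rewrite dot_vsub_l in O; rewrite dot_vsub_l; unfold in_chart; lra.
Qed.

(** The area density e s turns kappa0 into [mean_density]. The slice term enters as a function [kk]
    continuous up to the poles, which allows the integral to be split and makes this term the same
    for every embedding. *)
Lemma brown_york_of_mean_density a r gam X N kk : polar_metric (Sigma a r) gam ->
  (forall u, 0 < u < PI -> H a r u = (sin u * gam u) ^ 2) ->
  isometric_embedding a r X N -> cont_polar kk ->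
  (forall u v, interior_strip u v ->
     horizon_ext a (kappa a u v) r * sqrt (Sigma a r u ^ 2 * H a r u) = kk u v) ->
  brown_york_of a r X N =
  / (8 * PI) * (polar_integral (mean_density (Sigma a r) gam (in_chart sph_z X)
                                             (in_chart sph_z N)) - polar_integral kk).
Proof.
  intros M HG E Ck Hk.
  assert (S := embedding_closed_surface a r gam X N M HG E).
  assert (RM := polar_rotational_metric _ _ M).
  unfold brown_york_of; f_equal.
  rewrite <- polar_integral_minus; auto; [|now apply mean_density_cont].
  apply (polar_integral_ext (fun theta phi =>
    (kappa0 X N theta phi - horizon_ext a (kappa a theta phi) r)
      * sqrt (Sigma a r theta ^ 2 * H a r theta))).
  intros u v Huv; rewrite <- Hk by auto.
  rewrite Rmult_minus_distr_r; f_equal.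
  unfold kappa0, patch_mean_curvature, mean_curvature.
  destruct (emb_isometric _ _ _ _ E u v Huv) as [-> [-> ->]].
  rewrite HG by auto.
  assert (P1 := rm_e_pos _ _ RM u Huv); assert (P2 := rm_s_pos _ _ RM u Huv).
  simpl in P2.
  replace (Sigma a r u ^ 2 * (sin u * gam u) ^ 2)
    with ((Sigma a r u * (sin u * gam u)) ^ 2) by ring.
  rewrite sqrt_pow2 by (left; now apply Rmult_lt_0_compat).
  unfold mean_density.
  destruct (polar_second_form_interior _ gam _ _ S u v Huv) as [_ ->].
  assert (0 < sin u) by (apply sin_gt_0; apply Huv).
  assert (Pg := pm_g_pos _ gam M u ltac:(unfold interior_strip in Huv; lra)).
  field; repeat split; lra.
Qed.

Lemma brown_york_of_unique a r gam X N X' N' kk : polar_metric (Sigma a r) gam ->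
  (forall u, 0 < u < PI -> H a r u = (sin u * gam u) ^ 2) ->
  isometric_embedding a r X N -> isometric_embedding a r X' N' -> cont_polar kk ->
  (forall u v, interior_strip u v ->
     horizon_ext a (kappa a u v) r * sqrt (Sigma a r u ^ 2 * H a r u) = kk u v) ->
  brown_york_of a r X N = brown_york_of a r X' N'.
Proof.
  intros M HG E E' Ck Hk.
  rewrite (brown_york_of_mean_density a r gam X N kk M HG E Ck Hk),
    (brown_york_of_mean_density a r gam X' N' kk M HG E' Ck Hk).
  rewrite (total_mean_curvature_rigid (Sigma a r) gam (in_chart sph_z X) (in_chart sph_z N)
             (in_chart sph_z X') (in_chart sph_z N')); auto.
  - now apply embedding_closed_surface.
  - now apply (embedding_convex_surface a r gam).
  - now apply embedding_closed_surface.
  - now apply (embedding_convex_surface a r gam).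
Qed.

(** * Convex surfaces of revolution *)

Lemma vec3_ext v w : vx v = vx w -> vy v = vy w -> vz v = vz w -> v = w.
Proof.
  destruct v as [[v1 v2] v3], w as [[w1 w2] w3]; unfold vx, vy, vz; simpl.
  now intros -> -> ->.
Qed.

Definition cross (v w : vec3) : vec3 :=
  (vy v * vz w - vz v * vy w, vz v * vx w - vx v * vz w, vx v * vy w - vy v * vx w).

Definition vscal (k : R) (v : vec3) : vec3 := (k * vx v, k * vy v, k * vz v).

Lemma dot_cross_cross a b c d :
  dot (cross a b) (cross c d) = dot a c * dot b d - dot a d * dot b c.
Proof. unfold dot, cross, vx, vy, vz; simpl; ring. Qed.

Lemma dot_cross_l a b : dot a (cross a b) = 0.
Proof. unfold dot, cross, vx, vy, vz; simpl; ring. Qed.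

Lemma dot_cross_r a b : dot b (cross a b) = 0.
Proof. unfold dot, cross, vx, vy, vz; simpl; ring. Qed.

(** A map of space rather than of polar coordinates: the radius is sin theta g(cos theta), and
    smoothness at the poles reduces to that of [g] and [h] as functions of z. *)
Definition revolve (g h : R -> R) (p : vec3) : vec3 :=
  (vx p * g (vz p), vy p * g (vz p), h (vz p)).

Definition revolve_diff (g h : R -> R) (p w : vec3) : vec3 :=
  (vx w * g (vz p) + vx p * (Derive g (vz p) * vz w),
   vy w * g (vz p) + vy p * (Derive g (vz p) * vz w),
   Derive h (vz p) * vz w).

(** The area vector of the image of a tangent parallelogram. The formula serves both the surface and
    its Gauss map, in either chart. *)
Lemma cross_revolve_diff g h p v w s : dot p p = 1 -> cross v w = vscal s p ->
  cross (revolve_diff g h p v) (revolve_diff g h p w) =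
  vscal (s * g (vz p))
    (vx p * Derive h (vz p), vy p * Derive h (vz p),
     vz p * g (vz p) - (1 - vz p ^ 2) * Derive g (vz p)).
Proof.
  destruct p as [[x y] z], v as [[x1 y1] z1], w as [[x2 y2] z2].
  unfold dot, cross, vscal, revolve_diff, vx, vy, vz; simpl.
  intros Hp E; injection E as Ex Ey Ez.
  apply f_equal2; [apply f_equal2|].
  - match goal with |- ?l = _ =>
      replace l with (g z * Derive h z * (y1 * z2 - z1 * y2)) by ring end.
    rewrite Ex; ring.
  - match goal with |- ?l = _ =>
      replace l with (g z * Derive h z * (z1 * x2 - x1 * z2)) by ring end.
    rewrite Ey; ring.
  - match goal with |- ?l = _ =>
      replace l with (g z * g z * (x1 * y2 - y1 * x2)
        - g z * Derive g z * (y * (z1 * x2 - x1 * z2) + x * (y1 * z2 - z1 * y2))) by ring end.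
    rewrite Ex, Ey, Ez.
    replace (1 - z * (z * 1)) with (x * x + y * y) by lra; ring.
Qed.

Lemma is_derive_revolve_comp (c : R -> vec3) (g h : R -> R) t c' :
  is_derive (fun t => vx (c t)) t (vx c') -> is_derive (fun t => vy (c t)) t (vy c') ->
  is_derive (fun t => vz (c t)) t (vz c') ->
  ex_derive g (vz (c t)) -> ex_derive h (vz (c t)) ->
  is_derive (fun t => vx (revolve g h (c t))) t (vx (revolve_diff g h (c t) c')) /\
  is_derive (fun t => vy (revolve g h (c t))) t (vy (revolve_diff g h (c t) c')) /\
  is_derive (fun t => vz (revolve g h (c t))) t (vz (revolve_diff g h (c t) c')).
Proof.
  intros Hx Hy Hz Hg Hh.
  assert (Dg : is_derive (fun t => g (vz (c t))) t (Derive g (vz (c t)) * vz c')).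
  { evar_last; [apply (is_derive_comp g (fun t => vz (c t)));
      [apply Derive_correct, Hg|exact Hz]|unfold scal; simpl; unfold mult; simpl; ring]. }
  split; [|split].
  - exact (is_derive_Rmult _ _ t _ _ Hx Dg).
  - exact (is_derive_Rmult _ _ t _ _ Hy Dg).
  - evar_last; [apply (is_derive_comp h (fun t => vz (c t)));
      [apply Derive_correct, Hh|exact Hz]
      |unfold revolve_diff, vz, scal; simpl; unfold mult; simpl; ring].
Qed.

Lemma d1_revolve U c (g h : R -> R) u v : Ck3 1 U c -> U u v ->
  ex_derive g (vz (c u v)) -> ex_derive h (vz (c u v)) ->
  d1 (fun u v => revolve g h (c u v)) u v = revolve_diff g h (c u v) (d1 c u v).
Proof.
  intros [A [B C]] Huv Hg Hh.
  destruct (is_derive_revolve_comp (fun t => c t v) g h u (d1 c u v)) as [X [Y Z]]; auto.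
  - exact (Ck_is_D1 0 _ _ u v A Huv).
  - exact (Ck_is_D1 0 _ _ u v B Huv).
  - exact (Ck_is_D1 0 _ _ u v C Huv).
  - apply vec3_ext; now apply is_derive_unique.
Qed.

Lemma d2_revolve U c (g h : R -> R) u v : Ck3 1 U c -> U u v ->
  ex_derive g (vz (c u v)) -> ex_derive h (vz (c u v)) ->
  d2 (fun u v => revolve g h (c u v)) u v = revolve_diff g h (c u v) (d2 c u v).
Proof.
  intros [A [B C]] Huv Hg Hh.
  destruct (is_derive_revolve_comp (fun t => c u t) g h v (d2 c u v)) as [X [Y Z]]; auto.
  - exact (Ck_is_D2 0 _ _ u v A Huv).
  - exact (Ck_is_D2 0 _ _ u v B Huv).
  - exact (Ck_is_D2 0 _ _ u v C Huv).
  - apply vec3_ext; now apply is_derive_unique.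
Qed.

Lemma Ck3_revolve n U D c g h : open2 U -> open D -> Ck1 n D g -> Ck1 n D h ->
  Ck3 n U c -> (forall u v, U u v -> D (vz (c u v))) ->
  Ck3 n U (fun u v => revolve g h (c u v)).
Proof.
  intros HU HD Hg Hh [A [B C]] HUD.
  assert (G : Ck n U (fun u v => g (vz (c u v)))) by now apply Ck1_comp with D.
  split; [|split].
  - exact (Ck_mult n U _ _ HU A G).
  - exact (Ck_mult n U _ _ HU B G).
  - exact (Ck1_comp n U D h (fun u v => vz (c u v)) HU HD Hh C HUD).
Qed.

(** * Charts of the sphere and profiles of revolution *)

Record sphere_chart (c : patch) : Prop := {
  sc_smooth : forall n, Ck3 n interior_strip c;
  sc_sphere : forall u v, on_sphere (c u v);
  sc_cross : forall u v, cross (d1 c u v) (d2 c u v) = vscal (sin u) (c u v)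
}.

Lemma Ck_sin_fst n U : open2 U -> Ck n U (fun u _ => sin u).
Proof. intros HU; apply (Ck_sin n U (fun u _ => u)); auto; apply Ck_fst. Qed.
Lemma Ck_cos_fst n U : open2 U -> Ck n U (fun u _ => cos u).
Proof. intros HU; apply (Ck_cos n U (fun u _ => u)); auto; apply Ck_fst. Qed.
Lemma Ck_sin_snd n U : open2 U -> Ck n U (fun _ v => sin v).
Proof. intros HU; apply (Ck_sin n U (fun _ v => v)); auto; apply Ck_snd. Qed.
Lemma Ck_cos_snd n U : open2 U -> Ck n U (fun _ v => cos v).
Proof. intros HU; apply (Ck_cos n U (fun _ v => v)); auto; apply Ck_snd. Qed.

Lemma d1_sph_z u v : d1 sph_z u v = (cos u * cos v, cos u * sin v, - sin u).
Proof.
  apply vec3_ext; apply is_derive_unique; unfold sph_z, vx, vy, vz; simpl;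
    auto_derive; auto; ring.
Qed.

Lemma d2_sph_z u v : d2 sph_z u v = (- (sin u * sin v), sin u * cos v, 0).
Proof.
  apply vec3_ext; apply is_derive_unique; unfold sph_z, vx, vy, vz; simpl;
    auto_derive; auto; ring.
Qed.

Lemma d1_sph_x u v : d1 sph_x u v = (- sin u, cos u * cos v, cos u * sin v).
Proof.
  apply vec3_ext; apply is_derive_unique; unfold sph_x, vx, vy, vz; simpl;
    auto_derive; auto; ring.
Qed.

Lemma d2_sph_x u v : d2 sph_x u v = (0, - (sin u * sin v), sin u * cos v).
Proof.
  apply vec3_ext; apply is_derive_unique; unfold sph_x, vx, vy, vz; simpl;
    auto_derive; auto; ring.
Qed.

Lemma sphere_chart_sph_z : sphere_chart sph_z.
Proof.
  assert (HO := open2_interior_strip).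
  split.
  - intros n; split; [|split].
    + exact (Ck_mult n _ _ _ HO (Ck_sin_fst n _ HO) (Ck_cos_snd n _ HO)).
    + exact (Ck_mult n _ _ _ HO (Ck_sin_fst n _ HO) (Ck_sin_snd n _ HO)).
    + exact (Ck_cos_fst n _ HO).
  - apply on_sphere_sph_z.
  - intros u v; rewrite d1_sph_z, d2_sph_z.
    unfold cross, vscal, sph_z, vx, vy, vz; simpl.
    apply f_equal2; [apply f_equal2|]; try ring.
    generalize (sin2_cos2 v); unfold Rsqr; intros A.
    match goal with |- ?l = _ =>
      replace l with (sin u * cos u * (sin v * sin v + cos v * cos v)) by ring end.
    rewrite A; ring.
Qed.

Lemma sphere_chart_sph_x : sphere_chart sph_x.
Proof.
  assert (HO := open2_interior_strip).
  split.
  - intros n; split; [|split].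
    + exact (Ck_cos_fst n _ HO).
    + exact (Ck_mult n _ _ _ HO (Ck_sin_fst n _ HO) (Ck_cos_snd n _ HO)).
    + exact (Ck_mult n _ _ _ HO (Ck_sin_fst n _ HO) (Ck_sin_snd n _ HO)).
  - apply on_sphere_sph_x.
  - intros u v; rewrite d1_sph_x, d2_sph_x.
    unfold cross, vscal, sph_x, vx, vy, vz; simpl.
    apply f_equal2; [apply f_equal2|]; try ring.
    generalize (sin2_cos2 v); unfold Rsqr; intros A.
    match goal with |- ?l = _ =>
      replace l with (sin u * cos u * (sin v * sin v + cos v * cos v)) by ring end.
    rewrite A; ring.
Qed.

(* The surface is parametrized over the unit sphere by [revolve g zeta], with
   outward normal [revolve nu f]; [tau] is the length of the image of the unit
   tangent of a meridian. *)
Record profile (D : R -> Prop) (g zeta nu f tau : R -> R) : Prop := {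
  pr_open : open D;
  pr_dom : forall z, -1 <= z <= 1 -> D z;
  pr_g : forall n, Ck1 n D g;
  pr_zeta : forall n, Ck1 n D zeta;
  pr_nu : forall n, Ck1 n D nu;
  pr_f : forall n, Ck1 n D f;
  pr_tau_pos : forall z, D z -> 0 < tau z;
  pr_g_pos : forall z, D z -> 0 < g z;
  pr_nu_pos : forall z, D z -> 0 < nu z;
  pr_meridian : forall z, D z -> f z * tau z = z * g z - (1 - z ^ 2) * Derive g z;
  pr_height : forall z, D z -> Derive zeta z = nu z * tau z;
  pr_unit : forall z, D z -> (1 - z ^ 2) * nu z ^ 2 + f z ^ 2 = 1;
  pr_convex : forall z, -1 <= z <= 1 -> 0 < Derive f z
}.

Lemma Ck1_is_derive D g z : Ck1 1 D g -> D z -> is_derive g z (Derive g z).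
Proof. intros Hg Hz; exact (Ck_is_D1 0 _ _ z 0 Hg Hz). Qed.

Lemma profile_is_derive D g zeta nu f tau : profile D g zeta nu f tau ->
  forall z, D z -> is_derive g z (Derive g z) /\ is_derive zeta z (Derive zeta z) /\
                   is_derive nu z (Derive nu z) /\ is_derive f z (Derive f z).
Proof.
  intros P z Hz.
  refine (conj _ (conj _ (conj _ _))); apply (Ck1_is_derive D); auto.
  - apply (pr_g _ _ _ _ _ _ P).
  - apply (pr_zeta _ _ _ _ _ _ P).
  - apply (pr_nu _ _ _ _ _ _ P).
  - apply (pr_f _ _ _ _ _ _ P).
Qed.

(** Half the derivative of [pr_unit]. It plays for the Gauss map the role that [pr_meridian] plays
    for the surface. *)
Lemma profile_unit_derive D g zeta nu f tau : profile D g zeta nu f tau ->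
  forall z, D z -> nu z * (z * nu z - (1 - z ^ 2) * Derive nu z) = f z * Derive f z.
Proof.
  intros P z Hz.
  destruct (profile_is_derive _ _ _ _ _ _ P z Hz) as [_ [_ [Dn Df]]].
  assert (K : is_derive (fun z => (1 - z ^ 2) * (nu z * nu z) + f z * f z) z
    (- (2 * z) * (nu z * nu z) + (1 - z ^ 2) * (Derive nu z * nu z + nu z * Derive nu z)
     + (Derive f z * f z + f z * Derive f z))).
  { apply (is_derive_plus (V := R_NormedModule)).
    - apply (is_derive_Rmult (fun z => 1 - z ^ 2) (fun z => nu z * nu z));
        [auto_derive; auto; ring|now apply (is_derive_Rmult nu nu)].
    - now apply (is_derive_Rmult f f). }
  assert (K0 : is_derive (fun z => (1 - z ^ 2) * (nu z * nu z) + f z * f z) z 0).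
  { apply (is_derive_ext_loc (fun _ => 1)); [|apply is_derive_Rconst].
    destruct (pr_open _ _ _ _ _ _ P z Hz) as [d Hd].
    exists d; intros y Hy; generalize (pr_unit _ _ _ _ _ _ P y (Hd y Hy)); simpl; lra. }
  apply is_derive_unique in K; apply is_derive_unique in K0; rewrite K0 in K; lra.
Qed.

Lemma sphere_vz_bound p : on_sphere p -> -1 <= vz p <= 1 /\ vx p ^ 2 + vy p ^ 2 = 1 - vz p ^ 2.
Proof. unfold on_sphere, dot; intros Hp; split; [split|]; nra. Qed.

(** The area vectors of the surface and of its Gauss map are both multiples of [revolve nu f], which
    is therefore the normal. Their factors sin g tau and sin f' give the Gauss curvature f' / (g
    tau). *)
Lemma revolve_in_chart D g zeta nu f tau c : profile D g zeta nu f tau -> sphere_chart c ->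
  forall u v, interior_strip u v ->
  let p := c u v in
  d1 (in_chart c (revolve g zeta)) u v = revolve_diff g zeta p (d1 c u v) /\
  d2 (in_chart c (revolve g zeta)) u v = revolve_diff g zeta p (d2 c u v) /\
  d1 (in_chart c (revolve nu f)) u v = revolve_diff nu f p (d1 c u v) /\
  d2 (in_chart c (revolve nu f)) u v = revolve_diff nu f p (d2 c u v) /\
  cross (revolve_diff g zeta p (d1 c u v)) (revolve_diff g zeta p (d2 c u v))
    = vscal (sin u * g (vz p) * tau (vz p)) (revolve nu f p) /\
  cross (revolve_diff nu f p (d1 c u v)) (revolve_diff nu f p (d2 c u v))
    = vscal (sin u * Derive f (vz p)) (revolve nu f p) /\
  dot (revolve nu f p) (revolve nu f p) = 1.
Proof.
  intros P SC u v Huv p.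
  assert (Sp := sc_sphere c SC u v); fold p in Sp.
  destruct (sphere_vz_bound p Sp) as [Hz Hxy].
  assert (HD := pr_dom _ _ _ _ _ _ P _ Hz).
  destruct (profile_is_derive _ _ _ _ _ _ P _ HD) as [Dg [Dzeta [Dnu Df]]].
  assert (Sm := sc_smooth c SC 1%nat).
  assert (Cr := sc_cross c SC u v).
  split; [|split; [|split; [|split; [|split; [|split]]]]].
  - apply (d1_revolve interior_strip); auto; eexists; eauto.
  - apply (d2_revolve interior_strip); auto; eexists; eauto.
  - apply (d1_revolve interior_strip); auto; eexists; eauto.
  - apply (d2_revolve interior_strip); auto; eexists; eauto.
  - rewrite (cross_revolve_diff g zeta p _ _ (sin u) Sp Cr).
    rewrite (pr_height _ _ _ _ _ _ P _ HD), <- (pr_meridian _ _ _ _ _ _ P _ HD).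
    unfold vscal, revolve, vx, vy, vz; simpl.
    apply f_equal2; [apply f_equal2|]; ring.
  - rewrite (cross_revolve_diff nu f p _ _ (sin u) Sp Cr).
    assert (K := profile_unit_derive _ _ _ _ _ _ P _ HD).
    unfold revolve; set (x := vx p) in *; set (y := vy p) in *; set (z := vz p) in *.
    apply vec3_ext; unfold vscal, vx, vy, vz; simpl; [ring|ring|].
    replace (1 - z * (z * 1)) with (1 - z ^ 2) by ring.
    rewrite Rmult_assoc, K; ring.
  - replace (dot (revolve nu f p) (revolve nu f p))
      with ((vx p ^ 2 + vy p ^ 2) * nu (vz p) ^ 2 + f (vz p) ^ 2)
      by (unfold dot, revolve, vx, vy, vz; simpl; ring).
    rewrite Hxy; apply (pr_unit _ _ _ _ _ _ P _ HD).
Qed.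

Lemma revolve_smooth_patch D g h c : open D -> (forall z, -1 <= z <= 1 -> D z) ->
  (forall n, Ck1 n D g) -> (forall n, Ck1 n D h) -> sphere_chart c ->
  forall n, Ck3 n interior_strip (in_chart c (revolve g h)).
Proof.
  intros HD HD1 Hg Hh SC n.
  apply (Ck3_revolve n interior_strip D c g h); auto.
  - apply open2_interior_strip.
  - apply (sc_smooth c SC).
  - intros u v _; apply HD1, sphere_vz_bound, (sc_sphere c SC).
Qed.

Lemma dot_vscal k v w : dot (vscal k v) w = k * dot v w.
Proof. unfold dot, vscal, vx, vy, vz; simpl; ring. Qed.

Lemma revolve_normal_along D g zeta nu f tau c : profile D g zeta nu f tau ->
  sphere_chart c ->
  normal_along (in_chart c (revolve g zeta)) (in_chart c (revolve nu f)).
Proof.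
  intros P SC u v Huv.
  destruct (revolve_in_chart _ _ _ _ _ _ c P SC u v Huv) as [-> [-> [_ [_ [E _]]]]].
  unfold in_chart.
  assert (Sp := sc_sphere c SC u v).
  assert (HD := pr_dom _ _ _ _ _ _ P _ (proj1 (sphere_vz_bound _ Sp))).
  set (k := sin u * g (vz (c u v)) * tau (vz (c u v))) in E.
  assert (Hk : 0 < k).
  { unfold k; repeat apply Rmult_lt_0_compat.
    - apply sin_gt_0; apply Huv.
    - apply (pr_g_pos _ _ _ _ _ _ P _ HD).
    - apply (pr_tau_pos _ _ _ _ _ _ P _ HD). }
  split; apply Rmult_eq_reg_l with k; try lra; rewrite <- dot_vscal, <- E, dot_comm.
  - rewrite dot_cross_l; ring.
  - rewrite dot_cross_r; ring.
Qed.

(** By Lagrange's identity det h = <n_1 x n_2, Y_1 x Y_2> and det g = |Y_1 x Y_2|^2, and both cross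
    products are positive multiples of the normal. *)
Lemma revolve_positively_curved D g zeta nu f tau c : profile D g zeta nu f tau ->
  sphere_chart c ->
  positively_curved (in_chart c (revolve g zeta)) (in_chart c (revolve nu f)).
Proof.
  intros P SC u v Huv.
  assert (NA := revolve_normal_along _ _ _ _ _ _ c P SC).
  assert (SX := revolve_smooth_patch D g zeta c (pr_open _ _ _ _ _ _ P)
                  (pr_dom _ _ _ _ _ _ P) (pr_g _ _ _ _ _ _ P) (pr_zeta _ _ _ _ _ _ P) SC).
  assert (SN := revolve_smooth_patch D nu f c (pr_open _ _ _ _ _ _ P)
                  (pr_dom _ _ _ _ _ _ P) (pr_nu _ _ _ _ _ _ P) (pr_f _ _ _ _ _ _ P) SC).
  destruct (second_form_normal_derivatives interior_strip _ _ open2_interior_strip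
              (SX 2%nat) (SN 1%nat) (fun u v H => proj1 (NA u v H))
              (fun u v H => proj2 (NA u v H)) u v Huv) as [E11 [E12 [E21 E22]]].
  destruct (revolve_in_chart _ _ _ _ _ _ c P SC u v Huv)
    as [X1 [X2 [N1 [N2 [CX [CN U1]]]]]].
  assert (Sp := sc_sphere c SC u v).
  assert (Hz := proj1 (sphere_vz_bound _ Sp)).
  assert (HD := pr_dom _ _ _ _ _ _ P _ Hz).
  set (p := c u v) in *.
  unfold patch_gauss_curvature, gauss_curvature.
  set (Y := in_chart c (revolve g zeta)) in *; set (n := in_chart c (revolve nu f)) in *.
  replace (h11 Y n u v * h22 Y n u v - h12 Y n u v ^ 2)
    with (h11 Y n u v * h22 Y n u v - h12 Y n u v * h12 Y n u v) by ring.
  (* One factor h12 becomes <n_1, Y_2> and the other <n_2, Y_1>, as Lagrange's identity requires. *)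
  rewrite E12 at 1; rewrite E21, E11, E22.
  unfold g11, g12, g22.
  replace (dot (d1 Y u v) (d1 Y u v) * dot (d2 Y u v) (d2 Y u v) - dot (d1 Y u v) (d2 Y u v) ^ 2)
    with (dot (d1 Y u v) (d1 Y u v) * dot (d2 Y u v) (d2 Y u v)
          - dot (d1 Y u v) (d2 Y u v) * dot (d2 Y u v) (d1 Y u v))
    by (rewrite (dot_comm (d2 Y u v) (d1 Y u v)); ring).
  rewrite <- !dot_cross_cross, X1, X2, N1, N2, CX, CN.
  rewrite !dot_vscal, !(dot_comm _ (vscal _ _)), !dot_vscal, U1.
  assert (0 < sin u) by (apply sin_gt_0; apply Huv).
  assert (A := pr_g_pos _ _ _ _ _ _ P _ HD); assert (B := pr_tau_pos _ _ _ _ _ _ P _ HD).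
  assert (C := pr_convex _ _ _ _ _ _ P _ Hz).
  apply Rdiv_lt_0_compat; rewrite Rmult_1_r; repeat apply Rmult_lt_0_compat; auto.
Qed.

(** * Supporting planes and injectivity *)

Lemma profile_f_increasing D g zeta nu f tau : profile D g zeta nu f tau ->
  forall y z, -1 <= y -> y <= z -> z <= 1 -> f y <= f z.
Proof.
  intros P y z Hy Hyz Hz.
  assert (Df : forall x, -1 <= x <= 1 -> is_derive f x (Derive f x)).
  { intros x Hx.
    apply (profile_is_derive _ _ _ _ _ _ P x (pr_dom _ _ _ _ _ _ P x Hx)). }
  destruct (MVT_gen f y z (Derive f)) as [x [Hx E]];
    rewrite ?Rmin_left, ?Rmax_right in * by lra.
  - intros x Hx; apply (Df x ltac:(lra)).
  - intros x Hx; apply (is_derive_continuity_pt _ _ _ (Df x ltac:(lra))).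
  - assert (K := pr_convex _ _ _ _ _ _ P x ltac:(lra)); nra.
Qed.

(* With [f = cos psi] and [w = sin psi], [w0 * f1 - f0 * w1 = sin (psi0 - psi1)]. *)
Lemma unit_pairs_order f0 w0 f1 w1 : f0 ^ 2 + w0 ^ 2 = 1 -> f1 ^ 2 + w1 ^ 2 = 1 ->
  0 <= w0 -> 0 <= w1 -> f0 <= f1 -> 0 <= w0 * f1 - f0 * w1.
Proof.
  intros E0 E1 H0 H1 Hf.
  destruct (Rle_or_lt 0 f0) as [A|A].
  - assert (w1 <= w0) by nra; nra.
  - destruct (Rle_or_lt 0 f1) as [B|B]; [nra|].
    assert (w0 <= w1) by nra; nra.
Qed.

Lemma sphere_polar_angle p : on_sphere p ->
  exists t, 0 <= t <= PI /\ vz p = cos t.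
Proof.
  intros Hp; exists (acos (vz p)); split; [apply acos_bound|].
  symmetry; apply cos_acos; apply (proj1 (sphere_vz_bound p Hp)).
Qed.

(** Within one meridian plane, let F be the linear function given by the normal at angle [s], taken
    along the curve. Its derivative is tau times the sine of the difference of the normal angles; as
    f is increasing, F grows before [s] and decreases after it. *)
Lemma profile_supporting_line D g zeta nu f tau : profile D g zeta nu f tau ->
  forall s t, 0 <= s <= PI -> 0 <= t <= PI ->
  nu (cos s) * sin s * (sin t * g (cos t) - sin s * g (cos s))
  + f (cos s) * (zeta (cos t) - zeta (cos s)) <= 0.
Proof.
  intros P s t Hs Ht.
  assert (HD : forall x, D (cos x)) by (intros x; apply (pr_dom _ _ _ _ _ _ P), COS_bound).
  set (F := fun x => nu (cos s) * sin s * (sin x * g (cos x)) + f (cos s) * zeta (cos x)).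
  set (F' := fun x => tau (cos x) *
     (nu (cos s) * sin s * f (cos x) - f (cos s) * (nu (cos x) * sin x))).
  assert (DF : forall x, is_derive F x (F' x)).
  { intros x; destruct (profile_is_derive _ _ _ _ _ _ P _ (HD x)) as [Dg [Dz _]].
    assert (A : is_derive (fun x => g (cos x)) x (- sin x * Derive g (cos x)))
      by exact (is_derive_comp (V := R_NormedModule) g cos x _ _ Dg (is_derive_cos x)).
    assert (B : is_derive (fun x => zeta (cos x)) x (- sin x * Derive zeta (cos x)))
      by exact (is_derive_comp (V := R_NormedModule) zeta cos x _ _ Dz (is_derive_cos x)).
    assert (K := pr_meridian _ _ _ _ _ _ P _ (HD x)).
    assert (L := pr_height _ _ _ _ _ _ P _ (HD x)).
    evar_last.
    - apply (is_derive_plus (V := R_NormedModule)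
               (fun x => nu (cos s) * sin s * (sin x * g (cos x)))
               (fun x => f (cos s) * zeta (cos x))).
      + apply is_derive_Rmult; [apply is_derive_Rconst|].
        apply is_derive_Rmult; [apply is_derive_sin|exact A].
      + apply is_derive_Rmult; [apply is_derive_Rconst|exact B].
    - unfold plus; simpl; rewrite L; unfold F'.
      replace (tau (cos x) * (nu (cos s) * sin s * f (cos x)
                 - f (cos s) * (nu (cos x) * sin x)))
        with (nu (cos s) * sin s * (f (cos x) * tau (cos x))
              - f (cos s) * (nu (cos x) * sin x) * tau (cos x)) by ring.
      rewrite K; generalize (sin2_cos2 x); unfold Rsqr; intros E.
      replace (1 - cos x ^ 2) with (sin x * sin x) by (simpl; lra); ring. }
  assert (Sgn : forall x y, 0 <= x -> x <= y -> y <= PI ->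
            0 <= nu (cos y) * sin y * f (cos x) - f (cos y) * (nu (cos x) * sin x)).
  { intros x y Hx Hxy Hy.
    assert (W : forall x, 0 <= x <= PI -> f (cos x) ^ 2 + (nu (cos x) * sin x) ^ 2 = 1 /\
                                   0 <= nu (cos x) * sin x).
    { intros z Hz; split.
      - generalize (pr_unit _ _ _ _ _ _ P _ (HD z)) (sin2_cos2 z); unfold Rsqr; intros E1 E2.
        rewrite <- E1; replace (1 - cos z ^ 2) with (sin z * sin z) by (simpl; lra); ring.
      - apply Rmult_le_pos; [left; apply (pr_nu_pos _ _ _ _ _ _ P _ (HD z))|].
        apply sin_ge_0; lra. }
    destruct (W x) as [A1 A2]; [lra|]; destruct (W y) as [B1 B2]; [lra|].
    apply unit_pairs_order; auto.
    apply (profile_f_increasing _ _ _ _ _ _ P).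
    - apply COS_bound.
    - apply cos_decr_1; lra.
    - apply COS_bound. }
  destruct (MVT_gen F s t F') as [x [Hx E]].
  - intros; apply DF.
  - intros; eapply is_derive_continuity_pt, DF.
  - match goal with |- ?l <= 0 => replace l with (F t - F s) by (unfold F; ring) end.
    rewrite E; unfold F'.
    destruct (Rle_or_lt s t) as [Hst|Hst].
    + rewrite Rmin_left, Rmax_right in Hx by lra.
      assert (K := Sgn s x ltac:(lra) ltac:(lra) ltac:(lra)).
      assert (T := pr_tau_pos _ _ _ _ _ _ P _ (HD x)).
      assert (M : 0 <= tau (cos x) *
        (nu (cos x) * sin x * f (cos s) - f (cos x) * (nu (cos s) * sin s)))
        by (apply Rmult_le_pos; lra).
      assert (M2 := Rmult_le_pos _ (t - s) M ltac:(lra)); lra.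
    + rewrite Rmin_right, Rmax_left in Hx by lra.
      assert (K := Sgn x s ltac:(lra) ltac:(lra) ltac:(lra)).
      assert (T := pr_tau_pos _ _ _ _ _ _ P _ (HD x)).
      assert (M : 0 <= tau (cos x) *
        (nu (cos s) * sin s * f (cos x) - f (cos s) * (nu (cos x) * sin x)))
        by (apply Rmult_le_pos; lra).
      assert (M2 := Rmult_le_pos _ (s - t) M ltac:(lra)); lra.
Qed.

(** Rotating [q] into the meridian half-plane of [p] can only increase the left-hand side, by
    Cauchy-Schwarz in the horizontal plane and nu g > 0. The planar case remains. *)
Lemma revolve_outward D g zeta nu f tau : profile D g zeta nu f tau ->
  forall p q, on_sphere p -> on_sphere q ->
  dot (vsub (revolve g zeta q) (revolve g zeta p)) (revolve nu f p) <= 0.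
Proof.
  intros P p q Hp Hq.
  destruct (sphere_polar_angle p Hp) as [s [Hs Es]].
  destruct (sphere_polar_angle q Hq) as [t [Ht Et]].
  destruct (sphere_vz_bound p Hp) as [_ Rp]; destruct (sphere_vz_bound q Hq) as [_ Rq].
  assert (K := profile_supporting_line _ _ _ _ _ _ P s t Hs Ht).
  destruct p as [[x y] z], q as [[x' y'] z']; unfold vx, vy, vz in *; simpl in *; subst z z'.
  unfold dot, vsub, revolve, vx, vy, vz; simpl.
  assert (S1 : x * x + y * y = sin s * sin s)
    by (generalize (sin2_cos2 s); unfold Rsqr; lra).
  assert (S2 : x' * x' + y' * y' = sin t * sin t)
    by (generalize (sin2_cos2 t); unfold Rsqr; lra).
  assert (S3 : x * x' + y * y' <= sin s * sin t).
  { assert (A : 0 <= sin s) by (apply sin_ge_0; lra).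
    assert (B : 0 <= sin t) by (apply sin_ge_0; lra).
    apply Rnot_lt_le; intros C.
    assert (D1 : (sin s * sin t) * (sin s * sin t) < (x * x' + y * y') * (x * x' + y * y'))
      by (assert (0 <= sin s * sin t) by (now apply Rmult_le_pos); nra).
    assert (D2 : (x * x' + y * y') * (x * x' + y * y')
                 = (x * x + y * y) * (x' * x' + y' * y') - (x * y' - y * x') ^ 2) by ring.
    rewrite S1, S2 in D2; generalize (pow2_ge_0 (x * y' - y * x')); lra. }
  assert (HD : forall x, D (cos x)) by (intros; apply (pr_dom _ _ _ _ _ _ P), COS_bound).
  assert (Pn := pr_nu_pos _ _ _ _ _ _ P _ (HD s)).
  assert (Pg := pr_g_pos _ _ _ _ _ _ P _ (HD t)).
  match goal with |- ?l <= 0 => replace l with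
    (nu (cos s) * g (cos t) * (x * x' + y * y') - nu (cos s) * g (cos s) * (x * x + y * y)
     + f (cos s) * (zeta (cos t) - zeta (cos s))) by ring end.
  rewrite S1.
  assert (L : nu (cos s) * g (cos t) * (x * x' + y * y')
              <= nu (cos s) * g (cos t) * (sin s * sin t)).
  { apply Rmult_le_compat_l; auto; left; now apply Rmult_lt_0_compat. }
  lra.
Qed.

Lemma revolve_injective D g zeta nu f tau : profile D g zeta nu f tau ->
  forall p q, on_sphere p -> on_sphere q -> revolve g zeta p = revolve g zeta q -> p = q.
Proof.
  intros P p q Hp Hq E.
  destruct (sphere_vz_bound p Hp) as [Bp _]; destruct (sphere_vz_bound q Hq) as [Bq _].
  assert (Inc : forall y z, -1 <= y -> y < z -> z <= 1 -> zeta y < zeta z).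
  { intros y z Hy Hyz Hz.
    assert (Dz : forall x, -1 <= x <= 1 -> is_derive zeta x (Derive zeta x)).
    { intros x Hx.
      exact (proj1 (proj2 (profile_is_derive _ _ _ _ _ _ P x (pr_dom _ _ _ _ _ _ P x Hx)))). }
    destruct (MVT_gen zeta y z (Derive zeta)) as [x [Hx Ex]];
      rewrite ?Rmin_left, ?Rmax_right in * by lra.
    - intros x Hx; apply (Dz x ltac:(lra)).
    - intros x Hx; apply (is_derive_continuity_pt _ _ _ (Dz x ltac:(lra))).
    - assert (HD : D x) by (apply (pr_dom _ _ _ _ _ _ P); lra).
      rewrite (pr_height _ _ _ _ _ _ P x HD) in Ex.
      assert (A := pr_nu_pos _ _ _ _ _ _ P x HD); assert (B := pr_tau_pos _ _ _ _ _ _ P x HD).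
      assert (C := Rmult_lt_0_compat _ _ A B); nra. }
  destruct p as [[x y] z], q as [[x' y'] z']; unfold vx, vy, vz in *; simpl in *.
  unfold revolve, vx, vy, vz in E; simpl in E; injection E as Ex Ey Ez.
  assert (z = z').
  { destruct (Rtotal_order z z') as [L|[L|L]]; auto; exfalso.
    - assert (K := Inc z z' ltac:(lra) L ltac:(lra)); lra.
    - assert (K := Inc z' z ltac:(lra) L ltac:(lra)); lra. }
  subst z'.
  assert (G := pr_g_pos _ _ _ _ _ _ P z (pr_dom _ _ _ _ _ _ P z Bp)).
  apply Rmult_eq_reg_r in Ex; [|lra]; apply Rmult_eq_reg_r in Ey; [|lra].
  now subst.
Qed.

Lemma revolve_metric D g zeta nu f tau : profile D g zeta nu f tau ->
  forall u v, interior_strip u v ->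
  g11 (in_chart sph_z (revolve g zeta)) u v = tau (cos u) ^ 2 /\
  g12 (in_chart sph_z (revolve g zeta)) u v = 0 /\
  g22 (in_chart sph_z (revolve g zeta)) u v = (sin u * g (cos u)) ^ 2.
Proof.
  intros P u v Huv.
  destruct (revolve_in_chart _ _ _ _ _ _ sph_z P sphere_chart_sph_z u v Huv)
    as [E1 [E2 _]].
  unfold g11, g12, g22; rewrite E1, E2, d1_sph_z, d2_sph_z.
  assert (HD : D (cos u)) by (apply (pr_dom _ _ _ _ _ _ P), COS_bound).
  assert (K := pr_meridian _ _ _ _ _ _ P _ HD); assert (L := pr_height _ _ _ _ _ _ P _ HD).
  assert (U := pr_unit _ _ _ _ _ _ P _ HD).
  unfold dot, revolve_diff, sph_z, vx, vy, vz; simpl.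
  rewrite L.
  generalize (sin2_cos2 u) (sin2_cos2 v); unfold Rsqr; intros Su Sv.
  replace (1 - cos u ^ 2) with (sin u * sin u) in K, U by (simpl; lra).
  split; [|split].
  - match goal with |- ?l = _ => replace l with
      ((cos u * g (cos u) - sin u * sin u * Derive g (cos u)) ^ 2
        * (sin v * sin v + cos v * cos v)
       + sin u * sin u * nu (cos u) ^ 2 * tau (cos u) ^ 2) by ring end.
    rewrite Sv, <- K.
    replace ((f (cos u) * tau (cos u)) ^ 2 * 1 + sin u * sin u * nu (cos u) ^ 2 * tau (cos u) ^ 2)
      with ((sin u * sin u * nu (cos u) ^ 2 + f (cos u) ^ 2) * tau (cos u) ^ 2) by ring.
    rewrite U; ring.
  - ring.
  - match goal with |- ?l = _ => replace l with
      ((sin u * g (cos u)) ^ 2 * (sin v * sin v + cos v * cos v)) by ring end.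
    rewrite Sv; ring.
Qed.

Lemma Ck3_smooth_patch Y : (forall n, Ck3 n interior_strip Y) -> smooth_patch Y.
Proof.
  intros HY n u v Huv; destruct (HY n) as [A [B C]].
  split; [now apply A|split; [now apply B|now apply C]].
Qed.

Lemma revolve_isometric_embedding a r D g zeta nu f tau : profile D g zeta nu f tau ->
  (forall u, 0 < u < PI -> Sigma a r u = tau (cos u)) ->
  (forall u, 0 < u < PI -> H a r u = (sin u * g (cos u)) ^ 2) ->
  isometric_embedding a r (revolve g zeta) (revolve nu f).
Proof.
  intros P HS HH.
  assert (Cz := sphere_chart_sph_z); assert (Cx := sphere_chart_sph_x).
  split.
  - split; apply Ck3_smooth_patch, (revolve_smooth_patch D); auto; apply P.
  - apply (revolve_injective _ _ _ _ _ _ P).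
  - intros u v Huv; rewrite HS, HH by auto; apply (revolve_metric _ _ _ _ _ _ P u v Huv).
  - split; apply Ck3_smooth_patch, (revolve_smooth_patch D); auto; apply P.
  - intros p Hp; destruct (sphere_vz_bound p Hp) as [Hz Hxy].
    replace (dot (revolve nu f p) (revolve nu f p))
      with ((vx p ^ 2 + vy p ^ 2) * nu (vz p) ^ 2 + f (vz p) ^ 2)
      by (unfold dot, revolve, vx, vy, vz; simpl; ring).
    rewrite Hxy; apply (pr_unit _ _ _ _ _ _ P), (pr_dom _ _ _ _ _ _ P), Hz.
  - split; now apply (revolve_normal_along D g zeta nu f tau).
  - apply (revolve_outward _ _ _ _ _ _ P).
  - split; now apply (revolve_positively_curved D g zeta nu f tau).
Qed.

(** * The isometric embedding of S(r) *)

(** [ad_eps] controls the sign of f'. [ad_pole] is positivity of [KQ] at z = 1 and z = -1, where it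
    equals r (r^3 + a^2 r - 6 a^2) / (r^2 + a^2). *)
Record admissible (a r : R) : Prop := {
  ad_r : 0 < r;
  ad_Delta : 0 <= Delta a r;
  ad_eps : 4 * a ^ 2 <= r ^ 2;
  ad_pole : 0 < r ^ 3 + a ^ 2 * r - 6 * a ^ 2
}.

(* With [z = cos theta]: [Sigma^2 = KT z] and [H = (1 - z^2) * KP z / KT z]. *)
Definition KT (a r z : R) : R := r ^ 2 + a ^ 2 * z ^ 2.
Definition KP (a r z : R) : R :=
  (r ^ 2 + a ^ 2) ^ 2 - Delta a r * a ^ 2 * (1 - z ^ 2).
(** d sqrt H / dtheta = z KN / (KT^(3/2) KP^(1/2)). *)
Definition KN (a r z : R) : R :=
  KP a r z * KT a r z + 2 * a ^ 2 * r * (r ^ 2 + a ^ 2) * (1 - z ^ 2).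
(* [Sigma^2 - (d sqrt H / dtheta)^2 = (1 - z^2) * KQ z] *)
Definition KQ (a r z : R) : R :=
  r * (r ^ 3 + a ^ 2 * (r - 2) * z ^ 2) / KT a r z
  - 4 * a ^ 2 * r * (r ^ 2 + a ^ 2) * z ^ 2 / KT a r z ^ 2
  - (1 - z ^ 2) * (4 * a ^ 4 * r ^ 2 * (r ^ 2 + a ^ 2) ^ 2 * z ^ 2)
    / (KT a r z ^ 3 * KP a r z).

Definition prof_tau (a r z : R) : R := sqrt (KT a r z).
Definition prof_g (a r z : R) : R := sqrt (KP a r z) / sqrt (KT a r z).
Definition prof_f (a r z : R) : R := z * KN a r z / (KT a r z ^ 2 * sqrt (KP a r z)).
Definition prof_nu (a r z : R) : R := sqrt (KQ a r z) / sqrt (KT a r z).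
(** The height satisfies zeta' = nu tau = sqrt KQ and is given as an integral; the equator is put at
    height 0. *)
Definition prof_zeta (a r z : R) : R := RInt (fun t => sqrt (KQ a r t)) 0 z.

Lemma KP_eq a r z : KP a r z = Delta a r * KT a r z + 2 * r * (r ^ 2 + a ^ 2).
Proof. unfold KP, KT, Delta; ring. Qed.

Lemma KT_pos a r z : 0 < r -> 0 < KT a r z.
Proof.
  intros Hr; unfold KT.
  assert (0 <= a ^ 2 * z ^ 2) by (apply Rmult_le_pos; apply pow2_ge_0).
  assert (0 < r ^ 2) by now apply pow_lt. lra.
Qed.

Lemma KP_pos a r z : admissible a r -> 0 < KP a r z.
Proof.
  intros [Hr HD _ _]; rewrite KP_eq.
  assert (A := KT_pos a r z Hr).
  assert (0 <= Delta a r * KT a r z) by (apply Rmult_le_pos; lra).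
  assert (0 < r ^ 2) by now apply pow_lt.
  assert (0 < r * (r ^ 2 + a ^ 2))
    by (apply Rmult_lt_0_compat; auto; generalize (pow2_ge_0 a); lra).
  lra.
Qed.

Lemma one_minus_sqr_nonneg z : -1 <= z <= 1 -> 0 <= 1 - z ^ 2.
Proof.
  intros Hz; replace (1 - z ^ 2) with ((1 - z) * (1 + z)) by ring.
  apply Rmult_le_pos; lra.
Qed.

Lemma KN_pos a r z : admissible a r -> -1 <= z <= 1 -> 0 < KN a r z.
Proof.
  intros A Hz; unfold KN.
  assert (Hr := ad_r _ _ A).
  assert (0 < KP a r z * KT a r z)
    by (apply Rmult_lt_0_compat; [now apply KP_pos|now apply KT_pos]).
  assert (0 <= 2 * a ^ 2 * r * (r ^ 2 + a ^ 2) * (1 - z ^ 2)); [|lra].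
  assert (0 <= a ^ 2) by apply pow2_ge_0.
  assert (0 <= r ^ 2) by apply pow2_ge_0.
  assert (Hz2 := one_minus_sqr_nonneg z Hz).
  apply Rmult_le_pos; [|lra]; apply Rmult_le_pos; [|lra]; apply Rmult_le_pos; lra.
Qed.

(** * Monotonicity of the angle function f *)

Lemma is_derive_KT a r z : is_derive (KT a r) z (2 * a ^ 2 * z).
Proof. unfold KT; auto_derive; auto; ring. Qed.

Lemma is_derive_KP a r z : is_derive (KP a r) z (2 * Delta a r * a ^ 2 * z).
Proof. unfold KP; auto_derive; auto; ring. Qed.

Definition KN' (a r z : R) : R :=
  2 * Delta a r * a ^ 2 * z * KT a r z + KP a r z * (2 * a ^ 2 * z)
  - 4 * a ^ 2 * r * (r ^ 2 + a ^ 2) * z.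

Lemma is_derive_KN a r z : is_derive (KN a r) z (KN' a r z).
Proof.
  unfold KN, KN'.
  apply (is_derive_plus (V := R_NormedModule) (fun z => KP a r z * KT a r z)
           (fun z => 2 * a ^ 2 * r * (r ^ 2 + a ^ 2) * (1 - z ^ 2))).
  - apply is_derive_Rmult; [apply is_derive_KP|apply is_derive_KT].
  - auto_derive; auto; ring.
Qed.

(** On the left is the numerator of f' from the quotient rule. On the right, for Delta >= 0 and |z|
    <= 1, the only factor whose sign is in doubt is r^2 - 4 a^2 z^2: this is the source of the
    condition 4 a^2 <= r^2. *)
Lemma KN_identity a r z :
  (KN a r z + z * KN' a r z) * KT a r z * KP a r z
  - z * KN a r z * (4 * a ^ 2 * z * KP a r z + KT a r z * (Delta a r * a ^ 2 * z)) =
  KN a r z * (KP a r z * (r ^ 2 - 4 * a ^ 2 * z ^ 2)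
              + 2 * r * (r ^ 2 + a ^ 2) * a ^ 2 * z ^ 2)
  + 4 * a ^ 2 * z ^ 2 * Delta a r * KT a r z ^ 2 * KP a r z.
Proof. unfold KN', KN; rewrite KP_eq; unfold KT; ring. Qed.

Definition prof_f' (a r z : R) : R :=
  (KN a r z * (KP a r z * (r ^ 2 - 4 * a ^ 2 * z ^ 2)
               + 2 * r * (r ^ 2 + a ^ 2) * a ^ 2 * z ^ 2)
   + 4 * a ^ 2 * z ^ 2 * Delta a r * KT a r z ^ 2 * KP a r z)
  / (KT a r z ^ 3 * KP a r z * sqrt (KP a r z)).

Lemma is_derive_sqrt_KP a r z : admissible a r ->
  is_derive (fun z => sqrt (KP a r z)) z (Delta a r * a ^ 2 * z / sqrt (KP a r z)).
Proof.
  intros A; assert (HP := KP_pos a r z A).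
  evar_last; [apply (is_derive_sqrt (KP a r)); [apply is_derive_KP|auto]|].
  field; apply Rgt_not_eq, sqrt_lt_R0, HP.
Qed.

Lemma is_derive_prof_f a r z : admissible a r ->
  is_derive (prof_f a r) z (prof_f' a r z).
Proof.
  intros A; assert (HP := KP_pos a r z A); assert (HT := KT_pos a r z (ad_r _ _ A)).
  assert (HW : 0 < sqrt (KP a r z)) by now apply sqrt_lt_R0.
  assert (EW : sqrt (KP a r z) * sqrt (KP a r z) = KP a r z) by (apply sqrt_sqrt; lra).
  evar_last.
  - apply (is_derive_div (fun z => z * KN a r z) (fun z => KT a r z ^ 2 * sqrt (KP a r z))).
    + apply (is_derive_Rmult (fun z => z) (KN a r));
        [exact (is_derive_id z)|apply is_derive_KN].
    + apply (is_derive_Rmult (fun z => KT a r z ^ 2) (fun z => sqrt (KP a r z)));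
        [|now apply is_derive_sqrt_KP].
      evar_last; [apply (is_derive_ext (fun z => KT a r z * KT a r z));
        [intros; simpl; ring|apply is_derive_Rmult; apply is_derive_KT]|reflexivity].
    + apply Rmult_integral_contrapositive_currified; [apply pow_nonzero|]; lra.
  - assert (E := KN_identity a r z).
    unfold prof_f', one, KN' in *; simpl in *; rewrite <- E; clear E.
    set (w := sqrt (KP a r z)) in *; rewrite <- EW; field; lra.
Qed.

Lemma prof_f'_pos a r z : admissible a r -> -1 <= z <= 1 -> 0 < prof_f' a r z.
Proof.
  intros A Hz.
  assert (Hr := ad_r _ _ A); assert (He := ad_eps _ _ A); assert (HD := ad_Delta _ _ A).
  assert (HP := KP_pos a r z A); assert (HT := KT_pos a r z Hr); assert (HN := KN_pos a r z A Hz).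
  assert (HW : 0 < sqrt (KP a r z)) by now apply sqrt_lt_R0.
  assert (Hy := one_minus_sqr_nonneg z Hz).
  assert (Ha := pow2_ge_0 a); assert (Hz2 := pow2_ge_0 z); assert (Hr2 := pow_lt r 2 Hr).
  assert (Hay : a ^ 2 * z ^ 2 <= a ^ 2) by nra.
  assert (Hay0 : 0 <= a ^ 2 * z ^ 2) by now apply Rmult_le_pos.
  assert (HM : 0 < r * (r ^ 2 + a ^ 2)) by (apply Rmult_lt_0_compat; lra).
  apply Rdiv_lt_0_compat.
  2: { apply Rmult_lt_0_compat; auto; apply Rmult_lt_0_compat; auto; now apply pow_lt. }
  assert (K1 : 0 < KP a r z * (r ^ 2 - 4 * a ^ 2 * z ^ 2)
                   + 2 * r * (r ^ 2 + a ^ 2) * a ^ 2 * z ^ 2).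
  { replace (2 * r * (r ^ 2 + a ^ 2) * a ^ 2 * z ^ 2)
      with (2 * (r * (r ^ 2 + a ^ 2) * (a ^ 2 * z ^ 2))) by ring.
    (* As r^2 - 4 a^2 z^2 may vanish, strictness comes from the second summand when a z is nonzero,
       and from KP r^2 otherwise. *)
    destruct Hay0 as [H0|H0].
    - assert (0 < r * (r ^ 2 + a ^ 2) * (a ^ 2 * z ^ 2)) by now apply Rmult_lt_0_compat.
      assert (0 <= KP a r z * (r ^ 2 - 4 * a ^ 2 * z ^ 2)) by (apply Rmult_le_pos; lra).
      lra.
    - replace (4 * a ^ 2 * z ^ 2) with (4 * (a ^ 2 * z ^ 2)) by ring.
      rewrite <- H0; assert (K := Rmult_lt_0_compat _ _ HP Hr2); lra. }
  assert (K2 : 0 <= 4 * a ^ 2 * z ^ 2 * Delta a r * KT a r z ^ 2 * KP a r z).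
  { replace (4 * a ^ 2 * z ^ 2 * Delta a r * KT a r z ^ 2 * KP a r z)
      with (4 * (a ^ 2 * z ^ 2 * Delta a r) * (KT a r z ^ 2 * KP a r z)) by ring.
    apply Rmult_le_pos.
    - apply Rmult_le_pos; [lra|now apply Rmult_le_pos].
    - apply Rmult_le_pos; [apply pow2_ge_0|lra]. }
  assert (K3 := Rmult_lt_0_compat _ _ HN K1); lra.
Qed.

Lemma prof_f_at_pole a r : admissible a r -> prof_f a r 1 = 1.
Proof.
  intros A; assert (Hr := ad_r _ _ A).
  assert (HT : 0 < r ^ 2 + a ^ 2) by (generalize (pow_lt r 2 Hr) (pow2_ge_0 a); lra).
  unfold prof_f, KN.
  replace (KP a r 1) with ((r ^ 2 + a ^ 2) ^ 2) by (unfold KP; ring).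
  replace (KT a r 1) with (r ^ 2 + a ^ 2) by (unfold KT; ring).
  rewrite sqrt_pow2 by lra; field; lra.
Qed.

Lemma prof_f_odd a r z : prof_f a r (- z) = - prof_f a r z.
Proof.
  assert (ET : KT a r (- z) = KT a r z) by (unfold KT; ring).
  assert (EP : KP a r (- z) = KP a r z) by (unfold KP; ring).
  unfold prof_f, KN; rewrite ET, EP; unfold Rdiv; ring.
Qed.

Lemma prof_f_lt a r y z : admissible a r -> -1 <= y -> y < z -> z <= 1 ->
  prof_f a r y < prof_f a r z.
Proof.
  intros A Hy Hyz Hz.
  destruct (MVT_cor2 (prof_f a r) (prof_f' a r) y z Hyz) as [c [E Hc]].
  - intros c _; now apply is_derive_Reals, is_derive_prof_f.
  - assert (K := prof_f'_pos a r c A ltac:(lra)).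
    assert (0 < prof_f' a r c * (z - y)) by (apply Rmult_lt_0_compat; lra); lra.
Qed.

(** The origin of [KQ]: it is KT (1 - f^2) divided by 1 - z^2, in a form without the quotient 0 / 0
    at the poles. *)
Lemma prof_unit_KQ a r z : admissible a r ->
  (1 - z ^ 2) * (KQ a r z / KT a r z) + prof_f a r z ^ 2 = 1.
Proof.
  intros A; assert (HP := KP_pos a r z A); assert (HT := KT_pos a r z (ad_r _ _ A)).
  assert (HW : 0 < sqrt (KP a r z)) by now apply sqrt_lt_R0.
  replace (prof_f a r z ^ 2)
    with (z ^ 2 * KN a r z ^ 2 / (KT a r z ^ 4 * sqrt (KP a r z) ^ 2))
    by (unfold prof_f; field; lra).
  rewrite pow2_sqrt by lra.
  unfold KQ; set (T := KT a r z) in *; set (P := KP a r z) in *.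
  transitivity (((1 - z ^ 2) * (r * (r ^ 3 + a ^ 2 * (r - 2) * z ^ 2) * T ^ 2 * P
     - 4 * a ^ 2 * r * (r ^ 2 + a ^ 2) * z ^ 2 * T * P
     - (1 - z ^ 2) * (4 * a ^ 4 * r ^ 2 * (r ^ 2 + a ^ 2) ^ 2 * z ^ 2))
     + z ^ 2 * KN a r z ^ 2) / (T ^ 4 * P)); [field; lra|].
  apply Rmult_eq_reg_r with (T ^ 4 * P);
    [|apply Rmult_integral_contrapositive_currified; [apply pow_nonzero|]; lra].
  unfold Rdiv; rewrite Rmult_assoc, Rinv_l, Rmult_1_r, Rmult_1_l
    by (apply Rmult_integral_contrapositive_currified; [apply pow_nonzero|]; lra).
  unfold T, P, KN, KP, KT, Delta; ring.
Qed.

(* Away from the poles this follows from [|f| < 1], i.e. from positive curvature. *)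
Lemma KQ_pos a r z : admissible a r -> -1 <= z <= 1 -> 0 < KQ a r z.
Proof.
  intros A Hz.
  assert (Hr := ad_r _ _ A).
  assert (HP := KP_pos a r z A); assert (HT := KT_pos a r z Hr).
  destruct (Req_dec (z ^ 2) 1) as [E1|E1].
  - unfold KQ; rewrite E1, Rminus_diag, !Rmult_0_l.
    replace (KT a r z) with (r ^ 2 + a ^ 2) in * by (unfold KT; rewrite E1; ring).
    assert (P := ad_pole _ _ A).
    match goal with |- 0 < ?l => replace l with
      (r * (r ^ 3 + a ^ 2 * r - 6 * a ^ 2) / (r ^ 2 + a ^ 2)) end.
    + apply Rdiv_lt_0_compat; auto; now apply Rmult_lt_0_compat.
    + unfold Rdiv; rewrite Rmult_0_l; field; lra.
  - assert (Hy := one_minus_sqr_nonneg z Hz).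
    assert (Hz' : -1 < z < 1).
    { split; apply Rnot_le_lt; intros K; apply E1.
      - replace z with (-1) by lra; ring.
      - replace z with 1 by lra; ring. }
    assert (F1 := prof_f_lt a r z 1 A ltac:(lra) ltac:(lra) ltac:(lra)).
    assert (F2 := prof_f_lt a r (-1) z A ltac:(lra) ltac:(lra) ltac:(lra)).
    replace (-1) with (- (1)) in F2 by ring.
    rewrite prof_f_odd in F2; rewrite prof_f_at_pole in F1, F2 by auto.
    assert (U := prof_unit_KQ a r z A).
    assert (K : 0 < (1 - z ^ 2) * (KQ a r z / KT a r z)) by nra.
    assert (K' : 0 < KQ a r z / KT a r z).
    { apply Rmult_lt_reg_l with (1 - z ^ 2); lra. }
    replace (KQ a r z) with (KQ a r z / KT a r z * KT a r z) by (field; lra).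
    now apply Rmult_lt_0_compat.
Qed.

(** * Smoothness of the profile *)

Lemma Ck_KT n U a r : open2 U -> Ck n U (fun z _ => KT a r z).
Proof.
  intros HU; apply Ck_plus; auto; [apply Ck_const|].
  apply Ck_mult; auto; [apply Ck_const|].
  apply (Ck_pow n U (fun z _ => z)); auto; apply Ck_fst.
Qed.

Lemma Ck_one_minus_sqr n U : open2 U -> Ck n U (fun z _ => 1 - z ^ 2).
Proof.
  intros HU; apply Ck_minus; auto; [apply Ck_const|].
  apply (Ck_pow n U (fun z _ => z)); auto; apply Ck_fst.
Qed.

Lemma Ck_KP n U a r : open2 U -> Ck n U (fun z _ => KP a r z).
Proof.
  intros HU; apply Ck_minus; auto; [apply Ck_const|].
  apply Ck_mult; auto; [apply Ck_const|now apply Ck_one_minus_sqr].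
Qed.

Lemma Ck_KN n U a r : open2 U -> Ck n U (fun z _ => KN a r z).
Proof.
  intros HU; apply Ck_plus; auto.
  - apply Ck_mult; auto; [now apply Ck_KP|now apply Ck_KT].
  - apply Ck_mult; auto; [apply Ck_const|now apply Ck_one_minus_sqr].
Qed.

Lemma Ck_KQ n U a r : open2 U -> admissible a r -> Ck n U (fun z _ => KQ a r z).
Proof.
  intros HU A.
  assert (HT : forall u v : R, U u v -> KT a r u <> 0)
    by (intros; apply Rgt_not_eq, KT_pos, (ad_r _ _ A)).
  assert (HP : forall u v : R, U u v -> KP a r u <> 0)
    by (intros; apply Rgt_not_eq, KP_pos, A).
  assert (Sz : Ck n U (fun z _ => z ^ 2))
    by (apply (Ck_pow n U (fun z _ => z)); auto; apply Ck_fst).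
  assert (ST := Ck_KT n U a r HU); assert (SP := Ck_KP n U a r HU).
  apply Ck_minus; auto; [apply Ck_minus; auto|].
  - apply Ck_div; auto.
    apply Ck_mult; auto; [apply Ck_const|]; apply Ck_plus; auto; [apply Ck_const|].
    apply Ck_mult; auto; apply Ck_const.
  - apply Ck_div; auto.
    + apply Ck_mult; auto; apply Ck_const.
    + now apply (Ck_pow n U (fun z _ => KT a r z)).
    + intros u v Huv; apply pow_nonzero; eauto.
  - apply Ck_div; auto.
    + apply Ck_mult; auto; [now apply Ck_one_minus_sqr|].
      apply Ck_mult; auto; apply Ck_const.
    + apply Ck_mult; auto; now apply (Ck_pow n U (fun z _ => KT a r z)).
    + intros u v Huv; apply Rmult_integral_contrapositive_currified; eauto.
      apply pow_nonzero; eauto.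
Qed.

Lemma continuous_sqrt_KQ a r z : admissible a r -> continuous (fun t => sqrt (KQ a r t)) z.
Proof.
  intros A; apply (continuous_comp (KQ a r) sqrt); [|apply continuous_sqrt].
  apply (continuity_2d_fst_section (fun z _ => KQ a r z) z 0).
  apply (Ck_cont 0 (fun _ _ => True)); auto; apply Ck_KQ; auto; apply open2_True.
Qed.

Lemma is_derive_prof_zeta a r z : admissible a r ->
  is_derive (prof_zeta a r) z (sqrt (KQ a r z)).
Proof.
  intros A.
  apply (is_derive_RInt (V := R_NormedModule) (fun t => sqrt (KQ a r t)) (prof_zeta a r) 0 z).
  - exists (mkposreal 1 Rlt_0_1); intros y _.
    apply (RInt_correct (V := R_CompleteNormedModule)).
    apply (ex_RInt_continuous (V := R_CompleteNormedModule)); intros t _.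
    now apply continuous_sqrt_KQ.
  - now apply continuous_sqrt_KQ.
Qed.

(** An open neighbourhood of [-1, 1] on which sqrt KQ is smooth, so that the profile is smooth
    across the values z = 1 and z = -1 of the poles. *)
Definition KQ_domain (a r z : R) : Prop := 0 < KQ a r z.

Lemma open_KQ_domain a r : admissible a r -> open (KQ_domain a r).
Proof.
  intros A; apply (open_comp (KQ a r) (fun x => 0 < x)); [|apply open_pos].
  intros x _.
  apply (continuity_2d_fst_section (fun z _ => KQ a r z) x 0).
  apply (Ck_cont 0 (fun _ _ => True)); auto; apply Ck_KQ; auto; apply open2_True.
Qed.

(** By [KP_eq], g^2 = Delta + 2 r (r^2 + a^2) / KT, so z enters only through KT. *)
Lemma is_derive_prof_g a r z : admissible a r ->
  is_derive (prof_g a r) z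
    (- (2 * a ^ 2 * r * (r ^ 2 + a ^ 2) * z) / (KT a r z ^ 2 * prof_g a r z)).
Proof.
  intros A; assert (HP := KP_pos a r z A); assert (HT := KT_pos a r z (ad_r _ _ A)).
  assert (HW : 0 < sqrt (KP a r z)) by now apply sqrt_lt_R0.
  assert (HS : 0 < sqrt (KT a r z)) by now apply sqrt_lt_R0.
  assert (EW : sqrt (KP a r z) ^ 2 = KP a r z) by (apply pow2_sqrt; lra).
  assert (ES : sqrt (KT a r z) ^ 2 = KT a r z) by (apply pow2_sqrt; lra).
  evar_last.
  - apply (is_derive_div (fun z => sqrt (KP a r z)) (fun z => sqrt (KT a r z))).
    + now apply is_derive_sqrt_KP.
    + apply (is_derive_sqrt (KT a r)); [apply is_derive_KT|auto].
    + lra.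
  - unfold prof_g.
    assert (EP : KP a r z - Delta a r * KT a r z = 2 * r * (r ^ 2 + a ^ 2))
      by (rewrite KP_eq; ring).
    set (w := sqrt (KP a r z)) in *; set (s := sqrt (KT a r z)) in *.
    replace (2 * a ^ 2 * r * (r ^ 2 + a ^ 2) * z)
      with (a ^ 2 * z * (2 * r * (r ^ 2 + a ^ 2))) by ring.
    rewrite <- EP, <- EW, <- ES; field; lra.
Qed.

Lemma kerr_profile a r : admissible a r ->
  profile (KQ_domain a r) (prof_g a r) (prof_zeta a r) (prof_nu a r) (prof_f a r)
          (prof_tau a r).
Proof.
  intros A.
  assert (HD := open_KQ_domain a r A).
  assert (HO := open2_open _ HD).
  assert (HP := fun z => KP_pos a r z A); assert (HT := fun z => KT_pos a r z (ad_r _ _ A)).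
  assert (HW : forall z, 0 < sqrt (KP a r z)) by (intros; apply sqrt_lt_R0; auto).
  assert (HS : forall z, 0 < sqrt (KT a r z)) by (intros; apply sqrt_lt_R0; auto).
  assert (HK : forall z, KQ_domain a r z -> 0 < sqrt (KQ a r z))
    by (intros; now apply sqrt_lt_R0).
  assert (SW : forall n, Ck n (fun u _ => KQ_domain a r u) (fun z _ => sqrt (KP a r z))).
  { intros n; apply (Ck_sqrt n _ (fun z _ => KP a r z)); auto; now apply Ck_KP. }
  assert (SS : forall n, Ck n (fun u _ => KQ_domain a r u) (fun z _ => sqrt (KT a r z))).
  { intros n; apply (Ck_sqrt n _ (fun z _ => KT a r z)); auto; now apply Ck_KT. }
  assert (SK : forall n, Ck n (fun u _ => KQ_domain a r u) (fun z _ => sqrt (KQ a r z))).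
  { intros n; apply (Ck_sqrt n _ (fun z _ => KQ a r z)); auto; now apply Ck_KQ. }
  assert (NZ : forall x, 0 < x -> x <> 0) by (intros; lra).
  split; auto.
  - intros z Hz; now apply KQ_pos.
  - intros n; now apply (Ck_div n _ (fun z _ => sqrt (KP a r z))
                           (fun z _ => sqrt (KT a r z))); auto.
  - intros n; apply (Ck_le n (S n)); [lia|].
    apply Ck1_S with (fun z => sqrt (KQ a r z)); auto.
    + intros z _; now apply is_derive_prof_zeta.
    + apply SK.
  - intros n; now apply (Ck_div n _ (fun z _ => sqrt (KQ a r z))
                           (fun z _ => sqrt (KT a r z))); auto.
  - intros n.
    apply (Ck_div n _ (fun z _ => z * KN a r z) (fun z _ => KT a r z ^ 2 * sqrt (KP a r z))); auto.
    + apply (Ck_mult n _ (fun z _ => z)); auto; [apply Ck_fst|now apply Ck_KN].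
    + apply (Ck_mult n _ (fun z _ => KT a r z ^ 2)); auto.
      apply (Ck_pow n _ (fun z _ => KT a r z)); auto; now apply Ck_KT.
    + intros u v _; apply NZ, Rmult_lt_0_compat; auto; now apply pow_lt.
  - intros z _; apply HS.
  - intros z _; apply Rdiv_lt_0_compat; auto.
  - intros z Hz; apply Rdiv_lt_0_compat; auto.
  - intros z _; rewrite (is_derive_unique _ _ _ (is_derive_prof_g a r z A)).
    unfold prof_f, prof_tau, prof_g.
    assert (EW : sqrt (KP a r z) ^ 2 = KP a r z) by (apply pow2_sqrt; generalize (HP z); lra).
    assert (ES : sqrt (KT a r z) ^ 2 = KT a r z) by (apply pow2_sqrt; generalize (HT z); lra).
    unfold KN; generalize (HW z) (HS z); intros W S.
    set (w := sqrt (KP a r z)) in *; set (s := sqrt (KT a r z)) in *.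
    rewrite <- EW, <- ES; field; lra.
  - intros z _; rewrite (is_derive_unique _ _ _ (is_derive_prof_zeta a r z A)).
    unfold prof_nu, prof_tau; field; generalize (HS z); lra.
  - intros z Hz; unfold prof_nu.
    replace ((sqrt (KQ a r z) / sqrt (KT a r z)) ^ 2)
      with (sqrt (KQ a r z) ^ 2 / sqrt (KT a r z) ^ 2) by (field; generalize (HS z); lra).
    rewrite !pow2_sqrt by (left; auto); now apply prof_unit_KQ.
  - intros z Hz; rewrite (is_derive_unique _ _ _ (is_derive_prof_f a r z A)).
    now apply prof_f'_pos.
Qed.

(** * The metric of S(r) in terms of the profile *)

Lemma Sigma_eq a r u : Sigma a r u = prof_tau a r (cos u).
Proof. reflexivity. Qed.

Lemma one_minus_cos_sqr u : 1 - cos u ^ 2 = sin u ^ 2.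
Proof. generalize (sin2_cos2 u); unfold Rsqr; intros; simpl; lra. Qed.

Lemma Sigma_sqr a r u : 0 < r -> Sigma a r u ^ 2 = KT a r (cos u).
Proof.
  intros Hr; rewrite Sigma_eq; unfold prof_tau; apply pow2_sqrt; left; now apply KT_pos.
Qed.

Lemma H_eq_div a r u : 0 < r -> H a r u = sin u ^ 2 * KP a r (cos u) / KT a r (cos u).
Proof.
  intros Hr; unfold H; rewrite Sigma_sqr by auto.
  unfold KP; rewrite one_minus_cos_sqr; reflexivity.
Qed.

Lemma H_eq a r u : admissible a r -> H a r u = (sin u * prof_g a r (cos u)) ^ 2.
Proof.
  intros A; assert (Hr := ad_r _ _ A).
  assert (HP := KP_pos a r (cos u) A); assert (HT := KT_pos a r (cos u) Hr).
  rewrite H_eq_div by auto; unfold prof_g.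
  assert (HS : 0 < sqrt (KT a r (cos u))) by now apply sqrt_lt_R0.
  replace ((sin u * (sqrt (KP a r (cos u)) / sqrt (KT a r (cos u)))) ^ 2)
    with (sin u ^ 2 * sqrt (KP a r (cos u)) ^ 2 / sqrt (KT a r (cos u)) ^ 2)
    by (field; lra).
  rewrite !pow2_sqrt by lra; reflexivity.
Qed.

Lemma kerr_polar_metric a r : admissible a r ->
  polar_metric (Sigma a r) (fun u => prof_g a r (cos u)).
Proof.
  intros A.
  assert (HP := fun z => KP_pos a r z A); assert (HT := fun z => KT_pos a r z (ad_r _ _ A)).
  assert (S1 : Ck 1 (fun _ _ => True) (fun u _ => Sigma a r u)).
  { apply (Ck_sqrt 1 _ (fun u _ => KT a r (cos u))); auto; [apply open2_True|].
    apply (Ck_comp 1 _ (fun _ _ => True) (fun z _ => KT a r z) (fun u _ => cos u) (fun _ _ => 0));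
      auto using open2_True, Ck_KT, Ck_cos_fst, Ck_const. }
  assert (S2 : Ck 1 (fun _ _ => True) (fun u _ => prof_g a r (cos u))).
  { apply (Ck_div 1 _ (fun u _ => sqrt (KP a r (cos u))) (fun u _ => Sigma a r u)); auto.
    - apply open2_True.
    - apply (Ck_sqrt 1 _ (fun u _ => KP a r (cos u))); auto; [apply open2_True|].
      apply (Ck_comp 1 _ (fun _ _ => True) (fun z _ => KP a r z) (fun u _ => cos u) (fun _ _ => 0));
        auto using open2_True, Ck_KP, Ck_cos_fst, Ck_const.
    - intros u v _; apply Rgt_not_eq, sqrt_lt_R0, HT. }
  split.
  - intros u _; apply sqrt_lt_R0, HT.
  - intros u _; apply Rdiv_lt_0_compat; apply sqrt_lt_R0; auto.
  - intros u _; exact (is_derive_continuity_pt _ u _ (Ck_is_D1 0 _ _ u 0 S1 I)).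
  - intros u _; exact (is_derive_continuity_pt _ u _ (Ck_is_D1 0 _ _ u 0 S2 I)).
  - now apply (Ck_sub 1 _ (fun _ _ => True)).
  - now apply (Ck_sub 1 _ (fun _ _ => True)).
Qed.

Lemma kerr_isometric_embedding a r : admissible a r ->
  isometric_embedding a r (revolve (prof_g a r) (prof_zeta a r))
                          (revolve (prof_nu a r) (prof_f a r)).
Proof.
  intros A; apply (revolve_isometric_embedding a r _ _ _ _ _ _ (kerr_profile a r A)).
  - reflexivity.
  - intros u _; now apply H_eq.
Qed.

(** * Comparison with the quasilocal energy *)

(** The principal curvatures are f' / (tau nu) along the meridian and nu / g along the parallel; the
    area density is sin tau g. *)
Lemma revolve_mean_density D g zeta nu f tau e : profile D g zeta nu f tau ->
  (forall u, e u = tau (cos u)) ->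
  closed_surface e (fun u => g (cos u)) (in_chart sph_z (revolve g zeta))
                 (in_chart sph_z (revolve nu f)) ->
  forall u v, interior_strip u v ->
  mean_density e (fun u => g (cos u)) (in_chart sph_z (revolve g zeta))
               (in_chart sph_z (revolve nu f)) u v =
  sin u * (tau (cos u) * nu (cos u) + g (cos u) * Derive f (cos u) / nu (cos u)).
Proof.
  intros P He S u v Huv.
  assert (HD : D (cos u)) by (apply (pr_dom _ _ _ _ _ _ P), COS_bound).
  assert (Hs : 0 < sin u) by (apply sin_gt_0; apply Huv).
  assert (Hnu := pr_nu_pos _ _ _ _ _ _ P _ HD); assert (Hg := pr_g_pos _ _ _ _ _ _ P _ HD).
  assert (Htau := pr_tau_pos _ _ _ _ _ _ P _ HD).
  destruct (revolve_in_chart _ _ _ _ _ _ sph_z P sphere_chart_sph_z u v Huv)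
    as [X1 [X2 [N1 [N2 _]]]].
  destruct (immersion_normal_derivatives _ _ _ _ (cs_immersion _ _ _ _ S) u v Huv)
    as [_ [_ [E11 [_ [_ E22]]]]].
  destruct (polar_second_form_interior _ _ _ _ S u v Huv) as [_ K22].
  set (Y := in_chart sph_z (revolve g zeta)) in *.
  set (n := in_chart sph_z (revolve nu f)) in *.
  rewrite X1, N1, d1_sph_z in E11; rewrite X2, N2, d2_sph_z in E22.
  generalize (sin2_cos2 u) (sin2_cos2 v); unfold Rsqr; intros Su Sv.
  assert (U := pr_unit _ _ _ _ _ _ P _ HD).
  assert (V := profile_unit_derive _ _ _ _ _ _ P _ HD).
  assert (K := pr_meridian _ _ _ _ _ _ P _ HD); assert (L := pr_height _ _ _ _ _ _ P _ HD).
  replace (1 - cos u ^ 2) with (sin u * sin u) in K, U, V by (simpl; lra).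
  assert (H11 : h11 Y n u v = tau (cos u) * Derive f (cos u) / nu (cos u)).
  { rewrite E11; unfold dot, revolve_diff, sph_z, vx, vy, vz; simpl; rewrite L.
    (* After multiplication by nu, the derivative of nu occurs only in the combination that
       [profile_unit_derive] evaluates. *)
    apply Rmult_eq_reg_l with (nu (cos u)); [|lra].
    match goal with |- ?l = _ => replace l with
      ((nu (cos u) * (cos u * nu (cos u) - sin u * sin u * Derive nu (cos u)))
       * (cos u * g (cos u) - sin u * sin u * Derive g (cos u))
       * (sin v * sin v + cos v * cos v)
       + sin u * sin u * nu (cos u) ^ 2 * tau (cos u) * Derive f (cos u)) by ring end.
    rewrite V, <- K, Sv.
    transitivity ((sin u * sin u * nu (cos u) ^ 2 + f (cos u) ^ 2)
                  * (tau (cos u) * Derive f (cos u))); [ring|].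
    rewrite U; field; lra. }
  assert (H22 : h22 Y n u v = sin u ^ 2 * (nu (cos u) * g (cos u))).
  { rewrite E22; unfold dot, revolve_diff, sph_z, vx, vy, vz; simpl.
    match goal with |- ?l = _ => replace l with
      (sin u ^ 2 * (nu (cos u) * g (cos u)) * (sin v * sin v + cos v * cos v)) by ring end.
    rewrite Sv; ring. }
  assert (E : k22 Y n u v = nu (cos u) * g (cos u)).
  { apply Rmult_eq_reg_l with (sin u ^ 2); [lra|apply pow_nonzero; lra]. }
  unfold mean_density; rewrite H11, E, He; field; lra.
Qed.

(** * Mean curvature of S(r) in the slice *)

Definition KPr (a r z : R) : R :=
  4 * r * (r ^ 2 + a ^ 2) - (2 * r - 2) * a ^ 2 * (1 - z ^ 2).

Lemma Sigma_sqr_all a r u : Sigma a r u ^ 2 = r ^ 2 + a ^ 2 * cos u ^ 2.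
Proof.
  unfold Sigma; apply pow2_sqrt.
  generalize (pow2_ge_0 r) (Rmult_le_pos _ _ (pow2_ge_0 a) (pow2_ge_0 (cos u))); lra.
Qed.

Lemma is_derive_KT_r a r z : is_derive (fun s => KT a s z) r (2 * r).
Proof. unfold KT; auto_derive; auto; ring. Qed.

Lemma is_derive_KP_r a r z : is_derive (fun s => KP a s z) r (KPr a r z).
Proof. unfold KP, KPr, Delta; auto_derive; auto; ring. Qed.

Lemma Derive_Sigma_sqr_r a r u : Derive (fun s => Sigma a s u ^ 2) r = 2 * r.
Proof.
  rewrite (Derive_ext _ (fun s => KT a s (cos u))).
  - apply is_derive_unique, is_derive_KT_r.
  - intros s; apply Sigma_sqr_all.
Qed.

Lemma H_eq_div_all a r u : H a r u = sin u ^ 2 * KP a r (cos u) / KT a r (cos u).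
Proof.
  unfold H; rewrite Sigma_sqr_all; unfold KP; rewrite one_minus_cos_sqr; reflexivity.
Qed.

Lemma Derive_H_r a r u : 0 < r -> Derive (fun s => H a s u) r =
  sin u ^ 2 * (KPr a r (cos u) * KT a r (cos u) - KP a r (cos u) * (2 * r))
  / KT a r (cos u) ^ 2.
Proof.
  intros Hr; assert (HT := KT_pos a r (cos u) Hr).
  rewrite (Derive_ext _ (fun s => sin u ^ 2 * KP a s (cos u) / KT a s (cos u)))
    by (intros; apply H_eq_div_all).
  apply is_derive_unique; evar_last.
  - apply (is_derive_div (fun s => sin u ^ 2 * KP a s (cos u)) (fun s => KT a s (cos u))).
    + apply is_derive_Rmult; [apply is_derive_Rconst|apply is_derive_KP_r].
    + apply is_derive_KT_r.
    + lra.
  - cbv beta; field; lra.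
Qed.

Lemma Derive_H_Sigma_r a r u : 0 < r ->
  Derive (fun s => H a s u * Sigma a s u ^ 2) r = sin u ^ 2 * KPr a r (cos u).
Proof.
  intros Hr; apply is_derive_unique.
  apply (is_derive_ext_loc (fun s => sin u ^ 2 * KP a s (cos u))).
  - exists (mkposreal r Hr); intros s Hs.
    assert (H0 : 0 < s).
    { change (Rabs (s - r) < r) in Hs; apply Rabs_def2 in Hs; lra. }
    assert (HT := KT_pos a s (cos u) H0).
    change (sin u ^ 2 * KP a s (cos u) = H a s u * Sigma a s u ^ 2).
    rewrite H_eq_div_all, Sigma_sqr by auto; field; lra.
  - evar_last; [apply is_derive_Rmult; [apply is_derive_Rconst|apply is_derive_KP_r]|].
    simpl; ring.
Qed.

Lemma RR_eq a r u : 0 < r -> 0 < Delta a r -> RR a r u = Sigma a r u / sqrt (Delta a r).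
Proof.
  intros Hr HD; unfold RR.
  rewrite sqrt_div_alt by auto.
  rewrite sqrt_pow2; auto; apply sqrt_pos.
Qed.

Lemma partial_off_diagonal a i j k p : j <> k -> partial i (slice_metric a j k) p = 0.
Proof.
  intros Hjk; destruct j, k; try congruence; exact (Derive_const 0 (p i)).
Qed.

(** The metric is diagonal and nu has only a radial component, so in tangential directions the
    derivative of nu drops out and half the normal derivative of the metric remains. *)
Lemma slice_second_form a r u v i j : i <> crad -> j <> crad ->
  let p := slice_point r u v in
  second_form (slice_metric a) (slice_normal a) i j p
  = / RR a r u * partial crad (slice_metric a i j) p / 2.
Proof.
  intros Hi Hj p; unfold second_form, sum_coord, christoffel.
  rewrite (partial_off_diagonal a i crad j p), (partial_off_diagonal a j i crad p) by congruence.
  replace (slice_metric a crad j p) with 0 by (destruct j; [reflexivity|congruence|reflexivity]).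
  change (slice_normal a cphi) with (fun _ : point => 0).
  change (slice_normal a ctheta) with (fun _ : point => 0).
  change (slice_normal a crad p) with (/ RR a r u); cbv beta.
  replace (partial i (fun _ : point => 0) p) with 0 by exact (eq_sym (Derive_const 0 (p i))).
  unfold Rdiv; ring.
Qed.

(** kappa = (log (Sigma^2 H))_r / (2 R), and Sigma^2 H = sin^2 KP, so only the logarithmic
    derivative of KP is left. *)
Lemma kappa_eq a u v r : admissible a r -> 0 < Delta a r -> 0 < u < PI ->
  kappa a u v r = KPr a r (cos u) * sqrt (Delta a r) / (2 * KP a r (cos u) * Sigma a r u).
Proof.
  intros A HD Hu; assert (Hr := ad_r _ _ A).
  assert (HP := KP_pos a r (cos u) A); assert (HT := KT_pos a r (cos u) Hr).
  assert (Hs : 0 < sin u) by (apply sin_gt_0; apply Hu).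
  assert (HS : 0 < Sigma a r u) by now apply sqrt_lt_R0.
  assert (HW : 0 < sqrt (Delta a r)) by now apply sqrt_lt_R0.
  unfold kappa, mean_curvature.
  rewrite !slice_second_form by discriminate.
  replace (partial crad (slice_metric a ctheta ctheta) (slice_point r u v)) with (2 * r)
    by exact (eq_sym (Derive_Sigma_sqr_r a r u)).
  replace (partial crad (slice_metric a cphi cphi) (slice_point r u v))
    with (sin u ^ 2 * (KPr a r (cos u) * KT a r (cos u) - KP a r (cos u) * (2 * r))
          / KT a r (cos u) ^ 2)
    by exact (eq_sym (Derive_H_r a r u Hr)).
  change (slice_metric a ctheta ctheta (slice_point r u v)) with (Sigma a r u ^ 2).
  change (slice_metric a cphi cphi (slice_point r u v)) with (H a r u).
  change (slice_metric a ctheta cphi (slice_point r u v)) with 0.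
  rewrite H_eq_div, RR_eq by auto.
  rewrite <- (Sigma_sqr a r u Hr) in *.
  field; lra.
Qed.

(** kappa times the area density sin sqrt KP. With sqrt Delta in the numerator instead of 1 / R, it
    keeps its meaning on the horizon, where it is 0. *)
Definition kappa_density (a r u : R) : R :=
  sin u * KPr a r (cos u) * sqrt (Delta a r) / (2 * sqrt (KP a r (cos u)) * Sigma a r u).

Lemma sqrt_H a r u : admissible a r -> 0 < u < PI ->
  sqrt (H a r u) = sin u * prof_g a r (cos u).
Proof.
  intros A Hu; rewrite H_eq by auto; apply sqrt_pow2.
  apply Rmult_le_pos; [apply sin_ge_0; lra|].
  left; apply (pm_g_pos _ _ (kerr_polar_metric a r A) u); lra.
Qed.

(** * The energy integrand at x = y = 0 *)

Definition reference_density (a r u : R) : R :=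
  sin u * (prof_tau a r (cos u) * prof_nu a r (cos u)
           + prof_g a r (cos u) * prof_f' a r (cos u) / prof_nu a r (cos u)).

Lemma is_derive_meridian_radius a r t : admissible a r ->
  is_derive (fun t => sin t * prof_g a r (cos t)) t (prof_f a r (cos t) * Sigma a r t).
Proof.
  intros A.
  assert (P := kerr_profile a r A).
  assert (HD := pr_dom _ _ _ _ _ _ P _ (COS_bound t)).
  destruct (profile_is_derive _ _ _ _ _ _ P _ HD) as [Dg _].
  assert (B : is_derive (fun x => prof_g a r (cos x)) t (- sin t * Derive (prof_g a r) (cos t)))
    by exact (is_derive_comp (V := R_NormedModule) (prof_g a r) cos t _ _ Dg (is_derive_cos t)).
  evar_last; [apply is_derive_Rmult; [apply is_derive_sin|exact B]|].
  rewrite Sigma_eq, (pr_meridian _ _ _ _ _ _ P _ HD), one_minus_cos_sqr; simpl; ring.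
Qed.

Lemma H_th_eq a r t : admissible a r ->
  H_th a r t = 2 * (sin t * prof_g a r (cos t) * (prof_f a r (cos t) * Sigma a r t)).
Proof.
  intros A; unfold H_th.
  rewrite (Derive_ext _ (fun t => (sin t * prof_g a r (cos t)) ^ 2))
    by (intros; now apply H_eq).
  apply (Derive_square (fun t => sin t * prof_g a r (cos t))).
  now apply is_derive_meridian_radius.
Qed.

(** With H_theta = 2 sqrt H f Sigma, the terms containing Sigma_theta cancel: this explains the
    combination that occurs in C. *)
Lemma H_thth_eq a r u : admissible a r -> 0 < u < PI ->
  H_thth a r u * Sigma a r u - H_th a r u * Sigma_th a r u =
  2 * Sigma a r u ^ 2 * (prof_f a r (cos u) ^ 2 * Sigma a r u
    - sin u * prof_g a r (cos u) * (sin u * prof_f' a r (cos u))).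
Proof.
  intros A Hu; rewrite H_th_eq by auto; unfold H_thth.
  rewrite (Derive_ext _ (fun t => 2 * (sin t * prof_g a r (cos t)
                                       * (prof_f a r (cos t) * Sigma a r t))))
    by (intros; now apply H_th_eq).
  assert (DS : is_derive (Sigma a r) u (Sigma_th a r u))
    by exact (Ck_is_D1 0 _ _ u 0 (pm_e_smooth _ _ (kerr_polar_metric a r A)) Hu).
  assert (Df : is_derive (fun x => prof_f a r (cos x)) u (- sin u * prof_f' a r (cos u))).
  { exact (is_derive_comp (V := R_NormedModule) (prof_f a r) cos u _ _
             (is_derive_prof_f a r (cos u) A) (is_derive_cos u)). }
  assert (D : is_derive (fun t => 2 * (sin t * prof_g a r (cos t)
                                       * (prof_f a r (cos t) * Sigma a r t))) u
    (0 * (sin u * prof_g a r (cos u) * (prof_f a r (cos u) * Sigma a r u))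
     + 2 * (prof_f a r (cos u) * Sigma a r u * (prof_f a r (cos u) * Sigma a r u)
            + sin u * prof_g a r (cos u)
              * (- sin u * prof_f' a r (cos u) * Sigma a r u
                 + prof_f a r (cos u) * Sigma_th a r u)))).
  { apply (is_derive_Rmult (fun _ => 2)
             (fun t => sin t * prof_g a r (cos t) * (prof_f a r (cos t) * Sigma a r t)));
      [apply is_derive_Rconst|].
    apply (is_derive_Rmult (fun t => sin t * prof_g a r (cos t))
             (fun t => prof_f a r (cos t) * Sigma a r t)).
    - now apply is_derive_meridian_radius.
    - now apply (is_derive_Rmult (fun t => prof_f a r (cos t)) (Sigma a r)). }
  match type of D with is_derive ?f _ ?l =>
    match goal with |- context [Derive ?f' u] =>
      replace (Derive f' u) with l by exact (eq_sym (is_derive_unique f u l D)) end end.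
  ring.
Qed.

(** The radicand of beta is 4 H Sigma^2 (1 - f^2), a perfect square by [pr_unit], and alpha / ell =
    R / Sigma. The A-term gives the slice density; the C-term gives the reference density with a
    minus sign. *)
Lemma energy_integrand_eq a r u : admissible a r -> 0 < Delta a r -> 0 < u < PI ->
  energy_integrand a u 0 0 r
  = / (8 * PI) * (kappa_density a r u - reference_density a r u).
Proof.
  intros A HD Hu; assert (Hr := ad_r _ _ A).
  assert (HP := KP_pos a r (cos u) A); assert (HT := KT_pos a r (cos u) Hr).
  assert (Hs : 0 < sin u) by (apply sin_gt_0; apply Hu).
  assert (HS : 0 < Sigma a r u) by now apply sqrt_lt_R0.
  assert (HW : 0 < sqrt (Delta a r)) by now apply sqrt_lt_R0.
  assert (P := kerr_profile a r A).
  assert (HDm := pr_dom _ _ _ _ _ _ P _ (COS_bound u)).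
  assert (Hg := pr_g_pos _ _ _ _ _ _ P _ HDm); assert (Hnu := pr_nu_pos _ _ _ _ _ _ P _ HDm).
  assert (U := pr_unit _ _ _ _ _ _ P _ HDm); rewrite one_minus_cos_sqr in U.
  assert (HPi := PI_RGT_0).
  assert (Hb : beta a r u 0
    = 2 * (sin u * prof_g a r (cos u)) * (Sigma a r u * (sin u * prof_nu a r (cos u)))).
  { unfold beta; rewrite H_th_eq, H_eq by auto.
    rewrite <- (sqrt_pow2 (2 * (sin u * prof_g a r (cos u))
                           * (Sigma a r u * (sin u * prof_nu a r (cos u))))).
    - f_equal.
      transitivity (4 * (sin u * prof_g a r (cos u)) ^ 2 * Sigma a r u ^ 2
                    * (1 - prof_f a r (cos u) ^ 2)); [ring|].
      rewrite <- U; ring.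
    - assert (B1 := Rmult_lt_0_compat _ _ Hs Hg); assert (B2 := Rmult_lt_0_compat _ _ Hs Hnu).
      assert (B3 := Rmult_lt_0_compat _ _ HS B2).
      apply Rmult_le_pos; lra. }
  assert (Ha : alpha a r u 0 0 = RR a r u * Sigma a r u).
  { unfold alpha.
    replace (0 ^ 2 * Sigma a r u ^ 2 + RR a r u ^ 2 * (0 ^ 2 + Sigma a r u ^ 2))
      with ((RR a r u * Sigma a r u) ^ 2) by ring.
    apply sqrt_pow2, Rmult_le_pos; [apply sqrt_pos|lra]. }
  unfold energy_integrand; rewrite Hb, Ha.
  unfold ell, coefA, coefC, coefD, kappa_density, reference_density.
  rewrite H_thth_eq, Derive_H_Sigma_r, sqrt_H, H_eq, RR_eq by auto.
  replace (prof_f a r (cos u) ^ 2) with (1 - sin u ^ 2 * prof_nu a r (cos u) ^ 2) by lra.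
  rewrite <- Sigma_eq.
  assert (Eg : prof_g a r (cos u) = sqrt (KP a r (cos u)) / Sigma a r u) by reflexivity.
  assert (HPs : 0 < sqrt (KP a r (cos u))) by now apply sqrt_lt_R0.
  rewrite Eg; field; repeat split; lra.
Qed.

(** * Limits at the horizon *)

(** Delta is nondecreasing for r >= 1, so a limit from the right stays among admissible radii. *)
Lemma admissible_ge a r s : admissible a r -> 1 <= r -> r <= s -> admissible a s.
Proof.
  intros [Hr HD He Hp] H1 Hs; unfold Delta in *.
  split; [lra| | |].
  - unfold Delta; nra.
  - nra.
  - assert (r ^ 3 <= s ^ 3) by (apply pow_incr; lra).
    generalize (Rmult_le_pos (a ^ 2) (s - r) (pow2_ge_0 a) ltac:(lra)); lra.
Qed.

(** [F] is a closed formula for [f] where Delta > 0 that stays continuous where Delta = 0;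
    uniqueness of limits then identifies the right limit with its value. *)
Lemma horizon_ext_eq a r (f F : R -> R) : admissible a r -> 1 <= r ->
  (forall s, admissible a s -> 0 < Delta a s -> f s = F s) -> continuous F r ->
  horizon_ext a f r = F r.
Proof.
  intros A H1 Hf HF; unfold horizon_ext.
  assert (HD := ad_Delta _ _ A).
  destruct (Req_EM_T (Delta a r) 0) as [E|E]; [|apply Hf; auto; lra].
  unfold right_limit.
  apply (iota_filterlim_locally (V := R_CompleteNormedModule) (F := at_right r)).
  apply (filterlim_ext_loc F).
  - exists (mkposreal 1 Rlt_0_1); intros s _ Hs; symmetry; apply Hf.
    + apply (admissible_ge a r s); auto; lra.
    (* As Delta vanishes at r, its value at s is (s - r) (s + r - 2), which is positive for s > r >=
       1. *)
    + unfold Delta in *; nra.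
  - eapply filterlim_filter_le_1; [|exact HF]; apply filter_le_within.
Qed.

Lemma continuous_Rmult (f g : R -> R) x : continuous f x -> continuous g x ->
  continuous (fun t => f t * g t) x.
Proof. intros Hf Hg; exact (continuous_mult f g x Hf Hg). Qed.

Lemma continuous_Rplus (f g : R -> R) x : continuous f x -> continuous g x ->
  continuous (fun t => f t + g t) x.
Proof. intros Hf Hg; exact (continuous_plus (V := R_NormedModule) f g x Hf Hg). Qed.

Lemma continuous_Rminus (f g : R -> R) x : continuous f x -> continuous g x ->
  continuous (fun t => f t - g t) x.
Proof. intros Hf Hg; exact (continuous_minus (V := R_NormedModule) f g x Hf Hg). Qed.

Lemma continuous_Rdiv (f g : R -> R) x : continuous f x -> continuous g x -> g x <> 0 ->
  continuous (fun t => f t / g t) x.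
Proof.
  intros Hf Hg H0; apply continuous_Rmult; auto; now apply continuous_Rinv_comp.
Qed.

Lemma continuous_Rsqrt (f : R -> R) x : continuous f x -> continuous (fun t => sqrt (f t)) x.
Proof. intros Hf; apply (continuous_comp f sqrt); [auto|apply continuous_sqrt]. Qed.

Lemma continuous_Rpow (f : R -> R) x n : continuous f x -> continuous (fun t => f t ^ n) x.
Proof.
  intros Hf; induction n as [|n IH]; [apply continuous_const|].
  now apply (continuous_Rmult f (fun t => f t ^ n)).
Qed.

Lemma continuous_Rconst (c x : R) : continuous (fun _ : R => c) x.
Proof. apply continuous_const. Qed.

Lemma continuous_Rid (x : R) : continuous (fun t : R => t) x.
Proof. apply continuous_id. Qed.

Ltac solve_continuous :=
  lazymatch goal with
  | |- continuous (fun _ => ?c) _ => apply continuous_Rconst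
  | |- continuous (fun t => t) _ => apply continuous_Rid
  | |- continuous (fun t => @?f t - @?g t) ?x =>
      apply (continuous_Rminus f g x); solve_continuous
  | |- continuous (fun t => @?f t + @?g t) ?x =>
      apply (continuous_Rplus f g x); solve_continuous
  | |- continuous (fun t => @?f t * @?g t) ?x =>
      apply (continuous_Rmult f g x); solve_continuous
  | |- continuous (fun t => @?f t / @?g t) ?x =>
      apply (continuous_Rdiv f g x); [solve_continuous|solve_continuous|]
  | |- continuous (fun t => @?f t ^ ?n) ?x =>
      apply (continuous_Rpow f x n); solve_continuous
  | |- continuous (fun t => sqrt (@?f t)) ?x =>
      apply (continuous_Rsqrt f x); solve_continuous
  | |- continuous _ _ => assumption
  end.

Lemma continuous_KT_r a r z : continuous (fun s => KT a s z) r.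
Proof. unfold KT; solve_continuous. Qed.

Lemma continuous_Delta a r : continuous (fun s => Delta a s) r.
Proof. unfold Delta; solve_continuous. Qed.

Lemma continuous_KP_r a r z : continuous (fun s => KP a s z) r.
Proof. assert (C := continuous_Delta a r); unfold KP; solve_continuous. Qed.

Lemma densities_continuous_r a r u : admissible a r ->
  continuous (fun s => kappa_density a s u) r /\
  continuous (fun s => reference_density a s u) r.
Proof.
  intros A; set (z := cos u).
  assert (HP := KP_pos a r z A); assert (HT := KT_pos a r z (ad_r _ _ A)).
  assert (CT := continuous_KT_r a r z); assert (CP := continuous_KP_r a r z).
  assert (CD := continuous_Delta a r).
  assert (HWp : 0 < sqrt (KP a r z)) by now apply sqrt_lt_R0.
  assert (HWt : 0 < sqrt (KT a r z)) by now apply sqrt_lt_R0.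
  assert (NZ : forall x, 0 < x -> x <> 0) by (intros; lra).
  split.
  - unfold kappa_density, KPr; fold z.
    change (fun s => Sigma a s u) with (fun s => sqrt (KT a s z)).
    apply (continuous_ext (fun s => sin u * (4 * s * (s ^ 2 + a ^ 2)
       - (2 * s - 2) * a ^ 2 * (1 - z ^ 2)) * sqrt (Delta a s)
       / (2 * sqrt (KP a s z) * sqrt (KT a s z)))); [reflexivity|].
    solve_continuous; apply NZ; repeat apply Rmult_lt_0_compat; auto; lra.
  - assert (CN : continuous (fun s => KN a s z) r) by (unfold KN; solve_continuous).
    assert (CQ : continuous (fun s => KQ a s z) r).
    { unfold KQ; solve_continuous; apply NZ; auto.
      - now apply pow_lt.
      - apply Rmult_lt_0_compat; auto; now apply pow_lt. }
    assert (Hz : -1 <= z <= 1) by apply COS_bound.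
    assert (HQ : 0 < sqrt (KQ a r z)) by (apply sqrt_lt_R0; now apply KQ_pos).
    unfold reference_density, prof_tau, prof_nu, prof_g, prof_f'; fold z.
    solve_continuous; apply NZ; auto.
    + apply Rmult_lt_0_compat; auto; apply Rmult_lt_0_compat; auto; now apply pow_lt.
    + now apply Rdiv_lt_0_compat.
Qed.

Lemma cont_polar_kappa_density a r : admissible a r ->
  cont_polar (fun u _ => kappa_density a r u).
Proof.
  intros A.
  apply cont_polar_fst; intros u _; apply continuity_pt_filterlim.
  change (continuous (kappa_density a r) u).
  assert (Cc : continuous cos u) by apply continuous_cos.
  assert (Cs : continuous sin u) by apply continuous_sin.
  assert (HP := KP_pos a r (cos u) A); assert (HT := KT_pos a r (cos u) (ad_r _ _ A)).
  assert (HWp : 0 < sqrt (KP a r (cos u))) by now apply sqrt_lt_R0.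
  assert (HWt : 0 < sqrt (KT a r (cos u))) by now apply sqrt_lt_R0.
  unfold kappa_density, KPr, Sigma.
  apply (continuous_ext (fun x => sin x * (4 * r * (r ^ 2 + a ^ 2)
       - (2 * r - 2) * a ^ 2 * (1 - cos x ^ 2)) * sqrt (Delta a r)
       / (2 * sqrt ((r ^ 2 + a ^ 2) ^ 2 - Delta a r * a ^ 2 * (1 - cos x ^ 2))
          * sqrt (r ^ 2 + a ^ 2 * cos x ^ 2)))); [reflexivity|].
  solve_continuous.
  apply Rgt_not_eq; repeat apply Rmult_lt_0_compat; auto; lra.
Qed.

Lemma kappa_density_eq a r u v : admissible a r -> 1 <= r -> 0 < u < PI ->
  horizon_ext a (kappa a u v) r * sqrt (Sigma a r u ^ 2 * H a r u) = kappa_density a r u.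
Proof.
  intros A H1 Hu.
  assert (HP := KP_pos a r (cos u) A); assert (HT := KT_pos a r (cos u) (ad_r _ _ A)).
  assert (HS : 0 < Sigma a r u) by now apply sqrt_lt_R0.
  assert (HW : 0 < sqrt (KP a r (cos u))) by now apply sqrt_lt_R0.
  assert (EW : sqrt (KP a r (cos u)) ^ 2 = KP a r (cos u)) by (apply pow2_sqrt; lra).
  rewrite (horizon_ext_eq a r _ (fun s =>
    KPr a s (cos u) * sqrt (Delta a s) / (2 * KP a s (cos u) * Sigma a s u)) A H1).
  - rewrite sqrt_mult_alt by apply pow2_ge_0.
    rewrite sqrt_H, sqrt_pow2 by (auto; lra).
    change (prof_g a r (cos u)) with (sqrt (KP a r (cos u)) / Sigma a r u).
    unfold kappa_density; rewrite <- EW at 1; field; lra.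
  - intros s As Ds; now apply kappa_eq.
  - assert (CT := continuous_KT_r a r (cos u)); assert (CP := continuous_KP_r a r (cos u)).
    assert (CD := continuous_Delta a r).
    apply (continuous_ext (fun s => (4 * s * (s ^ 2 + a ^ 2)
       - (2 * s - 2) * a ^ 2 * (1 - cos u ^ 2)) * sqrt (Delta a s)
       / (2 * KP a s (cos u) * sqrt (KT a s (cos u))))); [reflexivity|].
    solve_continuous.
    apply Rgt_not_eq; repeat apply Rmult_lt_0_compat; auto; lra.
Qed.

(** * Equality of the two energies *)

(** Any embedding may be exchanged for the explicit surface of revolution, and for that one the two
    integrands agree pointwise between the poles. *)
Lemma brown_york_energy a r : admissible a r -> 1 <= r ->
  is_brown_york a r (energy a r (fun _ => 0) (fun _ => 0)).
Proof.
  intros A H1.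
  assert (M := kerr_polar_metric a r A).
  assert (HH : forall u, 0 < u < PI -> H a r u = (sin u * prof_g a r (cos u)) ^ 2)
    by (intros; now apply H_eq).
  assert (E0 := kerr_isometric_embedding a r A).
  assert (Ck := cont_polar_kappa_density a r A).
  assert (Hk : forall u v, interior_strip u v ->
    horizon_ext a (kappa a u v) r * sqrt (Sigma a r u ^ 2 * H a r u) = kappa_density a r u)
    by (intros; now apply kappa_density_eq).
  split; [eauto|].
  intros X N E.
  rewrite (brown_york_of_unique a r _ X N _ _ _ M HH E E0 Ck Hk).
  rewrite (brown_york_of_mean_density a r _ _ _ _ M HH E0 Ck Hk).
  assert (S := embedding_closed_surface a r _ _ _ M HH E0).
  assert (Cm := mean_density_cont _ _ _ _ M S).
  rewrite <- polar_integral_minus by auto.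
  rewrite <- polar_integral_scal by now apply cont_polar_minus.
  unfold energy.
  transitivity (- polar_integral (fun u v => (-1) * (/ (8 * PI) *
    (mean_density (Sigma a r) (fun u => prof_g a r (cos u))
       (in_chart sph_z (revolve (prof_g a r) (prof_zeta a r)))
       (in_chart sph_z (revolve (prof_nu a r) (prof_f a r))) u v - kappa_density a r u)))).
  - rewrite (polar_integral_scal (-1)); [ring|].
    apply (cont_polar_mult (fun _ _ => / (8 * PI))); [apply cont_polar_const|].
    now apply cont_polar_minus.
  - apply f_equal.
    apply (polar_integral_ext _ (fun theta _ => horizon_ext a (energy_integrand a theta 0 0) r)).
    intros u v Huv.
    rewrite (horizon_ext_eq a r _ (fun s =>
      / (8 * PI) * (kappa_density a s u - reference_density a s u)) A H1).
    + rewrite (revolve_mean_density _ _ _ _ _ _ _ (kerr_profile a r A)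
                 (fun u => Sigma_eq a r u) S u v Huv).
      rewrite (is_derive_unique _ _ _ (is_derive_prof_f a r (cos u) A)).
      unfold reference_density; ring.
    + intros s As Ds; now apply energy_integrand_eq.
    + destruct (densities_continuous_r a r u A) as [C1 C2].
      solve_continuous.
Qed.

Theorem corollary3p2 :
  exists eps0 : R, 0 < eps0 /\
    forall a r : R,
      0 <= a <= 1 ->
      (2 <= r \/ (r_plus a <= r /\ a / r <= eps0)) ->
      is_brown_york a r (energy a r (fun _ => 0) (fun _ => 0)).
Proof.
  (* With a <= r / 3 and r >= 1 one has 6 a^2 <= (2 / 3) r^2 < r^3, which gives [ad_pole]; [ad_eps]
     is immediate. *)
  exists (/ 3); split; [lra|].
  intros a r Ha Hr.
  assert (Ha2 : 0 <= a ^ 2 <= 1) by (simpl; nra).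
  destruct Hr as [Hr|[Hr He]].
  (* For r >= 2 and a <= 1: Delta = r (r - 2) + a^2 >= 0, 4 a^2 <= 4 <= r^2, and r^3 >= 8 > 6
     a^2. *)
  - apply brown_york_energy; [split|]; try lra.
    + unfold Delta; nra.
    + nra.
    + assert (r ^ 3 = r * r ^ 2) by ring.
      assert (4 <= r ^ 2) by nra; nra.
  - unfold r_plus in Hr.
    assert (Hs := sqrt_pos (1 - a ^ 2)).
    assert (Hs2 : sqrt (1 - a ^ 2) ^ 2 = 1 - a ^ 2) by (apply pow2_sqrt; lra).
    assert (H1 : 1 <= r) by lra.
    assert (Har : a <= r / 3).
    { apply (Rmult_le_compat_r r) in He; [|lra].
      unfold Rdiv in He; rewrite Rmult_assoc, Rinv_l in He; lra. }
    assert (Ha9 : 9 * a ^ 2 <= r ^ 2) by nra.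
    apply brown_york_energy; auto; split; try lra.
    (* Delta = (r - 1)^2 - (1 - a^2), and r - 1 is at least the square root of 1 - a^2. *)
    + assert (sqrt (1 - a ^ 2) ^ 2 <= (r - 1) ^ 2) by (apply pow_incr; lra).
      unfold Delta; lra.
    + assert (r ^ 3 = r * r ^ 2) by ring.
      assert (0 <= a ^ 2 * r) by (apply Rmult_le_pos; lra).
      nra.
Qed.
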